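(* Let $M$ be a compact, connected, orientable Riemannian manifold, with positive sectional curvatures, and dimension equal to $n$. For $T>0$ let $\pi_T$ be the Gibbs distribution $$\pi_T(dx)=(Z(T))^{-1}\exp\left[-\frac{U(x)}{T}\right]\mathrm{vol}(dx)$$ where the continuous potential $U:M\to\mathbb{R}$ has a unique global minimum at $x^*\in M$, and there exist $\mu_{\min},\mu_{\max}>0$ and $\rho>0$ such that $$\mu_{\min}\,d^{2}(x,x^* )\leq 2(U(x)-U(x^* ))\leq\mu_{\max}\,d^{2}(x,x^* )\qquad\text{whenever } d(x,x^* )\leq\rho .$$ (i) Let $\eta>0$. For any Riemannian barycentre $\hat{x}_T$ of $\pi_T$, $$W(\pi_T,\delta_{x^*})<\frac{\eta^2}{4\,\mathrm{diam}\,M}\;\Longrightarrow\; d(\hat{x}_T,x^* )<\eta .$$ (ii) There exists a temperature $T_W>0$ such that $T\leq T_W$ implies $$W(\pi_T,\delta_{x^*})\leq(8\pi)^{\frac12}\,B_n^{-1}\left(\frac{\pi}{2}\right)^{n-1}\left(\frac{\mu_{\max}}{\mu_{\min}}\right)^{\frac n2}\left(\frac{T}{\mu_{\min}}\right)^{\frac12},$$ where $B_n=B(1/2,n/2)$ in terms of the Euler Beta function.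
   Context: $d$ is the Riemannian distance, $\mathrm{vol}$ the Riemannian volume, $Z(T)$ the normalising constant and $\mathrm{diam}\,M$ the diameter of $M$. $W$ denotes the Kantorovich ($L^1$-Wasserstein) distance and $\delta_{x^*}$ the Dirac distribution at $x^*$. A Riemannian barycentre of a probability distribution $\pi$ on $M$ is any global minimiser of the variance function $\mathcal{E}_\pi(y)=\frac12\int_M d^{2}(y,x)\,\pi(dx)$. *)

(* Defs.v *)
From HB Require Import structures.
From mathcomp Require Import all_boot all_order all_algebra.
From mathcomp Require Import all_classical all_reals all_analysis.
Set Implicit Arguments.
Unset Strict Implicit.
Unset Printing Implicit Defensive.
Import Order.TTheory GRing.Theory Num.Theory.
Import numFieldNormedType.Exports.
Local Open Scope classical_set_scope.
Local Open Scope ring_scope.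

Definition partial (R : realType) (n : nat) (i : 'I_n) (f : 'rV[R]_n -> R) :
  'rV[R]_n -> R := fun x => derive f x (delta_mx 0 i).

(* [U] is meant to be open; [f] is unconstrained outside [U]. *)
Fixpoint Ck_on (R : realType) (n : nat) (k : nat) (U : set 'rV[R]_n)
    (f : 'rV[R]_n -> R) : Prop :=
  match k with
  | 0 => forall x, U x -> {for x, continuous f}
  | k'.+1 => forall i : 'I_n,
      (forall x, U x -> derivable f x (delta_mx 0 i)) /\
      Ck_on k' U (partial i f)
  end.

Definition smooth_on (R : realType) (n : nat) (U : set 'rV[R]_n)
    (f : 'rV[R]_n -> R) : Prop := forall k, Ck_on k U f.

Record chart (R : realType) (n : nat) (M : topologicalType) := Chart {
  chart_dom : set M;
  chart_map : M -> 'rV[R]_n;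
  chart_inv : 'rV[R]_n -> M;
  chart_dom_open : open chart_dom;
  chart_cod_open : open (chart_map @` chart_dom);
  chart_mapK : forall x, chart_dom x -> chart_inv (chart_map x) = x;
  chart_map_continuous :
    forall x, chart_dom x -> {for x, continuous chart_map};
  chart_inv_continuous :
    forall v, (chart_map @` chart_dom) v -> {for v, continuous chart_inv} }.

Definition chart_cod (R : realType) (n : nat) (M : topologicalType)
  (c : chart R n M) : set 'rV[R]_n := chart_map c @` chart_dom c.

Definition overlap (R : realType) (n : nat) (M : topologicalType)
  (c c' : chart R n M) : set 'rV[R]_n :=
  chart_map c @` (chart_dom c `&` chart_dom c').

Definition transition (R : realType) (n : nat) (M : topologicalType)
  (c c' : chart R n M) : 'rV[R]_n -> 'rV[R]_n :=
  fun v => chart_map c' (chart_inv c v).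

Definition compatible (R : realType) (n : nat) (M : topologicalType)
    (c c' : chart R n M) : Prop :=
  (forall i : 'I_n, smooth_on (overlap c c') (fun v => transition c c' v 0 i))
  /\
  (forall i : 'I_n, smooth_on (overlap c' c) (fun v => transition c' c v 0 i)).

(* The atlas is indexed by the points of M, the chart of index p being one
   around p: every atlas contains a subatlas of this form, which determines
   the same smooth structure. *)
Record smooth_manifold (R : realType) (n : nat) (M : topologicalType) :=
  SmoothManifold {
    chart_at : M -> chart R n M;
    mem_chart_at : forall p, chart_dom (chart_at p) p;
    chart_at_compatible : forall p q, compatible (chart_at p) (chart_at q);
    manifold_hausdorff : hausdorff_space M;
    manifold_second_countable : @second_countable M }.

Definition orientable (R : realType) (n : nat) (M : topologicalType)
    (X : smooth_manifold R n M) : Prop :=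
  exists B : set (chart R n M),
    [/\ forall p, exists2 c, B c & chart_dom c p,
        forall c p, B c -> compatible c (chart_at X p)
      & forall c c', B c -> B c' -> compatible c c' /\
          forall v, overlap c c' v ->
            0 < \det (jacobian (transition c c') v)].

(* A smooth (0,2)-tensor field given by its matrices in the charts. Tangent
   vectors are rows, so the differential of a map f at v is
   [u |-> u *m jacobian f v]; this fixes the side of the transposition in
   [metric_transition]. *)
Record riemannian_metric (R : realType) (n : nat) (M : topologicalType)
    (X : smooth_manifold R n M) := RiemannianMetric {
  metric : M -> 'rV[R]_n -> 'M[R]_n;
  metric_smooth : forall p i j,
    smooth_on (chart_cod (chart_at X p)) (fun v => metric p v i j);
  metric_sym : forall p v, chart_cod (chart_at X p) v ->
    (metric p v)^T = metric p v;
  metric_posdef : forall p v, chart_cod (chart_at X p) v ->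
    forall u : 'rV[R]_n, u != 0 -> 0 < (u *m metric p v *m u^T) 0 0;
  metric_transition : forall p q v,
    overlap (chart_at X p) (chart_at X q) v ->
    let J := jacobian (transition (chart_at X p) (chart_at X q)) v in
    metric p v =
      J *m metric q (transition (chart_at X p) (chart_at X q) v) *m J^T }.

Section curvature.
Context (R : realType) (n : nat) (g : 'rV[R]_n -> 'M[R]_n).

Definition inner (x u v : 'rV[R]_n) : R := (u *m g x *m v^T) 0 0.

(* Gamma^k_(ij) *)
Definition christoffel (i j k : 'I_n) (x : 'rV[R]_n) : R :=
  2^-1 * \sum_(l < n) invmx (g x) k l *
    (partial i (fun y => g y j l) x + partial j (fun y => g y i l) x
     - partial l (fun y => g y i j) x).

(* The l-th component of R(e_i, e_j) e_k, where
   R(u, v) w = D_u D_v w - D_v D_u w - D_[u,v] w *)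
Definition curvature_coef (i j k l : 'I_n) (x : 'rV[R]_n) : R :=
  partial i (christoffel j k l) x - partial j (christoffel i k l) x
  + \sum_(m < n) (christoffel i m l x * christoffel j k m x
                  - christoffel j m l x * christoffel i k m x).

Definition curvature (x u v w : 'rV[R]_n) : 'rV[R]_n :=
  \row_(l < n) \sum_(i < n) \sum_(j < n) \sum_(k < n)
    u 0 i * v 0 j * w 0 k * curvature_coef i j k l x.

Definition sectional_curvature (x u v : 'rV[R]_n) : R :=
  inner x (curvature x u v v) u /
  (inner x u u * inner x v v - inner x u v ^+ 2).

End curvature.

Definition positive_sectional_curvature (R : realType) (n : nat)
    (M : topologicalType) (X : smooth_manifold R n M)
    (g : riemannian_metric X) : Prop :=
  forall p x, chart_cod (chart_at X p) x ->
  forall u v : 'rV[R]_n, row_free (col_mx u v) ->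
  0 < sectional_curvature (metric g p) x u v.

Section riemannian_distance.
Context (R : realType) (n : nat) (M : topologicalType).
Context (X : smooth_manifold R n M) (g : riemannian_metric X).

(* C^1 on a neighbourhood of each point of [a, b], i.e. the restriction to
   [a, b] of a C^1 curve on a larger open interval *)
Definition C1_arc (c : R -> M) (a b : R) : Prop :=
  a <= b /\
  forall t, a <= t <= b ->
    {for t, continuous c} /\
    forall p, chart_dom (chart_at X p) (c t) ->
      let x := fun s : R => chart_map (chart_at X p) (c s) in
      (\forall s \near t, derivable x s 1) /\ {for t, continuous (derive1 x)}.

Definition speed (c : R -> M) (t : R) : R :=
  let p := c t in
  let phi := chart_map (chart_at X p) in
  let u : 'rV[R]_n := derive1 (fun s : R => phi (c s)) t in
  Num.sqrt (inner (metric g p) (phi p) u u).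

Definition arc_length (c : R -> M) (a b : R) : R :=
  \int[lebesgue_measure]_(t in `[a, b]) speed c t.

(* [path_length x y l]: some piecewise C^1 curve from x to y, given as a
   chain of C^1 arcs, has length l. *)
Inductive path_length : M -> M -> R -> Prop :=
| path_nil x : path_length x x 0
| path_cons c a b y l : C1_arc c a b -> path_length (c b) y l ->
    path_length (c a) y (arc_length c a b + l).

Definition rdist (x y : M) : R := inf [set l | path_length x y l].

Definition diameter : R :=
  sup [set r | exists x y : M, r = rdist x y].

End riemannian_distance.

Notation borel M := (g_sigma_algebraType (@open M)).

(* The Lebesgue integral over R^n, as an iterated integral; it is only applied
   to nonnegative Borel functions, for which this is Tonelli's theorem. *)
Fixpoint integral_rV (R : realType) (n : nat) :
    ('rV[R]_n -> \bar R) -> \bar R :=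
  match n with
  | 0 => fun f => f 0
  | m.+1 => fun f =>
      (\int[lebesgue_measure]_(t in [set: R])
         integral_rV (fun v : 'rV[R]_m => f (row_mx (t%:M : 'rV[R]_1) v)))%E
  end.

(* This determines vol, since M is covered by countably many chart domains. *)
Definition is_riemannian_volume (R : realType) (n : nat)
    (M : ptopologicalType) (X : smooth_manifold R n M)
    (g : riemannian_metric X) (vol : {measure set (borel M) -> \bar R}) :
    Prop :=
  forall p (A : set (borel M)), measurable A ->
    A `<=` chart_dom (chart_at X p) ->
    vol A = integral_rV (fun v =>
      (\1_(chart_map (chart_at X p) @` A) v *
       Num.sqrt (\det (metric g p v)))%:E).

Section probability_on_M.
Context (R : realType) (n : nat) (M : ptopologicalType).
Context (X : smooth_manifold R n M) (g : riemannian_metric X).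

Definition partition_function (vol : {measure set (borel M) -> \bar R})
    (U : M -> R) (T : R) : R :=
  \int[vol]_(x in [set: borel M]) expR (- (U x / T)).

Definition gibbs (vol : {measure set (borel M) -> \bar R})
    (U : M -> R) (T : R) (A : set (borel M)) : \bar R :=
  (((partition_function vol U T)^-1)%:E *
   \int[vol]_(x in A) (expR (- (U x / T)))%:E)%E.

Definition coupling (mu nu : probability (borel M) R)
    (q : probability (borel M * borel M)%type R) : Prop :=
  forall A : set (borel M), measurable A ->
    q (A `*` [set: borel M]) = mu A /\ q ([set: borel M] `*` A) = nu A.

Definition kantorovich (mu nu : probability (borel M) R) : \bar R :=
  ereal_inf [set (\int[q]_(z in [set: borel M * borel M])
                    (rdist g z.1 z.2)%:E)%E | q in coupling mu nu].

Definition variance_function (mu : probability (borel M) R) (y : M) : \bar R :=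
  ((2^-1)%:E * \int[mu]_(x in [set: borel M]) (rdist g y x ^+ 2)%:E)%E.

Definition is_barycentre (mu : probability (borel M) R) (x : M) : Prop :=
  forall y, (variance_function mu x <= variance_function mu y)%E.

End probability_on_M.

(* The Euler Beta function; the library's [beta_fun] has natural arguments. *)
Definition euler_beta (R : realType) (a b : R) : R :=
  \int[lebesgue_measure]_(t in `]0, 1[) (t `^ (a - 1) * (1 - t) `^ (b - 1)).

(* Main.v *)
Require Import Defs.
From HB Require Import structures.
From mathcomp Require Import all_boot all_order all_algebra.
From mathcomp Require Import all_classical all_reals all_analysis.
From mathcomp Require Import perm measurable_realfun ring lra.
Import Order.TTheory GRing.Theory Num.Theory.
Import numFieldNormedType.Exports.
Set Implicit Arguments.
Unset Strict Implicit.
Unset Printing Implicit Defensive.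
Local Open Scope classical_set_scope.
Local Open Scope ring_scope.

(* A coupling with a Dirac distribution is a product, so that
   W(pi_T, delta_x) is the mean of d(., x).

   (i) If y is a barycentre, D the diameter and w the mean of d(., x), then
   E d(y, .)^2 <= E d(x, .)^2 <= D w. Together with
   d(y, x)^2 <= d(y, .)^2 + 2 D d(., x) this gives d(y, x)^2 <= 3 D w.

   (ii) The constant K of the bound is large enough for E d(., x)^2 <= K^2,
   which is a Laplace estimate with room to spare, as B(1/2, n/2) <= 4 and
   pi >= 3. Hence no comparison theorem is needed: it suffices that the volume
   of a small ball is C r^n up to a factor close to 1. Since d is only compared
   with the norm of a chart near x, this is obtained from the length of curves
   in that chart. Contracting the balls by sqrt(mumin / mumax) compares the
   gaussian integrals of parameters mumin / T and mumax / T, and the second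
   moment of a gaussian is controlled because the gaussian integral is a convex
   function of its parameter. *)

(** * Calculus on row vectors and in charts *)

(** Volumes of balls enter (ii) only through ratios between the radii r and q r, so the constant C
    cancels and is never identified, and an error factor 101/100 can be fixed once and for all. The
    room for such losses is visible in the exponents: Laplace's method predicts a second moment of
    at most about n (mumax / mumin)^(n/2) T / mumin, whereas the square of the bound is at least 3/2
    (9/4)^(n-1) (mumax / mumin)^n T / mumin, and 3/2 (9/4)^(n-1) exceeds n. The mass away from the
    minimum is exponentially small; it is given a share 1/10 of the coefficient 3/2. Volumes are
    iterated integrals of functions whose measurability in each variable is not at hand.
    Monotonicity, scaling and affine changes of variable are therefore derived from the simple
    functions below the integrand. *)

Section rV_calculus.
Context {R : realType}.

Lemma rV_coord_norm n (v : 'rV[R]_n) i : `|v 0 i| <= `|v|.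
Proof.
rewrite [leRHS]/Num.norm /= mx_normrE.
by apply: (le_bigmax _ (fun ij : 'I_1 * 'I_n => `|v ij.1 ij.2|) (0, i)).
Qed.

Lemma rV_norm_le n (v : 'rV[R]_n) (e : R) :
  0 <= e -> (forall i, `|v 0 i| <= e) -> `|v| <= e.
Proof.
move=> e0 H; rewrite [leLHS]/Num.norm /= mx_normrE.
by apply: bigmax_le => // -[i j] _ /=; rewrite (ord1 i).
Qed.

Lemma rV_norm_lt n (v : 'rV[R]_n) (e : R) :
  0 < e -> (forall i, `|v 0 i| < e) -> `|v| < e.
Proof.
move=> e0 H; rewrite [ltLHS]/Num.norm /= mx_normrE.
by apply: bigmax_lt => // -[i j] _ /=; rewrite (ord1 i).
Qed.

Lemma derivable_line n (f : 'rV[R]_n -> R) (v e : 'rV[R]_n) (t : R) :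
  derivable f (v + t *: e) e -> is_derive t 1 (fun s : R => f (v + s *: e))
   (derive f (v + t *: e) e).
Proof.
move=> df.
have E : (fun h : R => h^-1 *: (f (h *: e + (v + t *: e)) - f (v + t *: e))) =
  (fun h : R => h^-1 *: (f (v + (h *: 1 + t) *: e) - f (v + t *: e))).
  apply/funext => h; congr (_ *: (f _ - _)).
  by rewrite scaler1 scalerDl addrCA addrA.
split.
  by move: df; rewrite /derivable /= E.
by rewrite /derive /= E.
Qed.

Lemma partial_mvt n (f : 'rV[R]_n -> R) (v : 'rV[R]_n) (i : 'I_n) (t e : R) :
  (forall s, `|s| <= `|t| -> derivable f (v + s *: delta_mx 0 i) (delta_mx 0 i)
     /\ `|partial i f (v + s *: delta_mx 0 i)| <= e) ->
  `|f (v + t *: delta_mx 0 i) - f v| <= e * `|t|.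
Proof.
move=> H.
pose F := fun s : R => f (v + s *: delta_mx 0 i).
have F0 : F 0 = f v by rewrite /F scale0r addr0.
have dF (s : R) : `|s| <= `|t| ->
   is_derive s 1 F (partial i f (v + s *: delta_mx 0 i)).
  by move=> /H[ds _]; exact: derivable_line.
have mvt (a b : R) : a <= b -> `|a| <= `|t| -> `|b| <= `|t| ->
   `|F b - F a| <= e * `|b - a|.
  move=> ab at_ bt.
  have sub (s : R) : a <= s <= b -> `|s| <= `|t|.
    move=> /andP[as_ sb]; move: at_ bt; rewrite !ler_norml => /andP[ta _] /andP[_ bt].
    by rewrite (le_trans ta as_) (le_trans sb bt).
  have [] := @MVT_segment R F (fun s => partial i f (v + s *: delta_mx 0 i)) a b ab.
  - move=> s; rewrite in_itv /= => /andP[a1 b1]; apply: dF; apply: sub.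
    by rewrite !ltW.
  - apply: derivable_within_continuous => s; rewrite in_itv /= => /sub sH.
    by have [] := dF _ sH.
  - move=> c; rewrite in_itv /= => /sub cH ->.
    rewrite normrM; apply: ler_wpM2r => //.
    by have [] := H _ cH.
rewrite -F0 -/(F t).
have [t0|t0] := leP 0 t.
  by have := mvt 0 t t0; rewrite subr0; apply; rewrite ?normr0.
rewrite distrC; have := mvt t 0 (ltW t0); rewrite sub0r normrN; apply => //.
by rewrite normr0.
Qed.

(** One coordinate is changed at a time: [T k] keeps the first k coordinates of h, and each change
    costs at most e |h| by the mean value theorem. In the sup norm all intermediate points stay
    within |h| of v. *)
Lemma small_partials n (f : 'rV[R]_n -> R) (v : 'rV[R]_n) (d e : R) : 0 <= e ->
  (forall w, `|w - v| < d -> forall i, derivable f w (delta_mx 0 i) /\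
     `|partial i f w| <= e) ->
  forall h, `|h| < d -> `|f (v + h) - f v| <= n%:R * e * `|h|.
Proof.
move=> e0 H h hd.
pose T k := \row_(i < n) (if (i < k)%N then h 0 i else 0).
have Tle k : `|T k| <= `|h|.
  apply: rV_norm_le => // i; rewrite mxE; case: ifP => _.
    exact: rV_coord_norm.
  by rewrite normr0.
suff S k : (k <= n)%N -> `|f (v + T k) - f v| <= k%:R * e * `|h|.
  have -> : h = T n.
    by apply/rowP => i; rewrite mxE ltn_ord.
  apply: le_trans (S n (leqnn n)) _; apply: ler_wpM2l.
    by rewrite mulr_ge0.
  have -> // : T n = h by apply/rowP => i; rewrite mxE ltn_ord.
elim: k => [_|k IH kn].
  have -> : T 0%N = 0 by apply/rowP => i; rewrite !mxE ltn0.
  by rewrite addr0 subrr normr0 !mul0r.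
pose i := Ordinal kn.
have TS : T k.+1 = T k + h 0 i *: delta_mx 0 i.
  apply/rowP => j; rewrite !mxE eqxx /= ltnS leq_eqVlt -val_eqE /=.
  case: ltngtP => //= jk; rewrite ?mulr0 ?addr0 ?mulr1 ?add0r //.
  by congr (h 0 _); apply/val_inj.
have -> : f (v + T k.+1) - f v =
  (f (v + T k + h 0 i *: delta_mx 0 i) - f (v + T k)) + (f (v + T k) - f v).
  by rewrite TS !addrA subrK.
apply: le_trans (ler_normD _ _) _.
rewrite -[k.+1%:R]natr1 2!mulrDl addrC mul1r.
apply: lerD; first exact: IH (ltnW kn).
apply: (@le_trans _ _ (e * `|h 0 i|)); last first.
  by apply: ler_wpM2l => //; exact: rV_coord_norm.
apply: partial_mvt => s sh; apply: H.
rewrite -(addrA v) (addrC v) addrK.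
apply: le_lt_trans hd; apply: rV_norm_le => // j; rewrite !mxE eqxx /=.
have [->|ji] := eqVneq j i.
  by rewrite /= ltnn add0r mulr1 (le_trans sh) // rV_coord_norm.
rewrite mulr0 addr0; case: ifP => _; first exact: rV_coord_norm.
by rewrite normr0.
Qed.

(** The candidate differential L has constant partial derivatives, those of f at v. Hence f - L has
    small partial derivatives near v, and [small_partials] turns this into the first-order
    expansion. *)
Lemma C1_differentiable n (U : set 'rV[R]_n) (f : 'rV[R]_n -> R) (v : 'rV[R]_n) :
  open U -> U v -> Ck_on 1 U f -> differentiable f v.
Proof.
move=> oU Uv C1.
pose L := fun h : 'rV[R]_n => \sum_(i < n) h 0 i * partial i f v.
have Llin : linear L.
  move=> a x y; rewrite /L scaler_sumr -big_split /=; apply: eq_bigr => i _.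
  by rewrite !mxE mulrDl -mulrA.
pose LL := GRing.isLinear.Build _ _ _ _ L Llin.
pose l : {linear 'rV[R]_n -> R} := HB.pack L LL.
have lc : continuous l.
  move=> x; apply: differentiable_continuous.
  have -> : (l : _ -> _) = \sum_(i < n) (fun h : 'rV[R]_n => h 0 i * partial i f v).
    by apply/funext => h; rewrite fct_sumE.
  apply: differentiable_sum => i.
  by apply: differentiableM => //; exact: differentiable_coord.
have lD x y : L (x + y) = L x + L y by apply: (linearD l).
suff E : f \o shift v = cst (f v) + l +o_ (0 : 'rV[R]_n) id.
  by apply/diff_locallyP; rewrite (diff_unique lc E).
apply/eqaddoP => e e0 /=.
have [C0 C1v] : (forall i, (\forall w \near v, derivable f w (delta_mx 0 i))) /\
    (forall i, {for v, continuous (partial i f)}).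
  split=> i; have [D C] := C1 i.
    by apply: filterS (open_nbhs_nbhs (conj oU Uv)) => w /D.
  exact: C.
(* Adding 1 to n keeps the denominator positive in dimension 0. *)
pose eps := e / (n%:R + 1).
have n1 : 0 < n%:R + 1 :> R by rewrite ltr_wpDl.
have eps0 : 0 < eps by rewrite divr_gt0.
have : \forall w \near v, (forall i, derivable f w (delta_mx 0 i) /\
   `|partial i f w - partial i f v| <= eps).
  apply: (@filter_forall _ _ (fun i w => derivable f w (delta_mx 0 i) /\
    `|partial i f w - partial i f v| <= eps) (nbhs v) _) => i.
  apply: filterI; first exact: C0.
  have /cvgrPdist_le /(_ eps eps0) := C1v i.
  by apply: filterS => w; rewrite distrC.
move=> /nbhs_ballP[d /= d0 Hd].
near=> h.
have hd : `|h| < d.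
  near: h; apply/nbhs_ballP; exists d => //= w; rewrite -ball_normE /= sub0r.
  by rewrite normrN.
have Lp i w : derivable L w (delta_mx 0 i).
  by apply: diff_derivable; rewrite -[L]/(l : _ -> _); apply: linear_differentiable.
have Ldp i w : partial i L w = partial i f v.
  rewrite /partial deriveE; last by rewrite -[L]/(l : _ -> _); apply: linear_differentiable.
  rewrite -[L]/(l : _ -> _) diff_lin // /= /L (bigD1 i) //= big1.
    by rewrite mxE !eqxx mul1r addr0.
  by move=> j ji; rewrite mxE eqxx (negbTE ji) mul0r.
have := @small_partials n (f - L) v d eps (ltW eps0) _ h hd.
rewrite !fctE.
have -> : f (v + h) - L (v + h) - (f v - L v) = (f \o shift v - (cst (f v) + l)) h.
  rewrite -[RHS]/(f (h + v) - (f v + L h)) (addrC h v) lD; ring.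
move=> /(_ _); set X := `| _ |; move=> HX.
apply: le_trans (HX _) _.
  move=> w wv i.
  have [] := Hd w _ i; first by rewrite -ball_normE /= distrC.
  move=> dw lw; split; first exact: derivableB.
  by rewrite /partial deriveB // -[X in _ - X]/(partial i L w) Ldp.
apply: ler_wpM2r => //.
rewrite /eps mulrA ler_pdivrMr // [leRHS]mulrDr mulr1 mulrC lerDl; exact: ltW.
Unshelve. all: by end_near. Qed.

Lemma rV_differentiable (V : normedModType R) n (F : V -> 'rV[R]_n) (v : V) :
  (forall j, differentiable (fun w => F w 0 j) v) -> differentiable F v.
Proof.
move=> H.
have -> : F = fun w => \sum_(j < n) F w 0 j *: (delta_mx 0 j : 'rV[R]_n).
  by apply/funext => w; rewrite -row_sum_delta.
have -> : (fun w => \sum_(j < n) F w 0 j *: (delta_mx 0 j : 'rV[R]_n)) =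
  \sum_(j < n) (fun w => F w 0 j *: (delta_mx 0 j : 'rV[R]_n)).
  by apply/funext => w; rewrite fct_sumE.
apply: differentiable_sum => j; exact: differentiableZl.
Qed.

Lemma rV_continuous (T : topologicalType) n (F : T -> 'rV[R]_n) (v : T) :
  (forall j, {for v, continuous (fun w => F w 0 j)}) -> {for v, continuous F}.
Proof.
move=> H; apply/cvgrPdist_lt => e e0.
have : \forall w \near v, (forall j, `|F v 0 j - F w 0 j| < e).
  apply: (@filter_forall _ _ (fun j w => `|F v 0 j - F w 0 j| < e) (nbhs v) _) => j.
  by have /cvgrPdist_lt /(_ e e0) := H j.
by apply: filterS => w Hw; apply: rV_norm_lt => // j; rewrite !mxE.
Qed.

Lemma coord_continuous_at (T : topologicalType) n (F : T -> 'rV[R]_n) (v : T) j :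
  {for v, continuous F} -> {for v, continuous (fun w => F w 0 j)}.
Proof.
move=> H; apply/cvgrPdist_lt => e e0; have /cvgrPdist_lt /(_ e e0) := H.
apply: filterS => w; apply: le_lt_trans.
have -> : F v 0 j - F w 0 j = (F v - F w) 0 j by rewrite !mxE.
exact: rV_coord_norm.
Qed.

Lemma derive1_comp_rV n m (F : 'rV[R]_n -> 'rV[R]_m) (x : R -> 'rV[R]_n) t :
  derivable x t 1 -> differentiable F (x t) ->
  derivable (F \o x) t 1 /\ derive1 (F \o x) t = derive1 x t *m jacobian F (x t).
Proof.
move=> dx dF; have dx' := dx; move/derivable1_diffP in dx.
have dc : differentiable (F \o x) t by exact: differentiable_comp.
split; first by apply/derivable1_diffP.
rewrite derive1E deriveE // diff_comp //=.
by rewrite deriv1E //= scale1r -deriveEjacobian // deriveE.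
Qed.

End rV_calculus.

Lemma near_near (T : topologicalType) (x : T) (P : T -> Prop) :
  (\near x, P x) -> \forall y \near x, \forall z \near y, P z.
Proof. by move=> /nbhs_interior. Qed.

Lemma near_eq_continuous (T U : topologicalType) (f h : T -> U) (t : T) :
  (\forall s \near t, f s = h s) -> {for t, continuous f} ->
  {for t, continuous h}.
Proof.
move=> E C; have Et : f t = h t := nbhs_singleton E.
move: C; rewrite /prop_for /continuous_at Et => C.
by apply: cvg_trans C; exact: near_eq_cvg.
Qed.

Lemma continuous_sum {R : realType} (T : topologicalType) (I : finType)
  (F : I -> T -> R) (t : T) :
  (forall i, {for t, continuous (F i)}) ->
  {for t, continuous (fun s => \sum_i F i s)}.
Proof.
move=> H; apply: (@cvg_big _ _ _ _ _ _ _ _ _ F (fun i => F i t)) => [|i _].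
  exact: add_continuous.
exact: H.
Qed.

Lemma continuous_mul {R : realType} (T : topologicalType) (f h : T -> R) (t : T) :
  {for t, continuous f} -> {for t, continuous h} ->
  {for t, continuous (fun s => f s * h s)}.
Proof. by move=> cf chh; exact: cvgM. Qed.

Lemma continuous_compose (T U V : topologicalType) (f : T -> U) (h : U -> V) t :
  {for t, continuous f} -> {for f t, continuous h} ->
  {for t, continuous (fun s => h (f s))}.
Proof. exact: continuous_comp. Qed.

Section charts.
Context {R : realType} {n : nat} {M : topologicalType}.
Implicit Types c : chart R n M.

Lemma transition_chart c c' x : chart_dom c x ->
  transition c c' (chart_map c x) = chart_map c' x.
Proof. by move=> cx; rewrite /transition chart_mapK. Qed.

Lemma open_overlap c c' : open (overlap c c').
Proof.
rewrite openE => _ [x [cx c'x] <-].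
have codx : chart_cod c (chart_map c x) by exists x.
have /chart_inv_continuous ci := codx.
have : \forall w \near chart_map c x, chart_dom c' (chart_inv c w).
  apply: ci; apply: open_nbhs_nbhs; split; first exact: chart_dom_open.
  by rewrite chart_mapK.
have : \forall w \near chart_map c x, chart_cod c w.
  by apply: open_nbhs_nbhs; split => //; exact: chart_cod_open.
apply: filterS2 => _ [y cy <-].
by rewrite chart_mapK // => c'y; exists y.
Qed.

Lemma chart_cod_near c x : chart_dom c x ->
  \forall w \near chart_map c x, chart_cod c w.
Proof.
by move=> cx; apply: open_nbhs_nbhs; split; [exact: chart_cod_open | exists x].
Qed.

Lemma chart_invK c v : chart_cod c v ->
  chart_dom c (chart_inv c v) /\ chart_map c (chart_inv c v) = v.
Proof. by move=> [x cx <-]; rewrite chart_mapK. Qed.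

End charts.
Arguments open_overlap {R n M} c c'.

(** * Regularity and speed of curves, read in charts *)

Section curves.
Context {R : realType} {n : nat} {M : topologicalType}.
Context {X : smooth_manifold R n M} (g : riemannian_metric X).
Local Notation ch := (chart_at X).
Local Notation dom p := (chart_dom (chart_at X p)).
Local Notation phi p := (chart_map (chart_at X p)).

Lemma transition_C1 p q i : Ck_on 1 (overlap (ch p) (ch q))
  (fun v => transition (ch p) (ch q) v 0 i).
Proof. by have [H _] := chart_at_compatible X p q; exact: H. Qed.

Lemma transition_differentiable p q v : overlap (ch p) (ch q) v ->
  differentiable (transition (ch p) (ch q)) v.
Proof.
move=> pqv; apply: rV_differentiable => j.
exact: (C1_differentiable (open_overlap (ch p) (ch q)) pqv (@transition_C1 p q j)).
Qed.

Lemma jacobianE (F : 'rV[R]_n -> 'rV[R]_n) v i j : differentiable F v ->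
  jacobian F v i j = partial i (fun w => F w 0 j) v.
Proof.
move=> dF; have := deriveEjacobian (delta_mx 0 i) dF.
rewrite -rowE derive_mx; last exact: diff_derivable.
by move=> /rowP /(_ j); rewrite !mxE.
Qed.

Lemma jacobian_transition_continuous p q v i j : overlap (ch p) (ch q) v ->
  {for v, continuous (fun w => jacobian (transition (ch p) (ch q)) w i j)}.
Proof.
move=> pqv; have [_ /(_ v pqv) C] := @transition_C1 p q j i.
have E : \forall w \near v, partial i (fun w => transition (ch p) (ch q) w 0 j) w
    = jacobian (transition (ch p) (ch q)) w i j.
  have := open_nbhs_nbhs (conj (open_overlap (ch p) (ch q)) pqv).
  by apply: filterS => w /transition_differentiable /jacobianE ->.
exact: near_eq_continuous E C.
Qed.

(** Regularity read in a single chart, in contrast with [C1_at], which quantifies over all charts at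
    the point. The two are equivalent because transition maps are smooth, so one convenient chart is
    enough to check an arc. *)
Definition chart_C1 (c : R -> M) p (t : R) : Prop :=
  [/\ \forall s \near t, dom p (c s),
      \forall s \near t, derivable (fun s : R => phi p (c s)) s 1 &
      {for t, continuous (derive1 (fun s : R => phi p (c s)))}].

Lemma chart_curve_continuous (c : R -> M) p (t : R) :
  (\forall s \near t, dom p (c s)) ->
  derivable (fun s : R => phi p (c s)) t 1 -> {for t, continuous c}.
Proof.
move=> dp dx.
have xc : {for t, continuous (fun s : R => phi p (c s))}.
  by apply: differentiable_continuous; exact/derivable1_diffP.
have ic : {for phi p (c t), continuous (chart_inv (ch p))}.
  by apply: chart_inv_continuous; exists (c t) => //; exact: (nbhs_singleton dp).
have E : \forall s \near t, chart_inv (ch p) (phi p (c s)) = c s.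
  by apply: filterS dp => s; exact: chart_mapK.
apply: (@near_eq_continuous _ _ (fun s => chart_inv (ch p) (phi p (c s))) c t E).
exact: (@continuous_compose _ _ _ (fun s : R => phi p (c s)) (chart_inv (ch p))).
Qed.

Lemma chart_change (c : R -> M) p q (t : R) :
  (\forall s \near t, dom p (c s)) -> dom q (c t) ->
  derivable (fun s : R => phi p (c s)) t 1 ->
  derivable (fun s : R => phi q (c s)) t 1 /\
  derive1 (fun s : R => phi q (c s)) t =
    derive1 (fun s : R => phi p (c s)) t *m
      jacobian (transition (ch p) (ch q)) (phi p (c t)).
Proof.
move=> dp dq dx.
have pt := nbhs_singleton dp.
have [] := @derive1_comp_rV R n n (transition (ch p) (ch q)) _ t dx.
  by apply: transition_differentiable; exists (c t).
set F := _ \o _ => dF DF.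
have E : {near t, F =1 (fun s : R => phi q (c s))}.
  by apply: filterS dp => s ps; rewrite /F /= transition_chart.
split; first exact: near_eq_derivable dF.
by rewrite -DF !derive1E; apply/esym/near_eq_derive.
Qed.

(** [speed] uses the chart attached to the point [c t], which varies with t. The transformation law
    of the metric allows one fixed chart instead, as continuity in t requires. *)
Lemma speed_chart (c : R -> M) p (t : R) :
  (\forall s \near t, dom p (c s)) ->
  derivable (fun s : R => phi p (c s)) t 1 ->
  speed g c t = let u := derive1 (fun s : R => phi p (c s)) t in
    Num.sqrt (inner (metric g p) (phi p (c t)) u u).
Proof.
move=> dp dx /=.
have pt := nbhs_singleton dp.
have [_ D] := chart_change dp (mem_chart_at X (c t)) dx.
rewrite /speed D /inner (metric_transition g (p := p) (q := c t)); last first.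
  by exists (c t) => //; split => //; exact: mem_chart_at.
by rewrite transition_chart // trmx_mul !mulmxA.
Qed.

Lemma metric_continuous p v i j : chart_cod (ch p) v ->
  {for v, continuous (fun w => metric g p w i j)}.
Proof. by move=> pv; exact: (metric_smooth g p i j 0%N v pv). Qed.

Lemma innerE (G : 'rV[R]_n -> 'M[R]_n) x u v :
  inner G x u v = \sum_(i < n) \sum_(j < n) u 0 i * v 0 j * G x i j.
Proof.
rewrite /inner mxE exchange_big /=; apply: eq_bigr => j _.
rewrite mxE big_distrl /=; apply: eq_bigr => i _.
by rewrite mxE mulrAC.
Qed.

Lemma chart_C1_speed_continuous (c : R -> M) p (t : R) :
  chart_C1 c p t -> {for t, continuous (speed g c)}.
Proof.
move=> [dp dx cx].
have pt := nbhs_singleton dp.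
have xc : {for t, continuous (fun s : R => phi p (c s))}.
  by apply: differentiable_continuous; exact/derivable1_diffP/(nbhs_singleton dx).
pose S := fun s : R => Num.sqrt (inner (metric g p) (phi p (c s))
  (derive1 (fun s : R => phi p (c s)) s) (derive1 (fun s : R => phi p (c s)) s)).
have E : \forall s \near t, S s = speed g c s.
  have := near_near dp; apply: filterS2 dx => s dx ps.
  by rewrite (speed_chart ps dx).
apply: (@near_eq_continuous _ _ S _ _ E).
have cS : {for t, continuous (fun s : R => \sum_(i < n) \sum_(j < n)
   derive1 (fun s : R => phi p (c s)) s 0 i *
   derive1 (fun s : R => phi p (c s)) s 0 j * metric g p (phi p (c s)) i j)}.
  apply: continuous_sum => i; apply: continuous_sum => j.
  apply: (@continuous_mul _ _ (fun s => derive1 (fun s : R => phi p (c s)) s 0 i *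
   derive1 (fun s : R => phi p (c s)) s 0 j) (fun s => metric g p (phi p (c s)) i j)).
    by apply: continuous_mul; exact: coord_continuous_at.
  apply: (@continuous_compose _ _ _ (fun s : R => phi p (c s))
    (fun w => metric g p w i j)) => //.
  by apply: metric_continuous; exists (c t).
have -> : S = fun s : R => Num.sqrt (\sum_(i < n) \sum_(j < n)
   derive1 (fun s : R => phi p (c s)) s 0 i *
   derive1 (fun s : R => phi p (c s)) s 0 j * metric g p (phi p (c s)) i j).
  by apply/funext => s; rewrite /S innerE.
exact: (continuous_compose cS (@sqrt_continuous _ _)).
Qed.

(** The condition that [C1_arc] imposes at each time, isolated so that it can be treated
    pointwise. *)
Definition C1_at (c : R -> M) (t : R) : Prop :=
  {for t, continuous c} /\
  forall p, dom p (c t) ->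
    let x := fun s : R => phi p (c s) in
    (\forall s \near t, derivable x s 1) /\ {for t, continuous (derive1 x)}.

Lemma C1_at_chart (c : R -> M) p (t : R) : C1_at c t -> dom p (c t) ->
  chart_C1 c p t.
Proof.
move=> [cc H] pt; have [dx cx] := H p pt; split => //.
by apply: cc; apply: open_nbhs_nbhs; split => //; exact: chart_dom_open.
Qed.

Lemma chart_C1_at (c : R -> M) p (t : R) : chart_C1 c p t -> C1_at c t.
Proof.
move=> [dp dx cx].
have pt := nbhs_singleton dp; have dxt := nbhs_singleton dx.
have cc : {for t, continuous c} by exact: chart_curve_continuous dp dxt.
have xc : {for t, continuous (fun s : R => phi p (c s))}.
  by apply: differentiable_continuous; exact/derivable1_diffP.
split; first exact: cc.
move=> q qt.
have dq : \forall s \near t, dom q (c s).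
  by apply: cc; apply: open_nbhs_nbhs; split => //; exact: chart_dom_open.
have ch_ : \forall s \near t, derivable (fun s : R => phi q (c s)) s 1 /\
  derive1 (fun s : R => phi q (c s)) s = derive1 (fun s : R => phi p (c s)) s *m
      jacobian (transition (ch p) (ch q)) (phi p (c s)).
  have := near_near dp; have := dx; have := dq; apply: filterS3 => s qs dxs ps.
  exact: chart_change.
split; first by apply: filterS ch_ => s [].
apply: rV_continuous => j.
pose D := fun s : R => \sum_(i < n) derive1 (fun s : R => phi p (c s)) s 0 i *
      jacobian (transition (ch p) (ch q)) (phi p (c s)) i j.
have E : \forall s \near t, D s = derive1 (fun s : R => phi q (c s)) s 0 j.
  by apply: filterS ch_ => s [_ ->]; rewrite mxE.
apply: (@near_eq_continuous _ _ D
  (fun s => derive1 (fun s : R => phi q (c s)) s 0 j) _ E).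
apply: continuous_sum => i.
apply: (@continuous_mul _ _ (fun s => derive1 (fun s : R => phi p (c s)) s 0 i)
  (fun s => jacobian (transition (ch p) (ch q)) (phi p (c s)) i j)).
  exact: (coord_continuous_at cx).
apply: (@continuous_compose _ _ _ (fun s : R => phi p (c s))
  (fun w => jacobian (transition (ch p) (ch q)) w i j)) => //.
by apply: jacobian_transition_continuous; exists (c t).
Qed.

Lemma C1_at_speed_continuous (c : R -> M) (t : R) : C1_at c t ->
  {for t, continuous (speed g c)}.
Proof.
by move=> /C1_at_chart /(_ (mem_chart_at X (c t))); exact: chart_C1_speed_continuous.
Qed.

End curves.

(** * Integrals along curves *)

Section real_integral.
Context {R : realType}.
Local Notation mu := (@lebesgue_measure R).
Implicit Types (a b s t u : R) (f h : R -> R).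

(** Cousin's lemma in the form of a continuous induction: a property of intervals that holds for
    small intervals around each point and is stable under concatenation holds for [a, b]. The
    supremum of the s with P a s is reached and cannot be less than b. *)
Lemma cousin (P : R -> R -> Prop) a b : a <= b ->
  (forall s t u, a <= s -> s <= t -> t <= u -> u <= b ->
     P s t -> P t u -> P s u) ->
  (forall t, a <= t <= b -> exists2 d, 0 < d & forall s u,
     a <= s -> s <= t -> t <= u -> u <= b -> t - d < s -> u < t + d -> P s u) ->
  P a b.
Proof.
move=> ab trP locP.
pose S : set R := [set s | a <= s <= b /\ P a s].
have Sa : S a.
  split; first by rewrite lexx ab.
  have [|d d0] := locP a; first by rewrite lexx ab.
  by apply => //; rewrite ?ltrDl // ltrBlDr ltrDl.
have Sb : has_ubound S by exists b => s [/andP[]].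
have hS : has_sup S by split => //; exists a.
have am : a <= sup S by exact: ub_le_sup.
have mb : sup S <= b by apply: ge_sup; [exists a | move=> s [/andP[]]].
set m := sup S in am mb.
have [|d d0 dP] := locP m; first by rewrite am mb.
have [s [/andP[as_ sb] Pas] ms] := sup_adherent d0 hS.
have sm : s <= m by apply: ub_le_sup => //; split => //; apply/andP.
pose u := Num.min b (m + d / 2).
have d20 : 0 < d / 2 by rewrite divr_gt0.
have mu_ : m <= u by rewrite le_min mb lerDl ltW.
have ub : u <= b by rewrite ge_min lexx.
have Psu : P s u.
  apply: dP => //; rewrite gt_min; apply/orP; right.
  by rewrite ltrD2l ltr_pdivrMr // ltr_pMr // ltr1n.
have Pau : P a u by apply: trP Pas Psu => //; apply: le_trans mu_.
have : u <= m.
  by apply: ub_le_sup => //; split => //; rewrite (le_trans am) //.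
rewrite /u ge_min => /orP[bm|]; last by rewrite gerDl leNgt d20.
have -> // : b = u.
apply/eqP; rewrite eq_le ub andbT; exact: le_trans mu_.
Qed.

Definition continuous_on f a b := forall t, a <= t <= b -> {for t, continuous f}.

Lemma continuous_onS f a b s u : a <= s -> u <= b -> continuous_on f a b ->
  continuous_on f s u.
Proof.
move=> as_ ub fc t /andP[st tu]; apply: fc.
by rewrite (le_trans as_ st) (le_trans tu ub).
Qed.

Lemma continuous_on_within f a b : continuous_on f a b ->
  {within `[a, b], continuous f}.
Proof.
move=> fc; apply: continuous_in_subspaceT => t; rewrite inE /= in_itv /=.
exact: fc.
Qed.

Lemma continuous_on_integrable f a b : continuous_on f a b ->
  mu.-integrable `[a, b] (EFin \o f).
Proof.
move=> fc; apply: continuous_compact_integrable; first exact: segment_compact.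
exact: continuous_on_within.
Qed.

Lemma Rintegral_split f a s b : a <= s -> s <= b -> continuous_on f a b ->
  \int[mu]_(x in `[a, b]) f x =
  \int[mu]_(x in `[a, s]) f x + \int[mu]_(x in `[s, b]) f x.
Proof.
move=> as_ sb fc.
have := @Rintegral_itvB R f (BLeft a) (BRight b) s (continuous_on_integrable fc).
rewrite !bnd_simp => /(_ as_ sb).
rewrite Rintegral_itv_obnd_cbnd => [<-|]; first by rewrite addrC subrK.
apply: integrableS (continuous_on_integrable fc) => //.
by apply: subset_itvr; rewrite bnd_simp.
Qed.

Lemma Rintegral_lb f a b k : a <= b -> continuous_on f a b ->
  (forall t, a <= t <= b -> k <= f t) ->
  k * (b - a) <= \int[mu]_(x in `[a, b]) f x.
Proof.
move=> ab fc kf.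
have -> : k * (b - a) = \int[mu]_(x in `[a, b]) cst k x.
  by rewrite Rintegral_cst //= lebesgue_measure_itv /= lte_fin; case: ltrP => //= ba;
   rewrite (_ : a = b) ?subrr //; apply/eqP; rewrite eq_le ab.
apply: le_Rintegral => //.
- by apply: continuous_on_integrable => t _; exact: cvg_cst.
- exact: continuous_on_integrable.
Qed.

Lemma Rintegral_ub f a b k : a <= b -> continuous_on f a b ->
  (forall t, a <= t <= b -> f t <= k) ->
  \int[mu]_(x in `[a, b]) f x <= k * (b - a).
Proof.
move=> ab fc kf.
have -> : k * (b - a) = \int[mu]_(x in `[a, b]) cst k x.
  by rewrite Rintegral_cst //= lebesgue_measure_itv /= lte_fin; case: ltrP => //= ba;
   rewrite (_ : a = b) ?subrr //; apply/eqP; rewrite eq_le ab.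
apply: le_Rintegral => //.
- exact: continuous_on_integrable.
- by apply: continuous_on_integrable => t _; exact: cvg_cst.
Qed.

Lemma Rintegral_opp f a b : a <= b -> continuous_on f a b ->
  \int[mu]_(x in `[- b, - a]) f (- x) = \int[mu]_(x in `[a, b]) f x.
Proof.
move=> ab fc.
have := @integration_by_substitution_oppr R f (- b) (- a).
rewrite lerN2 !opprK => /(_ ab (continuous_on_within fc)).
by rewrite /Rintegral => ->.
Qed.

(** A substitute for the fundamental theorem of calculus for a function h that may fail to be
    differentiable, such as a truncated norm along a curve. Around each t the increments of h have
    rate at most K f t + e; continuity of f replaces f t by its mean, and [cousin] glues the small
    intervals. *)
Lemma increment_le_integral (h f : R -> R) (K : R) a b : a <= b -> 0 <= K ->
  continuous_on f a b ->
  (forall t e, a <= t <= b -> 0 < e -> exists2 d, 0 < d & forall s u,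
     s <= t -> t <= u -> t - d < s -> u < t + d ->
     `|h u - h s| <= (K * f t + e) * (u - s)) ->
  `|h b - h a| <= K * \int[mu]_(x in `[a, b]) f x.
Proof.
move=> ab K0 fc H.
suff S e : 0 < e -> `|h b - h a| <= K * \int[mu]_(x in `[a, b]) f x + e * (b - a).
  apply/ler_addgt0Pr => e e0.
  have ba : 0 < b - a + 1 by rewrite ltr_wpDl // subr_ge0.
  apply: le_trans (S (e / (b - a + 1)) _) _; first by rewrite divr_gt0.
  rewrite lerD2l mulrAC ler_pdivrMr // ler_wpM2l ?ltW //; lra.
move=> e0.
apply: (cousin (P := fun a b => `|h b - h a| <=
   K * \int[mu]_(x in `[a, b]) f x + e * (b - a))) => //.
  move=> s t u as_ st tu ub H1 H2.
  rewrite (Rintegral_split st tu); last exact: continuous_onS fc.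
  have -> : h u - h s = (h u - h t) + (h t - h s) by rewrite addrA subrK.
  apply: le_trans (ler_normD _ _) _.
  apply: le_trans (lerD H2 H1) _.
  by rewrite le_eqVlt; apply/orP; left; apply/eqP; ring.
move=> t tab.
have K1 : 0 < 2 * (K + 1) by rewrite mulr_gt0 // ltr_wpDl.
have [|d1 d10 H1] := H t (e / 2) tab; first by rewrite divr_gt0.
(* Half of e pays for the local rate, the other half for replacing f t by f nearby, an error
   multiplied by K; the added 1 covers K = 0. *)
have e1 : 0 < e / (2 * (K + 1)) by rewrite divr_gt0.
have /cvgrPdist_le /(_ _ e1) /nbhs_ballP [d2 /= d20 H2] := fc t tab.
exists (Num.min d1 d2); first by rewrite lt_min d10.
move=> s u as_ st tu ub; rewrite ltrBlDr -ltrBlDl lt_min => /andP[s1 s2].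
rewrite -ltrBlDl lt_min => /andP[u1 u2].
have su := le_trans st tu.
apply: (le_trans (H1 s u st tu _ _)).
- by rewrite ltrBlDr -ltrBlDl.
- by rewrite -ltrBlDl.
have := @Rintegral_lb f s u (f t - e / (2 * (K + 1))) su (continuous_onS as_ ub fc).
move=> /(_ _) L.
have {L} : (f t - e / (2 * (K + 1))) * (u - s) <= \int[mu]_(x in `[s, u]) f x.
  apply: L => x /andP[sx xu].
  have : `|f t - f x| <= e / (2 * (K + 1)).
    apply: H2; rewrite /ball /= ltr_norml; apply/andP; split; lra.
  by rewrite ler_norml => /andP[_]; lra.
move=> /(ler_wpM2l K0); set I := \int[mu]_(x in _) _ => L.
have us : 0 <= u - s by rewrite subr_ge0.
have Ke : K * (e / (2 * (K + 1))) <= e / 2.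
  rewrite mulrA ler_pdivrMr //.
  have -> : e / 2 * (2 * (K + 1)) = K * e + e by field.
  by rewrite lerDl ltW.
move: (ler_wpM2r us Ke) L; lra.
Qed.

End real_integral.

(** * Norms of positive definite matrices *)

Section quadratic_form.
Context {R : realType} {n : nat}.
Implicit Types (G : 'M[R]_n) (u v w : 'rV[R]_n).

Definition bform G u v : R := (u *m G *m v^T) 0 0.
Definition qnorm G u : R := Num.sqrt (bform G u u).
Definition posdef G : Prop := G^T = G /\ forall u, u != 0 -> 0 < bform G u u.

Lemma bformE G u v :
  bform G u v = \sum_(i < n) \sum_(j < n) u 0 i * v 0 j * G i j.
Proof. exact: (innerE (fun=> G) 0 u v). Qed.

Lemma bformDl G u v w : bform G (u + v) w = bform G u w + bform G v w.
Proof. by rewrite /bform !mulmxDl mxE. Qed.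

Lemma bformDr G u v w : bform G w (u + v) = bform G w u + bform G w v.
Proof. by rewrite /bform linearD mulmxDr mxE. Qed.

Lemma bformZl G a u v : bform G (a *: u) v = a * bform G u v.
Proof. by rewrite /bform -!scalemxAl mxE. Qed.

Lemma bformZr G a u v : bform G u (a *: v) = a * bform G u v.
Proof. by rewrite /bform linearZ -scalemxAr mxE. Qed.

Lemma bformC G u v : posdef G -> bform G u v = bform G v u.
Proof.
move=> [symG _]; rewrite /bform -[in RHS]symG.
have -> : v *m G^T *m u^T = (u *m G *m v^T)^T by rewrite !trmx_mul trmxK mulmxA.
by rewrite [RHS]mxE.
Qed.

Lemma bform_ge0 G u : posdef G -> 0 <= bform G u u.
Proof.
move=> [_ pG]; have [->|u0] := eqVneq u 0; last exact/ltW/pG.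
by rewrite /bform !mul0mx mxE.
Qed.

Lemma qnorm_ge0 G u : 0 <= qnorm G u. Proof. exact: sqrtr_ge0. Qed.

Lemma qnorm_sqr G u : posdef G -> qnorm G u ^+ 2 = bform G u u.
Proof. by move=> pG; rewrite sqr_sqrtr // bform_ge0. Qed.

Lemma qnormZ G a u : qnorm G (a *: u) = `|a| * qnorm G u.
Proof.
by rewrite /qnorm bformZl bformZr mulrA -expr2 sqrtrM ?sqr_ge0 // sqrtr_sqr.
Qed.

Lemma qnorm0 G : qnorm G 0 = 0.
Proof. by rewrite -(scale0r 0) qnormZ normr0 mul0r. Qed.

Lemma qnormN G u : qnorm G (- u) = qnorm G u.
Proof. by rewrite -scaleN1r qnormZ normrN1 mul1r. Qed.

Lemma bform_cauchy_schwarz G u v : posdef G ->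
  bform G u v <= qnorm G u * qnorm G v.
Proof.
move=> pG.
have [->|v0] := eqVneq v 0.
  by rewrite qnorm0 mulr0 /bform trmx0 mulmx0 mxE.
have vv : 0 < bform G v v by apply: (proj2 pG).
pose a := bform G u v / bform G v v.
have E : bform G (u - a *: v) (u - a *: v) =
    bform G u u - bform G u v ^+ 2 / bform G v v.
  rewrite -scaleNr !(bformDl, bformDr, bformZl, bformZr) (bformC v u pG) /a.
  by field; rewrite gt_eqF.
have := bform_ge0 (u - a *: v) pG; rewrite E.
rewrite subr_ge0 ler_pdivrMr // -!qnorm_sqr // -exprMn => H.
apply: le_trans (ler_norm _) _.
by rewrite -(@ler_pXn2r _ 2) ?nnegrE ?mulr_ge0 ?qnorm_ge0 // real_normK ?num_real.
Qed.

Lemma qnormD G u v : posdef G -> qnorm G (u + v) <= qnorm G u + qnorm G v.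
Proof.
move=> pG; rewrite -(@ler_pXn2r _ 2) ?nnegrE ?addr_ge0 ?qnorm_ge0 //.
rewrite sqrrD !qnorm_sqr // !(bformDl, bformDr) (bformC v u pG).
have := bform_cauchy_schwarz u v pG; rewrite -mulr_natl; lra.
Qed.

Lemma qnorm_dist G u v : posdef G -> `|qnorm G u - qnorm G v| <= qnorm G (u - v).
Proof.
move=> pG; rewrite ler_norml; apply/andP; split.
  have := qnormD (v - u) u pG; rewrite subrK -opprB qnormN; lra.
have := qnormD (u - v) v pG; rewrite subrK; lra.
Qed.

Lemma bform_bound G u : `|bform G u u| <= (\sum_(i < n) \sum_(j < n) `|G i j|) * `|u| ^+ 2.
Proof.
rewrite bformE mulr_suml.
apply: le_trans (ler_norm_sum _ _ _) _; apply: ler_sum => i _.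
rewrite mulr_suml.
apply: le_trans (ler_norm_sum _ _ _) _; apply: ler_sum => j _.
rewrite !normrM mulrC ler_wpM2l // expr2.
by apply: ler_pM => //; exact: rV_coord_norm.
Qed.

Lemma qnorm_ub G : exists2 L : R, 0 < L & forall u, qnorm G u <= L * `|u|.
Proof.
pose S := \sum_(i < n) \sum_(j < n) `|G i j|.
have S0 : 0 <= S by apply: sumr_ge0 => i _; apply: sumr_ge0.
exists (Num.sqrt S + 1); first by rewrite ltr_wpDl // sqrtr_ge0.
move=> u; apply: (@le_trans _ _ (Num.sqrt S * `|u|)); last first.
  by rewrite ler_wpM2r // lerDl.
have -> : Num.sqrt S * `|u| = Num.sqrt (S * `|u| ^+ 2).
  by rewrite sqrtrM // sqrtr_sqr normr_id.
apply: ler_wsqrtr; apply: le_trans (ler_norm _) _; exact: bform_bound.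
Qed.

Lemma qnorm_continuous G : continuous (qnorm G).
Proof.
move=> u; apply: (@continuous_compose _ _ _ (fun u => bform G u u) Num.sqrt);
  last exact: sqrt_continuous.
have -> : (fun u => bform G u u) =
  fun u => \sum_(i < n) \sum_(j < n) u 0 i * u 0 j * G i j.
  by apply/funext => w; rewrite bformE.
apply: continuous_sum => i; apply: continuous_sum => j.
apply: (@continuous_mul _ _ (fun u : 'rV[R]_n => u 0 i * u 0 j) (fun=> G i j));
  last exact: (@cst_continuous _ _ (G i j) u).
apply: (@continuous_mul _ _ (fun u : 'rV[R]_n => u 0 i) (fun u : 'rV[R]_n => u 0 j)).
  exact: (@coord_continuous_at _ _ _ id u i (fun x => id)).
exact: (@coord_continuous_at _ _ _ id u j (fun x => id)).
Qed.

Lemma qnorm_lb G : posdef G -> exists2 l : R, 0 < l & forall u, l * `|u| <= qnorm G u.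
Proof.
move=> pG.
pose S : set 'rV[R]_n := [set u | `|u| = 1].
have cS : compact S.
  apply: bounded_closed_compact.
    by exists 1; split; [exact: num_real | move=> M M1 u /= ->; exact: ltW].
  have -> : S = (fun u : 'rV[R]_n => `|u|) @^-1` [set 1] by [].
  apply: closed_comp => [u _|]; first exact: norm_continuous.
  exact: closed_eq.
have [[u0 Su0]|S0] := pselect (S !=set0).
  have [||c Sc cmin] := @compact_EVT_min _ R (qnorm G) S _ cS; first by exists u0.
    by apply: continuous_subspaceT; exact: qnorm_continuous.
  have c1 : `|c| = 1 by move: Sc; rewrite inE.
  have c0 : c != 0 by rewrite -normr_gt0 c1.
  exists (qnorm G c); first by rewrite sqrtr_gt0; apply: (proj2 pG).
  move=> u; have [->|un0] := eqVneq u 0; first by rewrite normr0 mulr0 qnorm0.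
  have u0' : 0 < `|u| by rewrite normr_gt0.
  have := cmin (`|u|^-1 *: u).
  rewrite qnormZ ger0_norm ?invr_ge0 // => /(_ _).
  rewrite mulrC ler_pdivlMr //; apply.
  by rewrite inE /S /= normrZ ger0_norm ?invr_ge0 // mulVf // gt_eqF.
(* An empty unit sphere means that 0 is the only vector, that is, n = 0. *)
exists 1 => // u.
have [->|un0] := eqVneq u 0; first by rewrite normr0 mulr0 qnorm0.
exfalso; apply: S0; exists (`|u|^-1 *: u).
by rewrite /S /= normrZ ger0_norm ?invr_ge0 // mulVf // normr_eq0.
Qed.

(** Perturbing the entries by e changes the form by at most n^2 e |u|^2, which the lower bound of
    [qnorm_lb] makes smaller than h times the form. With h = 1 - K^-2 one has 1 - h = K^-2 and 1 + h
    <= K^2, which gives both inequalities after taking roots. *)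
Lemma qnorm_near G (K : R) : posdef G -> 1 < K -> exists2 e : R, 0 < e &
  forall G', (forall i j, `|G' i j - G i j| <= e) ->
    forall u, qnorm G u <= K * qnorm G' u /\ qnorm G' u <= K * qnorm G u.
Proof.
move=> pG K1.
have K0 : 0 < K by exact: lt_trans K1.
have [l l0 lP] := qnorm_lb pG.
pose h := 1 - K ^- 2.
have KK : 1 < K ^+ 2 by rewrite exprn_egt1.
have KK0 : 0 < K ^+ 2 by rewrite exprn_gt0.
have h0 : 0 < h by rewrite subr_gt0 invf_lt1.
have nn : 0 < (n * n)%:R + 1 :> R by rewrite ltr_wpDl.
exists (h * l ^+ 2 / ((n * n)%:R + 1)).
  by rewrite divr_gt0 // mulr_gt0 // exprn_gt0.
move=> G' GG' u.
have D : `|bform G' u u - bform G u u| <= h * bform G u u.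
  have -> : bform G' u u - bform G u u = bform (G' - G) u u.
    by rewrite /bform mulmxBr mulmxBl [RHS]mxE [X in _ = _ + X]mxE.
  apply: le_trans (bform_bound _ _) _.
  apply: (@le_trans _ _ (h * l ^+ 2 * `|u| ^+ 2)).
    apply: ler_wpM2r; first by rewrite sqr_ge0.
    apply: (@le_trans _ _ (\sum_(i < n) \sum_(j < n) (h * l ^+ 2 / ((n * n)%:R + 1)))).
      apply: ler_sum => i _; apply: ler_sum => j _; rewrite !mxE; exact: GG'.
    have hl : 0 <= h * l ^+ 2 by rewrite mulr_ge0 ?sqr_ge0 // ltW.
    rewrite !sumr_const !card_ord -mulrnA -[leLHS]mulr_natr.
    by rewrite mulrAC ler_pdivrMr // ler_wpM2l // lerDl.
  rewrite -mulrA ler_pM2l // -exprMn -qnorm_sqr //.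
  by rewrite ler_pXn2r ?nnegrE ?mulr_ge0 ?qnorm_ge0 // ltW.
have B0 := bform_ge0 u pG.
have EK : h * K ^+ 2 = K ^+ 2 - 1.
  by rewrite /h mulrBl mul1r mulVf // gt_eqF.
have H1 : bform G u u <= K ^+ 2 * bform G' u u.
  have : (1 - h) * bform G u u <= bform G' u u.
    by move: D; rewrite ler_norml => /andP[]; lra.
  move=> /(ler_wpM2l (ltW KK0)); apply: le_trans.
  by rewrite mulrA /h opprB addrCA subrr addr0 divff ?mul1r // gt_eqF.
have H2 : bform G' u u <= K ^+ 2 * bform G u u.
  have : bform G' u u <= (1 + h) * bform G u u.
    by move: D; rewrite ler_norml => /andP[_]; lra.
  move=> H; apply: le_trans H _; apply: ler_wpM2r => //.
  nra.
have sK x : K * Num.sqrt x = Num.sqrt (K ^+ 2 * x).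
  by rewrite sqrtrM ?sqr_ge0 // sqrtr_sqr gtr0_norm.
by rewrite /qnorm !sK; split; apply: ler_wsqrtr.
Qed.

End quadratic_form.

(** * Paths and the distance in a chart *)

Section straddle.
Context {R : realType}.

Lemma derive1_oppr (V : normedModType R) (y : R -> V) (s : R) :
  derivable y (- s) 1 -> derivable (fun s => y (- s)) s 1 /\
  derive1 (fun s => y (- s)) s = - derive1 y (- s).
Proof.
move=> dy; have dY := dy; move/derivable1_diffP in dy.
have dO : differentiable (-%R : R -> R) s by [].
have dc : differentiable (y \o (-%R : R -> R)) s by exact: differentiable_comp.
split; first by apply/derivable1_diffP.
rewrite -[LHS]/(derive1 (y \o (-%R : R -> R)) s) derive1E deriveE // diff_comp //=.
rewrite deriv1E //= -deriveE //.
have -> : 'D_1 (-%R : R -> R) s = -1 by rewrite derive_val.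
by rewrite scaleN1r.
Qed.

(** Differentiability at the single point t controls increments between two points on opposite sides
    of t, because then |u - t| + |s - t| = u - s. This is the local estimate that
    [increment_le_integral] asks for. *)
Lemma straddle (V : normedModType R) (x : R -> V) (t : R) : derivable x t 1 ->
  forall e, 0 < e -> exists2 d, 0 < d & forall s u,
    s <= t -> t <= u -> t - d < s -> u < t + d ->
    `|x u - x s - (u - s) *: derive1 x t| <= e * (u - s).
Proof.
move=> /derivable_nbhsP dx e e0; rewrite derive1E.
move/eqaddoP : dx => /(_ e e0) /nbhs_ballP [d /= d0 H].
have {}H h : `|h| < d -> `|x (t + h) - x t - h *: 'D_1 x t| <= e * `|h|.
  move=> hd; have := H h; rewrite -ball_normE /= sub0r normrN => /(_ hd).
  by rewrite !fctE /= scaler1 opprD addrA (addrC h).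
exists d => // s u st tu sd ud.
have H1 := H (u - t); have H2 := H (s - t).
rewrite (_ : t + (u - t) = u) in H1; last by rewrite addrC subrK.
rewrite (_ : t + (s - t) = s) in H2; last by rewrite addrC subrK.
have -> : x u - x s - (u - s) *: 'D_1 x t =
   (x u - x t - (u - t) *: 'D_1 x t) - (x s - x t - (s - t) *: 'D_1 x t).
  have -> : u - s = (u - t) - (s - t) by rewrite opprB addrA subrK.
  rewrite scalerBl; set A := (u - t) *: _; set B := (s - t) *: _.
  rewrite [X in _ = _ + X]opprB (opprB (x s)) (addrC B) [RHS]addrACA.
  by rewrite (addrA _ (x t)) subrK opprB (addrC B).
apply: le_trans (ler_normB _ _) _.
have -> : e * (u - s) = e * `|u - t| + e * `|s - t|.
  by rewrite ger0_norm ?subr_ge0 // ler0_norm ?subr_le0 // -mulrDr opprB addrA subrK.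
apply: lerD; [apply: H1 | apply: H2].
  by rewrite ger0_norm ?subr_ge0 // ltrBlDl.
by rewrite ler0_norm ?subr_le0 // opprB ltrBlDr -ltrBlDl.
Qed.

End straddle.

Section paths.
Context {R : realType} {n : nat} {M : topologicalType}.
Context {X : smooth_manifold R n M} (g : riemannian_metric X).
Local Notation ch := (chart_at X).
Local Notation dom p := (chart_dom (chart_at X p)).
Local Notation phi p := (chart_map (chart_at X p)).

Lemma speed_ge0 c t : 0 <= speed g c t.
Proof. exact: sqrtr_ge0. Qed.

Lemma C1_arc_speed c a b : C1_arc X c a b -> continuous_on (speed g c) a b.
Proof. by move=> [_ H] t /H; exact: C1_at_speed_continuous. Qed.

Lemma arc_length_ge0 c a b : 0 <= arc_length g c a b.
Proof. by apply: Rintegral_ge0 => t _; exact: speed_ge0. Qed.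

Lemma path_length_ge0 x y l : path_length g x y l -> 0 <= l.
Proof. by elim=> // *; rewrite addr_ge0 // arc_length_ge0. Qed.

Lemma path_cat x y z l l' : path_length g x y l -> path_length g y z l' ->
  path_length g x z (l + l').
Proof.
move=> H; elim: H z l' => [x0|c a b y0 l0 arc _ IH] z l' H; first by rewrite add0r.
by rewrite -addrA; apply: path_cons => //; exact: IH.
Qed.

Lemma path_arc c a b : C1_arc X c a b ->
  path_length g (c a) (c b) (arc_length g c a b).
Proof.
move=> arc; rewrite -[arc_length _ _ _ _]addr0.
by apply: path_cons => //; exact: path_nil.
Qed.

(** Time reversal, from which the distance gets its symmetry: the velocity changes sign and the
    quadratic form does not see it. *)
Lemma C1_at_opp c (t : R) : C1_at (X := X) c (- t) ->
  C1_at (X := X) (fun s => c (- s)) t /\ speed g (fun s => c (- s)) t = speed g c (- t).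
Proof.
move=> Hc; have [dp dx cx] := C1_at_chart Hc (mem_chart_at X (c (- t))).
set p := c (- t) in dp dx cx.
have opp_near (P : R -> Prop) : (\forall s \near - t, P s) -> \forall s \near t, P (- s).
  by move=> HP; apply: (@opp_continuous R t).
have dx' : \forall s \near t, derivable (fun s => phi p (c (- s))) s 1 /\
   derive1 (fun s => phi p (c (- s))) s = - derive1 (fun s => phi p (c s)) (- s).
  apply: filterS (opp_near (fun s => derivable (fun s => phi p (c s)) s 1) dx) => s.
  exact: derive1_oppr.
have H : chart_C1 (X := X) (fun s => c (- s)) p t.
  split; first exact: (opp_near (fun s => dom p (c s))).
    by apply: filterS dx' => s [].
  have E : \forall s \near t, - derive1 (fun s => phi p (c s)) (- s) =
     derive1 (fun s => phi p (c (- s))) s by apply: filterS dx' => s [].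
  apply: (near_eq_continuous E).
  apply: (@continuous_compose _ _ _ (fun s : R => derive1 (fun s => phi p (c s)) (- s)) -%R);
    last exact: (@opp_continuous 'rV[R]_n).
  apply: (@continuous_compose _ _ _ (-%R : R -> R) (derive1 (fun s => phi p (c s)))).
    exact: (@opp_continuous R t).
  exact: cx.
split; first exact: chart_C1_at H.
have [dp' _ _] := H; have [d2 D2] := nbhs_singleton dx'.
rewrite (speed_chart g dp' d2) (speed_chart g dp (nbhs_singleton dx)) /= D2.
by rewrite /inner linearN /= mulNmx mulmxN mulNmx opprK.
Qed.

Lemma C1_arc_opp c a b : C1_arc X c a b ->
  C1_arc X (fun s => c (- s)) (- b) (- a) /\
  arc_length g (fun s => c (- s)) (- b) (- a) = arc_length g c a b.
Proof.
move=> arc; have [ab H] := arc; split.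
  split; first by rewrite lerN2.
  move=> t /andP[bt ta]; apply: (C1_at_opp (H (- t) _)).1.
  by rewrite lerNr ta lerNl.
rewrite [RHS]/arc_length -(Rintegral_opp ab (C1_arc_speed arc)).
apply: eq_Rintegral => t; rewrite inE /= in_itv /= => /andP[bt ta].
apply: (C1_at_opp (H (- t) _)).2.
by rewrite lerNr ta lerNl.
Qed.

Lemma path_sym x y l : path_length g x y l -> path_length g y x l.
Proof.
elim=> [z|c a b z l0 arc _ IH]; first exact: path_nil.
rewrite addrC; apply: path_cat IH _.
have [arc' <-] := C1_arc_opp arc.
by have := path_arc arc'; rewrite !opprK.
Qed.

Lemma metric_pd p v : chart_cod (ch p) v -> posdef (metric g p v).
Proof.
by move=> pv; split; [exact: (Defs.metric_sym g pv) | exact: (metric_posdef g pv)].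
Qed.

Lemma line_C1 p (v w : 'rV[R]_n) (t : R) : chart_cod (ch p) (v + t *: w) ->
  C1_at (X := X) (fun s => chart_inv (ch p) (v + s *: w)) t /\
  speed g (fun s => chart_inv (ch p) (v + s *: w)) t =
    qnorm (metric g p (v + t *: w)) w.
Proof.
move=> pt; pose c := fun s => chart_inv (ch p) (v + s *: w).
have lc : {for t, continuous (fun s : R => v + s *: w)}.
  by apply: differentiable_continuous.
have cods : \forall s \near t, chart_cod (ch p) (v + s *: w).
  by apply: lc; apply: open_nbhs_nbhs; split => //; exact: chart_cod_open.
have dp : \forall s \near t, dom p (c s).
  by apply: filterS cods => s /chart_invK[].
have is_dl (s : R) : is_derive s 1 (fun s : R => v + s *: w) w.
  have D : differentiable (fun s : R => v + s *: w) s by [].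
  split; first by apply/derivable1_diffP.
  by rewrite deriveE // diff_val /= add0r scale1r.
have dx' : \forall s \near t, derivable (fun s => phi p (c s)) s 1 /\
    derive1 (fun s => phi p (c s)) s = w.
  have := near_near cods; apply: filterS => s nc.
  have E : {near s, (fun s : R => v + s *: w) =1 (fun s => phi p (c s))}.
    by apply: filterS nc => s' /chart_invK[_].
  have [dl Dl] := is_dl s.
  split; first exact: near_eq_derivable dl.
  by rewrite derive1E -(near_eq_derive _ E).
have H : chart_C1 (X := X) c p t.
  split=> //; first by apply: filterS dx' => s [].
  have E : \forall s \near t, w = derive1 (fun s => phi p (c s)) s.
    by apply: filterS dx' => s [].
  by apply: (near_eq_continuous E); exact: cst_continuous.
split; first exact: chart_C1_at H.
have [d2 D2] := nbhs_singleton dx'.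
by rewrite (speed_chart g dp d2) /= D2 /c (chart_invK pt).2.
Qed.

End paths.

Lemma minr_dist (R : realDomainType) (a b r : R) :
  `|Num.min a r - Num.min b r| <= `|a - b|.
Proof.
have h1 := ler_norm (a - b); have h2 := ler_norm (b - a); rewrite distrC in h2.
have h3 := normr_ge0 (a - b).
by rewrite ler_norml; case: (leP a r) => ?; case: (leP b r) => ?;
  apply/andP; split; lra.
Qed.

Section comparison.
Context {R : realType} {n : nat} {M : topologicalType}.
Context {X : smooth_manifold R n M} (g : riemannian_metric X).
Local Notation ch := (chart_at X).
Local Notation dom p := (chart_dom (chart_at X p)).
Local Notation phi p := (chart_map (chart_at X p)).

Definition chart_pt p : 'rV[R]_n := phi p p.
Definition cnorm p : 'rV[R]_n -> R := qnorm (metric g p (chart_pt p)).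

Lemma center_cod p : chart_cod (ch p) (chart_pt p).
Proof. by exists p => //; exact: mem_chart_at. Qed.

Lemma center_pd p : posdef (metric g p (chart_pt p)).
Proof. exact: metric_pd (center_cod p). Qed.

Lemma metric_near p (K : R) : 1 < K -> exists2 d, 0 < d &
  forall v, `|v - chart_pt p| < d -> chart_cod (ch p) v /\
    forall u, cnorm p u <= K * qnorm (metric g p v) u /\
      qnorm (metric g p v) u <= K * cnorm p u.
Proof.
move=> K1; have [e e0 He] := qnorm_near (center_pd p) K1.
have : \forall v \near chart_pt p, chart_cod (ch p) v /\
   (forall i j, `|metric g p v i j - metric g p (chart_pt p) i j| <= e).
  apply: filterI; first exact: chart_cod_near (mem_chart_at X p).
  apply: (@filter_forall _ _ (fun i v => forall j,
    `|metric g p v i j - metric g p (chart_pt p) i j| <= e) (nbhs (chart_pt p)) _) => i.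
  apply: (@filter_forall _ _ (fun j v =>
    `|metric g p v i j - metric g p (chart_pt p) i j| <= e) (nbhs (chart_pt p)) _) => j.
  have /cvgrPdist_le /(_ e e0) := @metric_continuous _ _ _ _ g p _ i j (center_cod p).
  by apply: filterS => v; rewrite distrC.
move=> /nbhs_ballP [d /= d0 Hd]; exists d => // v vd.
have [] := Hd v; first by rewrite -ball_normE /= distrC.
by move=> cv H; split => // u; exact: He.
Qed.

(** The straight segment of the chart is an admissible curve. It stays in the ball, so its speed is
    at most K times the norm of its direction. *)
Lemma segment_path p (K r : R) :
  (forall v : 'rV[R]_n, cnorm p (v - chart_pt p) < r -> chart_cod (ch p) v /\
    forall u, qnorm (metric g p v) u <= K * cnorm p u) ->
  forall v : 'rV[R]_n, cnorm p (v - chart_pt p) < r ->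
    exists2 l, path_length g p (chart_inv (ch p) v) l & l <= K * cnorm p (v - chart_pt p).
Proof.
move=> H v vr; set w := v - chart_pt p.
pose c := fun s : R => chart_inv (ch p) (chart_pt p + s *: w).
have ball s : 0 <= s <= 1 -> cnorm p (chart_pt p + s *: w - chart_pt p) < r.
  move=> /andP[s0 s1]; rewrite addrAC subrr add0r [cnorm _ _]qnormZ ger0_norm //.
  apply: le_lt_trans vr; apply: ler_piMl => //; exact: qnorm_ge0.
have Hl s (s01 : 0 <= s <= 1) := line_C1 g (H _ (ball s s01)).1.
have arc : C1_arc X c 0 1 by split => // s /Hl[].
have c0 : c 0 = p by rewrite /c scale0r addr0 chart_mapK //; exact: mem_chart_at.
have c1 : c 1 = chart_inv (ch p) v by rewrite /c scale1r /w addrC subrK.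
exists (arc_length g c 0 1); first by have := path_arc g arc; rewrite c0 c1.
have := @Rintegral_ub R (speed g c) 0 1 (K * cnorm p w) ler01 (C1_arc_speed (g := g) arc).
rewrite subr0 mulr1; apply => s s01.
rewrite (Hl s s01).2; exact: (H _ (ball s s01)).2.
Qed.

(* Distance to [p] in the chart norm at [p], truncated at [r]: it is defined on
   all of [M], and its variation along a curve is controlled by the length. *)
Definition trunc_norm p (r : R) (x : M) : R :=
  if `[< dom p x /\ cnorm p (phi p x - chart_pt p) <= r >]
  then cnorm p (phi p x - chart_pt p) else r.

Lemma trunc_norm_dom p r x : dom p x ->
  trunc_norm p r x = Num.min (cnorm p (phi p x - chart_pt p)) r.
Proof.
move=> px; rewrite /trunc_norm; case: asboolP => [[_ H]|H].
  by rewrite min_l.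
by rewrite min_r // ltW // ltNge; apply/negP => h; apply: H.
Qed.

Hypothesis haus : hausdorff_space M.

(** Closedness inside the chart domain would not do, since a curve outside the ball may also be
    outside the domain. The ball is the image of a compact set under the inverse chart, hence closed
    in the Hausdorff space [M]. *)
Lemma closed_chart_ball p r :
  (forall v : 'rV[R]_n, cnorm p (v - chart_pt p) <= r -> chart_cod (ch p) v) ->
  closed [set x | dom p x /\ cnorm p (phi p x - chart_pt p) <= r].
Proof.
move=> H; have [l l0 Hl] := qnorm_lb (center_pd p).
pose B := [set v | cnorm p (v - chart_pt p) <= r].
have -> : [set x | dom p x /\ cnorm p (phi p x - chart_pt p) <= r] =
    chart_inv (ch p) @` B.
  apply/seteqP; split => [x [px xr]|_ [v vB <-]].
    by exists (phi p x) => //; rewrite chart_mapK.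
  by have [d E] := chart_invK (H v vB); split => //; rewrite E.
apply: compact_closed => //; apply: continuous_compact.
  apply: continuous_in_subspaceT => v; rewrite inE => /H.
  exact: chart_inv_continuous.
apply: bounded_closed_compact.
  exists (`|chart_pt p| + r / l); split; first exact: num_real.
  move=> C hC v /= vB; apply: le_trans (ltW hC).
  rewrite -[v](subrK (chart_pt p)) addrC.
  apply: le_trans (ler_normD _ _) _; rewrite lerD2l ler_pdivlMr // mulrC.
  exact: le_trans (Hl _) vB.
have cB : continuous (fun v : 'rV[R]_n => cnorm p (v - chart_pt p)).
  move=> v; apply: (@continuous_compose _ _ _ (fun v : 'rV[R]_n => v - chart_pt p) (cnorm p)).
    apply: differentiable_continuous; exact: differentiableB.
  exact: qnorm_continuous.
have -> : B = (fun v : 'rV[R]_n => cnorm p (v - chart_pt p)) @^-1` [set x | x <= r] by [].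
by apply: closed_comp => [v _|]; [exact: cB | exact: closed_le].
Qed.

Lemma trunc_norm_arc p (K r : R) c a b : 0 < K ->
  (forall v : 'rV[R]_n, cnorm p (v - chart_pt p) <= r -> chart_cod (ch p) v /\
    forall u, cnorm p u <= K * qnorm (metric g p v) u) ->
  C1_arc X c a b ->
  `|trunc_norm p r (c b) - trunc_norm p r (c a)| <= K * arc_length g c a b.
Proof.
move=> K0 H arc; have [ab Hc] := arc.
apply: (increment_le_integral (h := fun s => trunc_norm p r (c s)) ab (ltW K0)
  (C1_arc_speed (g := g) arc)).
move=> t e tab e0.
have ct := Hc t tab.
(* At a point of the closed ball the increments are compared with the velocity in the chart.
   Elsewhere the curve avoids the closed ball for nearby times and the truncated norm is constantly
   r. *)
have [[pt tr]|out] := pselect (dom p (c t) /\ cnorm p (phi p (c t) - chart_pt p) <= r).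
  have [dp dx _] := C1_at_chart ct pt.
  have dxt := nbhs_singleton dx.
  have [L L0 HL] := qnorm_ub (metric g p (chart_pt p)).
  (* The straddle lemma measures its error in the sup norm; L converts it to the norm of the metric
     at p. *)
  have eL : 0 < e / L by rewrite divr_gt0.
  have [d1 d10 H1] := straddle dxt eL.
  have /nbhs_ballP [d2 /= d20 H2] := dp.
  exists (Num.min d1 d2); first by rewrite lt_min d10.
  move=> s u st tu; rewrite ltrBlDr -ltrBlDl lt_min => /andP[s1 s2].
  rewrite -ltrBlDl lt_min => /andP[u1 u2].
  have ps : dom p (c s).
    by apply: H2; rewrite /ball /= ltr_norml; apply/andP; split; lra.
  have pu : dom p (c u).
    by apply: H2; rewrite /ball /= ltr_norml; apply/andP; split; lra.
  rewrite !trunc_norm_dom //.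
  set x := fun s => phi p (c s) in dxt H1 *.
  apply: (@le_trans _ _ (cnorm p (x u - x s))).
    apply: (@le_trans _ _ `|cnorm p (x u - chart_pt p) - cnorm p (x s - chart_pt p)|).
      exact: minr_dist.
    apply: le_trans (qnorm_dist _ _ (center_pd p)) _.
    by rewrite opprB addrA subrK.
  have := H1 s u st tu _ _; rewrite ltrBlDr -ltrBlDl -ltrBlDl => /(_ s1 u1) H3.
  have us : 0 <= u - s by rewrite subr_ge0 (le_trans st).
  have A1 : cnorm p ((u - s) *: derive1 x t) <= K * speed g c t * (u - s).
    rewrite [cnorm _ _]qnormZ ger0_norm // mulrC ler_wpM2r //.
    by rewrite (speed_chart g dp dxt); exact: ((H _ tr).2 (derive1 x t)).
  have A2 : cnorm p (x u - x s - (u - s) *: derive1 x t) <= e * (u - s).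
    by apply: le_trans (HL _) _; rewrite mulrC -ler_pdivlMr // mulrAC.
  rewrite mulrDl (addrC (K * _ * _)) -[x u - x s](subrK ((u - s) *: derive1 x t)).
  exact: le_trans (qnormD _ _ (center_pd p)) (lerD A2 A1).
have : \forall s \near t, ~ (dom p (c s) /\ cnorm p (phi p (c s) - chart_pt p) <= r).
  apply: (ct.1 (~` [set x | dom p x /\ cnorm p (phi p x - chart_pt p) <= r])).
  apply: open_nbhs_nbhs; split => //.
  by apply: closed_openC; apply: closed_chart_ball => v /H[].
move=> /nbhs_ballP [d /= d0 Hd]; exists d => // s u st tu sd ud.
have E s' : t - d < s' -> s' < t + d -> trunc_norm p r (c s') = r.
  move=> h1 h2; rewrite /trunc_norm; case: asboolP => // h; exfalso.
  by apply: (Hd s') h; rewrite /ball /= ltr_norml; apply/andP; split; lra.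
rewrite !E ?subrr ?normr0; try lra.
apply: mulr_ge0; last by lra.
apply: addr_ge0; last exact: ltW.
by apply: mulr_ge0; [exact: ltW | exact: speed_ge0].
Qed.

Lemma trunc_norm_path p (K r : R) x y l : 0 < K ->
  (forall v : 'rV[R]_n, cnorm p (v - chart_pt p) <= r -> chart_cod (ch p) v /\
    forall u, cnorm p u <= K * qnorm (metric g p v) u) ->
  path_length g x y l -> `|trunc_norm p r y - trunc_norm p r x| <= K * l.
Proof.
move=> K0 H; elim=> [z|c a b z l0 arc _ IH]; first by rewrite subrr normr0 mulr0.
rewrite -(subrK (trunc_norm p r (c b)) (trunc_norm p r z)) -addrA.
apply: le_trans (ler_normD _ _) _; rewrite mulrDr [leRHS]addrC.
exact: lerD IH (trunc_norm_arc K0 H arc).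
Qed.

(** Distances are bounded above by chart segments. Conversely, along a path of length l from x to p
    the truncated norm varies by at most K l < r0, and it vanishes at p. So its value at x is not
    the default r0, which forces x into the chart. *)
Lemma chart_comparison p (K : R) : 1 < K -> exists2 r0, 0 < r0 &
  (forall v : 'rV[R]_n, cnorm p (v - chart_pt p) < r0 -> chart_cod (ch p) v /\
    exists2 l, path_length g p (chart_inv (ch p) v) l & l <= K * cnorm p (v - chart_pt p)) /\
  (forall x l, path_length g x p l -> K * l < r0 ->
     dom p x /\ cnorm p (phi p x - chart_pt p) <= K * l).
Proof.
move=> K1; have K0 : 0 < K by exact: lt_trans K1.
have [d d0 Hd] := metric_near p K1; have [k k0 Hk] := qnorm_lb (center_pd p).
(* The half makes even the closed ball of this radius lie in the open sup-norm ball of radius d. *)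
have r0 : 0 < k * (d / 2) by rewrite mulr_gt0 // divr_gt0.
exists (k * (d / 2)) => //.
have B v : cnorm p (v - chart_pt p) <= k * (d / 2) -> `|v - chart_pt p| < d.
  move=> vr; have := le_trans (Hk _) vr; rewrite ler_pM2l //; lra.
split.
  move=> v vr; split; first exact: (Hd v (B v (ltW vr))).1.
  apply: segment_path vr => {}v vr; have [cv H] := Hd v (B v (ltW vr)).
  by split => // u; have [] := H u.
move=> x l xl Kl.
have H : `|trunc_norm p (k * (d / 2)) p - trunc_norm p (k * (d / 2)) x| <= K * l.
  apply: (trunc_norm_path K0 _ xl) => v vr; have [cv H] := Hd v (B v vr).
  by split => // u; have [] := H u.
have Tp : trunc_norm p (k * (d / 2)) p = 0.
  rewrite trunc_norm_dom; last exact: mem_chart_at.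
  by rewrite subrr [cnorm _ _]qnorm0 min_l // ltW.
move: H; rewrite Tp sub0r normrN => H.
have {H} := le_trans (ler_norm _) H; rewrite /trunc_norm.
case: asboolP => [[px _] H|_ H]; first by split.
by move: Kl; rewrite ltNge H.
Qed.

End comparison.
Arguments chart_pt {R n M} X p.

(** * The Riemannian distance as a metric, and its comparison with a chart norm *)

Section rdist_metric.
Context {R : realType} {n : nat} {M : topologicalType}.
Context {X : smooth_manifold R n M} (g : riemannian_metric X).
Local Notation ch := (chart_at X).
Local Notation dom p := (chart_dom (chart_at X p)).
Local Notation phi p := (chart_map (chart_at X p)).
Local Notation center := (chart_pt X).

Hypothesis M_connected : connected [set: M].

Let haus : hausdorff_space M := manifold_hausdorff X.

Lemma cnorm_chart_continuous p :
  {for p, continuous (fun x => cnorm g p (phi p x - center p))}.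
Proof.
have pp : dom p p := mem_chart_at X p.
apply: (@continuous_compose _ _ _ (phi p) (fun v => cnorm g p (v - center p))).
  exact: chart_map_continuous.
apply: (@continuous_compose _ _ _ (fun v : 'rV[R]_n => v - center p) (cnorm g p)).
  apply: differentiable_continuous; exact: differentiableB.
exact: qnorm_continuous.
Qed.

Lemma near_cnorm p (r : R) : 0 < r ->
  \forall x \near p, dom p x /\ cnorm g p (phi p x - center p) < r.
Proof.
move=> r0; apply: filterI.
  by apply: open_nbhs_nbhs; split; [exact: chart_dom_open | exact: mem_chart_at].
have /cvgrPdist_lt /(_ r r0) := @cnorm_chart_continuous p.
apply: filterS => x; rewrite -/(center p) subrr [cnorm _ _ 0]qnorm0 sub0r normrN.
exact: le_lt_trans (ler_norm _).
Qed.

Lemma near_path p : \forall x \near p, exists2 l, path_length g p x l &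
  l <= 2 * cnorm g p (phi p x - center p).
Proof.
have [r r0 [H _]] := chart_comparison g haus p (ltr1n R 2).
have := near_cnorm p r0; apply: filterS => x [px xr].
have [_ [l pl Hl]] := H _ xr; exists l => //.
by rewrite chart_mapK in pl.
Qed.

(** The set of points reachable from x is open and closed, since every point is joined to its
    neighbours by chart segments. This ensures that [rdist] is a genuine infimum and not the value
    of [inf] at the empty set. *)
Lemma path_exists x y : exists l, path_length g x y l.
Proof.
pose B := [set y | exists l, path_length g x y l].
have oB : open B.
  rewrite openE => z [l xz]; have := near_path z.
  by apply: filterS => w [l' zw _]; exists (l + l'); exact: path_cat zw.
have cB : closed B.
  rewrite -openC openE => z nz; have := near_path z.
  apply: filterS => w [l' zw _] [l xw]; apply: nz.
  by exists (l + l'); apply: path_cat xw _; exact: path_sym.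
suff E : B = [set: M] by have : B y by rewrite E.
apply: M_connected; first by exists x, 0; exact: path_nil.
  by exists B => //; rewrite setTI.
by exists B => //; rewrite setTI.
Qed.

Let has_inf_path x y : has_inf [set l | path_length g x y l].
Proof.
split; first by have [l] := path_exists x y; exists l.
by exists 0 => l /path_length_ge0.
Qed.

Lemma rdist_le x y l : path_length g x y l -> rdist g x y <= l.
Proof. by move=> xy; apply: ge_inf => //; have [] := has_inf_path x y. Qed.

Lemma rdist_lt x y (e : R) : rdist g x y < e ->
  exists2 l, path_length g x y l & l < e.
Proof.
rewrite -subr_gt0 => /inf_adherent /(_ (has_inf_path x y)) [l xy].
by rewrite addrC subrK; exists l.
Qed.

Lemma rdist_ge0 x y : 0 <= rdist g x y.
Proof.
apply: lb_le_inf; first by have [] := has_inf_path x y.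
by move=> l /path_length_ge0.
Qed.

Lemma rdist_xx x : rdist g x x = 0.
Proof.
by apply/eqP; rewrite eq_le rdist_ge0 andbT; apply: rdist_le; exact: path_nil.
Qed.

Lemma rdist_sym x y : rdist g x y = rdist g y x.
Proof.
have H z w : rdist g z w <= rdist g w z.
  apply: lb_le_inf; first by have [] := has_inf_path w z.
  by move=> l /path_sym; exact: rdist_le.
by apply/eqP; rewrite eq_le !H.
Qed.

Lemma rdist_triangle x y z : rdist g x z <= rdist g x y + rdist g y z.
Proof.
apply/ler_addgt0Pr => e e0.
have e20 : 0 < e / 2 by rewrite divr_gt0.
have [|l xy lx] := @rdist_lt x y (rdist g x y + e / 2); first by rewrite ltrDl.
have [|l' yz lz] := @rdist_lt y z (rdist g y z + e / 2); first by rewrite ltrDl.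
have := rdist_le (path_cat xy yz); lra.
Qed.

Lemma rdist_dist x y z : `|rdist g x z - rdist g y z| <= rdist g x y.
Proof.
have := rdist_triangle x y z; have := rdist_triangle y x z.
rewrite (rdist_sym y x) ler_norml => h1 h2; apply/andP; split; lra.
Qed.

Lemma near_rdist p (e : R) : 0 < e -> \forall x \near p, rdist g p x < e.
Proof.
move=> e0; have e20 : 0 < e / 2 by rewrite divr_gt0.
have := near_cnorm p e20; have := near_path p.
by apply: filterS2 => x [l /rdist_le px lx] [_ xe]; lra.
Qed.

Lemma rdist_continuous y : continuous (fun x => rdist g x y).
Proof.
move=> p; apply/cvgrPdist_lt => e e0; have := near_rdist p e0.
by apply: filterS => x; apply: le_lt_trans; exact: rdist_dist.
Qed.

Lemma open_rdist_ball y (r : R) : open [set x | rdist g x y < r].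
Proof.
have -> : [set x | rdist g x y < r] = (fun x => rdist g x y) @^-1` [set s | s < r] by [].
by apply: open_comp => [x _|]; [exact: rdist_continuous | exact: open_lt].
Qed.

Lemma rdist_comparison p (K : R) : 1 < K -> exists2 r0, 0 < r0 &
  (forall v : 'rV[R]_n, cnorm g p (v - center p) < r0 -> chart_cod (ch p) v /\
    rdist g (chart_inv (ch p) v) p <= K * cnorm g p (v - center p)) /\
  (forall x, K * rdist g x p < r0 ->
     dom p x /\ cnorm g p (phi p x - center p) <= K * rdist g x p).
Proof.
move=> K1; have K0 : 0 < K by exact: lt_trans K1.
have [r0 r00 [H1 H2]] := chart_comparison g haus p K1.
exists r0 => //; split.
  move=> v /H1[cv [l pl lv]]; split => //.
  by apply: le_trans lv; rewrite rdist_sym; exact: rdist_le.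
move=> x Kx.
have Hx e : 0 < e -> K * (rdist g x p + e) < r0 ->
    dom p x /\ cnorm g p (phi p x - center p) <= K * (rdist g x p + e).
  move=> e0 Ke; have [|l xl le_] := @rdist_lt x p (rdist g x p + e).
    by rewrite ltrDl.
  have Kl : K * l <= K * (rdist g x p + e) by rewrite ler_pM2l // ltW.
  have [px nx] := H2 x l xl (le_lt_trans Kl Ke).
  by split => //; exact: le_trans nx Kl.
(* Paths are only almost minimising. An excess of this size uses up half of the room left below r0,
   so nearly shortest paths still satisfy the strict inequality. *)
have d0 : 0 < (r0 - K * rdist g x p) / (2 * K).
  by rewrite divr_gt0 ?subr_gt0 // mulr_gt0.
have small e : e <= (r0 - K * rdist g x p) / (2 * K) -> K * (rdist g x p + e) < r0.
  rewrite ler_pdivlMr ?mulr_gt0 // => he.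
  have : K * rdist g x p < r0 := Kx.
  rewrite mulrDr; lra.
split; first by have [] := Hx _ d0 (small _ (lexx _)).
apply/ler_addgt0Pr => e e0.
pose e' := Num.min (e / K) ((r0 - K * rdist g x p) / (2 * K)).
have e'0 : 0 < e' by rewrite lt_min d0 divr_gt0.
have [|_ H] := Hx e' e'0; first by apply: small; rewrite ge_min lexx orbT.
apply: le_trans H _; rewrite mulrDr lerD2l mulrC -ler_pdivlMr //.
by rewrite ge_min lexx.
Qed.

Hypothesis M_compact : compact [set: M].

(** [diameter] is a real supremum and is an upper bound only for a bounded set. The maximum of the
    distance to one point exists by compactness, and twice this maximum bounds all distances. *)
Lemma rdist_bounded : exists D : R, forall x y, rdist g x y <= D.
Proof.
have [[p _]|M0] := pselect ([set: M] !=set0); last first.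
  by exists 0 => x; exfalso; apply: M0; exists x.
have p0 : [set: M] !=set0 by exists p.
have dc : {within [set: M], continuous (fun x => rdist g x p)}.
  by apply: continuous_subspaceT; exact: rdist_continuous.
have [c _ cmax] := compact_EVT_max p0 M_compact dc.
exists (rdist g c p + rdist g c p) => x y.
apply: le_trans (rdist_triangle x p y) _; rewrite (rdist_sym p y).
by apply: lerD; apply: cmax; rewrite inE.
Qed.

Lemma rdist_le_diameter x y : rdist g x y <= diameter g.
Proof.
have [D HD] := rdist_bounded.
by apply: ub_le_sup; [exists D => r [a [b ->]] | exists x, y].
Qed.

End rdist_metric.

(** * Iterated integrals and the volume of small balls *)

Section nonneg_integral.
Local Open Scope ereal_scope.
Context d (T : measurableType d) (R : realType) (mu : {measure set T -> \bar R}).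
Implicit Types f h : T -> \bar R.
Import HBNNSimple.

(* No measurability is needed: both sides are suprema over simple functions. *)
Lemma nonneg_le_integral f h : (forall x, 0 <= f x) -> (forall x, f x <= h x) ->
  \int[mu]_x f x <= \int[mu]_x h x.
Proof.
move=> f0 fh; rewrite !ge0_integralTE //; last by move=> x; exact: le_trans (fh x).
apply: le_ereal_sup => _ [s sf <-]; exists s => // x; exact: le_trans (sf x) (fh x).
Qed.

Lemma nonneg_integral_ub f (C : \bar R) : (forall x, 0 <= f x) ->
  (forall s : {nnsfun T >-> R}, (forall x, (s x)%:E <= f x) ->
     \int[mu]_x (s x)%:E <= C) -> \int[mu]_x f x <= C.
Proof.
move=> f0 H; rewrite ge0_integralTE //; apply: ge_ereal_sup => _ [s sf <-].
have := H s sf; rewrite integral_nnsfun //.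
by rewrite (_ : (s : T -> R) \_ setT = s) // patch_setT.
Qed.

(** The known scaling of simple functions gives one inequality for an arbitrary nonnegative
    integrand; the same inequality with the inverse factor gives the other. *)
Lemma nonneg_integralZl f (c : R) : (0 < c)%R -> (forall x, 0 <= f x) ->
  \int[mu]_x (c%:E * f x) = c%:E * \int[mu]_x f x.
Proof.
have le_ (k : R) h : (0 < k)%R -> (forall x, 0 <= h x) ->
    \int[mu]_x (k%:E * h x) <= k%:E * \int[mu]_x h x.
  move=> k0 h0; apply: nonneg_integral_ub => [x|s sh].
    by apply: mule_ge0; [rewrite lee_fin ltW | exact: h0].
  have ms : measurable_fun [set: T] (fun x : T => (s x : R)%:E : \bar R).
    by apply/measurable_EFinP; exact: measurable_funP.
  have s0 x : setT x -> 0 <= (s x)%:E by rewrite lee_fin.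
  have k'0 : 0 <= (k^-1)%:E by rewrite lee_fin invr_ge0 ltW.
  rewrite -lee_pdivrMl // -(ge0_integralZl mu measurableT ms s0 k'0).
  apply: nonneg_le_integral => x.
    by apply: mule_ge0 => //; rewrite lee_fin.
  by rewrite lee_pdivrMl.
move=> c0 f0; apply/eqP; rewrite eq_le le_ //=.
rewrite -lee_pdivlMl //.
have -> : \int[mu]_x f x = \int[mu]_x (c^-1%:E * (c%:E * f x)).
  by apply: eq_integral => x _; rewrite muleA -EFinM mulVf ?gt_eqF // mul1e.
apply: le_; first by rewrite invr_gt0.
by move=> x; apply: mule_ge0; [rewrite lee_fin ltW | exact: f0].
Qed.

End nonneg_integral.

Definition affine_map {R : realType} (a r : R) (t : measurableTypeR R) :
  measurableTypeR R := a + r * t.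

Lemma measurable_affine_map {R : realType} (a r : R) :
  measurable_fun [set: measurableTypeR R] (affine_map a r).
Proof. by apply: measurable_funD => //; exact: measurable_funM. Qed.

Definition affine_pushforward {R : realType} (a r : R) :
    {measure set (measurableTypeR R) -> \bar R} :=
  measure_function_pushforward__canonical__measure_function_Measure
    (@lebesgue_measure R) (measurable_affine_map a r).

Section affine.
Local Open Scope ereal_scope.
Context {R : realType}.
Local Notation leb := (@lebesgue_measure R).
Import HBNNSimple.

(** The right-hand side is a measure that agrees with Lebesgue measure on half-open intervals, and
    these determine Lebesgue measure. *)
Lemma lebesgue_affine (a r : R) (X : set (measurableTypeR R)) : (0 < r)%R ->
  measurable X -> leb X = r%:E * leb (affine_map a r @^-1` X).
Proof.
move=> r0 mX.
pose nu := mscale (NngNum (ltW r0)) (affine_pushforward a r).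
have : forall Y, ocitv Y -> leb Y = nu Y; last first.
  by move=> H; rewrite (@lebesgue_measure_unique R nu H X mX).
move=> _ [[x y] /= _ <-].
rewrite -[nu _]/(r%:E * leb (affine_map a r @^-1` `]x, y]%classic)).
have -> : affine_map a r @^-1` `]x, y]%classic = `]((x - a) / r)%R, ((y - a) / r)%R]%classic.
  apply/seteqP; split => t /=; rewrite !in_itv /= ltr_pdivrMr // ler_pdivlMr //;
  by rewrite ltrBlDl lerBrDl (mulrC t).
rewrite !lebesgue_measure_itv /= !lte_fin ltr_pM2r ?invr_gt0 // ltrD2r.
case: ifP => xy; last by rewrite mule0.
rewrite -!EFinB -EFinM; congr EFin; field; exact: lt0r_neq0.
Qed.

Lemma ge0_integral_affine (h : R -> R) (b k : R) : (0 < k)%R ->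
  (forall x, 0 <= h x)%R -> measurable_fun [set: measurableTypeR R] h ->
  \int[leb]_x (h x)%:E = k%:E * \int[leb]_x (h (b + k * x))%R%:E.
Proof.
move=> k0 h0 mh.
have -> : \int[leb]_x (h (b + k * x))%R%:E =
    \int[affine_pushforward b k]_x (h x)%:E.
  rewrite (ge0_integral_pushforward (measurable_affine_map b k)) //.
    exact/measurable_EFinP.
  by move=> x _; rewrite lee_fin.
rewrite -(@ge0_integral_mscale _ _ _ _ _ _ (NngNum (ltW k0))) //.
- by apply: eq_measure_integral => X mX _; exact: (lebesgue_affine b k0 mX).
- exact/measurable_EFinP.
- by move=> x _; rewrite lee_fin.
Qed.

(** The measurable change of variables is applied to the simple functions below the composed
    integrand, which yields one inequality. The opposite one is the same inequality for the inverse
    affine map. *)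
Lemma nonneg_integral_affine (f : R -> \bar R) (a r : R) : (0 < r)%R ->
  (forall x, 0 <= f x) ->
  \int[leb]_x f (a + r * x)%R = (r^-1)%:E * \int[leb]_x f x.
Proof.
have le_ (h : R -> \bar R) (b k : R) : (0 < k)%R -> (forall x, 0 <= h x) ->
    \int[leb]_x h (b + k * x)%R <= (k^-1)%:E * \int[leb]_x h x.
  move=> k0 h0; apply: nonneg_integral_ub => [x|s sh]; first exact: h0.
  have k'0 : (0 < k^-1)%R by rewrite invr_gt0.
  rewrite (ge0_integral_affine (- (b / k)) k'0) //.
  apply: lee_wpmul2l; first by rewrite lee_fin ltW.
  apply: nonneg_le_integral => [x|x]; first by rewrite lee_fin; exact: fun_ge0.
  apply: le_trans (sh _) _; rewrite le_eqVlt; apply/orP; left; apply/eqP; congr h.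
  by field; exact: lt0r_neq0.
move=> r0 f0; apply/eqP; rewrite eq_le le_ //=.
rewrite muleC lee_pdivrMr //.
have r'0 : (0 < r^-1)%R by rewrite invr_gt0.
have := le_ (fun x => f (a + r * x)%R) (- (a / r))%R _ r'0 (fun x => f0 _).
rewrite invrK muleC; apply: le_trans.
rewrite le_eqVlt; apply/orP; left; apply/eqP; apply: eq_integral => x _; congr f.
by field; exact: lt0r_neq0.
Qed.

End affine.

Section iterated_integral.
Context {R : realType}.
Local Open Scope ereal_scope.

Lemma integral_rV_ge0 n (f : 'rV[R]_n -> \bar R) : (forall v, 0 <= f v) ->
  0 <= integral_rV f.
Proof.
elim: n f => [|n IH] f f0 /=; first exact: f0.
by apply: integral_ge0 => t _; apply: IH => v; exact: f0.
Qed.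

Lemma integral_rV_le n (f h : 'rV[R]_n -> \bar R) : (forall v, 0 <= f v) ->
  (forall v, f v <= h v) -> integral_rV f <= integral_rV h.
Proof.
elim: n f h => [|n IH] f h f0 fh /=; first exact: fh.
apply: nonneg_le_integral => [t|t]; first by apply: integral_rV_ge0 => v; exact: f0.
by apply: IH => v; [exact: f0 | exact: fh].
Qed.

Lemma integral_rVZ n (f : 'rV[R]_n -> \bar R) (c : R) : (0 < c)%R ->
  (forall v, 0 <= f v) -> integral_rV (fun v => c%:E * f v) = c%:E * integral_rV f.
Proof.
move=> c0; elim: n f => [//|n IH] f f0 /=.
rewrite -nonneg_integralZl //; last first.
  by move=> t; apply: integral_rV_ge0 => v; exact: f0.
by apply: eq_integral => t _; rewrite IH // => v; exact: f0.
Qed.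

Lemma integral_rV_affine n (f : 'rV[R]_n -> \bar R) (r : R) (w : 'rV[R]_n) :
  (0 < r)%R -> (forall v, 0 <= f v) ->
  integral_rV (fun v => f (w + r *: v)%R) = (r ^- n)%:E * integral_rV f.
Proof.
move=> r0; elim: n f w => [|n IH] f w f0 /=.
  rewrite expr0 invr1 mul1e; congr f; apply/rowP => -[]//.
pose a : R := w ord0 ord0.
pose w' : 'rV[R]_n := \row_i w ord0 (lift ord0 i).
pose F := fun t : R => integral_rV (fun v : 'rV[R]_n => f (row_mx (t%:M : 'rV_1) v)).
have F0 t : 0 <= F t by apply: integral_rV_ge0 => v; exact: f0.
transitivity (\int[lebesgue_measure]_(t in [set: R]) ((r ^- n)%:E * F (a + r * t)%R)).
  apply: eq_integral => t _.
  rewrite -(IH (fun v => f (row_mx (a + r * t)%R%:M v)) w' (fun v => f0 _)).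
  congr integral_rV; apply/funext => v; congr f.
  apply/rowP => i; rewrite !mxE.
  case: (split_ordP (i : 'I_(1 + n))) => j ->.
    by rewrite !mxE (ord1 j) eqxx !mulr1n /a; congr (w _ _ + _)%R; exact/val_inj.
  by rewrite !mxE; congr (w _ _ + _)%R; exact/val_inj.
rewrite nonneg_integralZl //; last by rewrite invr_gt0 exprn_gt0.
rewrite nonneg_integral_affine // muleA -EFinM; congr (_%:E * _).
by rewrite -invfM -exprSr.
Qed.

Definition box n (k : R) : set 'rV[R]_n := [set v | forall i, `|v 0%R i| < k]%R.

Lemma integral_rV_box n (k : R) : (0 < k)%R ->
  integral_rV (fun v : 'rV[R]_n => (\1_(box k) v)%:E) = ((2 * k) ^+ n)%:E.
Proof.
move=> k0; elim: n => [|n IH] /=.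
  by rewrite expr0 indicE mem_set // => -[].
have E (t : R) (v : 'rV[R]_n) : (\1_(box k) (row_mx (t%:M : 'rV[R]_1) v) =
    \1_(`](- k)%R, k[%classic) t * \1_(box k) v :> R)%R.
  rewrite !indicE -natrM mulnb; congr (nat_of_bool _)%:R.
  apply/idP/andP.
    rewrite inE => H; split; rewrite inE /=.
      have := H (lshift n ord0); rewrite row_mxEl mxE eqxx mulr1n in_itv /=.
      by rewrite ltr_norml.
    by move=> i; have := H (rshift 1 i); rewrite row_mxEr.
  rewrite !inE /= in_itv /= -ltr_norml => -[tk vk] i.
  case: (split_ordP (i : 'I_(1 + n))) => j ->; last by rewrite row_mxEr.
  by rewrite row_mxEl mxE (ord1 j) eqxx mulr1n.
transitivity (\int[lebesgue_measure]_(t in [set: R])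
   (((2 * k) ^+ n)%:E * (\1_(`](- k)%R, k[%classic) t)%:E)).
  apply: eq_integral => t _.
  have [tk|tk] := boolP (t \in `](- k)%R, k[%classic).
    rewrite indicE tk mule1 -IH; congr integral_rV; apply/funext => v.
    by rewrite E indicE tk mul1r.
  rewrite indicE (negbTE tk) mule0.
  transitivity (integral_rV (fun v : 'rV[R]_n => 0%:E) : \bar R).
    congr integral_rV; apply/funext => v.
    by rewrite E indicE (negbTE tk) mul0r.
  elim: (n) => [//|m IHm] /=.
  by apply: integral0_eq => s _; rewrite IHm.
have k20 : (0 < (2 * k) ^+ n)%R by rewrite exprn_gt0 // mulr_gt0.
rewrite (nonneg_integralZl _ k20); last by move=> t; rewrite lee_fin indicE.
have H : lebesgue_measure (`](- k)%R, k[%classic : set R) = (2 * k)%R%:E.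
  rewrite lebesgue_measure_itv /= lte_fin gtrN ?k0 // -EFinB opprK.
  by rewrite mulr_natl mulr2n.
by rewrite integral_indic // setIT [X in _ * X]H -EFinM exprSr.
Qed.

End iterated_integral.

(** * Determinants: continuity and positivity *)

Section det_posdef.
Context {R : realType}.

Lemma continuous_prod (T : topologicalType) (I : finType) (F : I -> T -> R) (t : T) :
  (forall i, {for t, continuous (F i)}) ->
  {for t, continuous (fun s => \prod_i F i s)}.
Proof.
move=> H; apply: (@cvg_big _ _ _ _ _ _ _ _ _ F (fun i => F i t)) => [|i _].
  exact: mul_continuous.
exact: H.
Qed.

Lemma det_continuous (T : topologicalType) n (A : T -> 'M[R]_n) (t : T) :
  (forall i j, {for t, continuous (fun s => A s i j)}) ->
  {for t, continuous (fun s => \det (A s))}.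
Proof.
move=> H; apply: (@continuous_sum _ _ _ (fun (s : 'S_n) x =>
  (-1) ^+ s * \prod_i A x i (s i))) => s.
apply: (@continuous_mul _ _ (fun=> (-1) ^+ s) (fun x => \prod_i A x i (s i))).
  exact: (@cst_continuous T R ((-1) ^+ s) t).
by apply: (@continuous_prod _ _ (fun i x => A x i (s i))) => i; exact: H.
Qed.

Lemma posdef_det_neq0 n (A : 'M[R]_n) : posdef A -> \det A != 0.
Proof.
move=> [_ pA]; apply/eqP => /eqP /det0P [v v0 vA].
by have := pA v v0; rewrite /bform vA mul0mx mxE ltxx.
Qed.

Lemma bform1_gt0 n (u : 'rV[R]_n) : u != 0 -> 0 < bform 1%:M u u.
Proof.
move=> u0; rewrite /bform mulmx1 mxE.
have E i : u 0 i * u^T i 0 = u 0 i ^+ 2 by rewrite mxE expr2.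
rewrite (eq_bigr _ (fun i _ => E i)) lt_neqAle sumr_ge0 ?andbT => [|i _];
  last exact: sqr_ge0.
apply/negP => /eqP /esym H; move/negP: u0; apply; apply/eqP/rowP => i; rewrite mxE.
have /eqP := psumr_eq0P (fun i _ => sqr_ge0 (u 0 i)) H (i := i) isT.
by rewrite sqrf_eq0 => /eqP.
Qed.

(* The segment from the identity to [A] consists of positive definite matrices,
   so the determinant keeps its sign along it. *)
Lemma posdef_det_gt0 n (A : 'M[R]_n) : posdef A -> 0 < \det A.
Proof.
move=> pA; rewrite ltNge; apply/negP => dA.
pose B := fun t : R => (1 - t) *: 1%:M + t *: A.
have B0 : \det (B 0) = 1 by rewrite /B subr0 scale1r scale0r addr0 det1.
have B1 : B 1 = A by rewrite /B subrr scale0r scale1r add0r.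
have cB : {within `[0, 1], continuous (fun t => \det (B t))}.
  apply: continuous_in_subspaceT => t _; apply: det_continuous => i j.
  have -> : (fun s => B s i j) = fun s => (1 - s) * (1%:M : 'M[R]_n) i j + s * A i j.
    by apply/funext => s; rewrite !mxE.
  apply: differentiable_continuous; apply: differentiableD.
    by apply: differentiableM => //; apply: differentiableB.
  by apply: differentiableM.
have [||c c01 Bc] := @IVT R (fun t => \det (B t)) 0 1 0 _ cB.
- exact: ler01.
- by rewrite B0 B1 ge_min le_max ler01 dA orbT.
move: c01; rewrite in_itv /= => /andP[c0 c1].
have pB : posdef (B c).
  split; first by rewrite /B linearD /= !linearZ /= trmx1 (proj1 pA).
  move=> u u0; rewrite /bform /B mulmxDr mulmxDl -!scalemxAr -!scalemxAl.
  rewrite mxE [X in X + _]mxE [X in _ + X]mxE -!/(bform _ u u).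
  have h1 := bform1_gt0 u0; have h2 := (proj2 pA) u u0.
  have [->|c0'] := eqVneq c 0; first by rewrite subr0 mul1r mul0r addr0.
  have c0'' : 0 < c by rewrite lt_neqAle eq_sym c0'.
  apply: ltr_wpDl; last exact: mulr_gt0.
  by apply: mulr_ge0; [rewrite subr_ge0 | exact: ltW].
by have := posdef_det_neq0 pB; rewrite Bc eqxx.
Qed.

End det_posdef.

(** * Riemannian volume of small balls *)

Section ball_volume.
Context {R : realType} {n : nat} {M : ptopologicalType}.
Context {X : smooth_manifold R n M} (g : riemannian_metric X).
Local Notation ch := (chart_at X).
Local Notation dom p := (chart_dom (chart_at X p)).
Local Notation phi p := (chart_map (chart_at X p)).
Local Notation center := (chart_pt X).
Hypothesis M_connected : connected [set: M].

Definition rball p (r : R) : set (borel M) := [set x | rdist g x p < r].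

Lemma open_borel (A : set M) : open A -> measurable (A : set (borel M)).
Proof. by move=> oA; exact: sub_sigma_algebra. Qed.

Lemma measurable_rball p r : measurable (rball p r).
Proof. by apply: open_borel; exact: open_rdist_ball. Qed.

Variable vol : {measure set (borel M) -> \bar R}.
Hypothesis vol_riemannian : is_riemannian_volume g vol.

Definition unit_ball_integral p : \bar R :=
  integral_rV (fun v : 'rV[R]_n => (\1_[set v | cnorm g p v < 1] v)%:E).

(** The norm lies between two positive multiples of the sup norm, so its unit ball contains a cube
    and is contained in a cube, and cubes have explicit volumes. *)
Lemma unit_ball_integral_pos p : (0 < unit_ball_integral p < +oo)%E.
Proof.
have ind0 (A : set 'rV[R]_n) v : (0 <= (\1_A v)%:E :> \bar R)%E.
  by rewrite lee_fin indicE.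
have [L L0 HL] := qnorm_ub (metric g p (center p)).
have [l l0 Hl] := qnorm_lb (center_pd g p).
have indS (A B : set 'rV[R]_n) : A `<=` B ->
    forall v, ((\1_A v)%:E <= (\1_B v)%:E :> \bar R)%E.
  move=> AB v; rewrite lee_fin !indicE ler_nat; case: (boolP (v \in A)) => // vA.
  by rewrite (mem_set (AB _ _)) //; rewrite inE in vA.
have k1 : 0 < (2 * L)^-1 by rewrite invr_gt0 mulr_gt0.
have k2 : 0 < 2 * l^-1 by rewrite mulr_gt0 // invr_gt0.
apply/andP; split.
  apply: (@lt_le_trans _ _ ((2 * (2 * L)^-1) ^+ n)%:E).
    by rewrite lte_fin exprn_gt0 // mulr_gt0.
  rewrite -integral_rV_box //; apply: integral_rV_le => //; apply: indS.
  move=> v vb /=; apply: le_lt_trans (HL v) _.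
  apply: (@le_lt_trans _ _ (L * (2 * L)^-1)).
    by rewrite ler_pM2l // rV_norm_le // => [|i]; [exact: ltW | exact/ltW/vb].
  rewrite invfM mulrCA divff ?mulr1; last exact: lt0r_neq0.
  by rewrite invf_lt1 // ltr1n.
apply: (@le_lt_trans _ _ ((2 * (2 * l^-1)) ^+ n)%:E); last exact: ltry.
rewrite -integral_rV_box //; apply: integral_rV_le => //; apply: indS.
move=> v /= v1 i; apply: le_lt_trans (rV_coord_norm v i) _.
have : l * `|v| < 1 by apply: le_lt_trans (Hl v) v1.
rewrite -ltr_pdivlMl // mulr1 => /lt_le_trans; apply.
by rewrite ler_peMl ?ler1n // invr_ge0 ltW.
Qed.

Lemma ball_integral p (r c : R) : 0 < r -> 0 < c ->
  integral_rV (fun v : 'rV[R]_n => (\1_[set v | cnorm g p (v - center p) < r] v * c)%:E)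
  = ((c * r ^+ n)%:E * unit_ball_integral p)%E.
Proof.
move=> r0 c0; have r'0 : 0 < r^-1 by rewrite invr_gt0.
pose f := fun v : 'rV[R]_n => ((\1_[set v | cnorm g p v < 1] v)%:E : \bar R).
have f0 v : (0 <= f v)%E by rewrite lee_fin indicE.
transitivity (integral_rV (fun v : 'rV[R]_n => (c%:E *
   f (- (r^-1 *: center p) + r^-1 *: v)%R)%E)).
  congr integral_rV; apply/funext => v; rewrite /f -EFinM mulrC; congr ((c * _)%:E).
  rewrite !indicE; congr (nat_of_bool _)%:R.
  have E : (cnorm g p (- (r^-1 *: center p) + r^-1 *: v) < 1) =
      (cnorm g p (v - center p) < r).
    rewrite addrC -scalerBr [cnorm _ _ (_ *: _)]qnormZ gtr0_norm // mulrC.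
    by rewrite ltr_pdivrMr // mul1r.
  by apply/idP/idP; rewrite !inE /= E.
rewrite integral_rVZ // integral_rV_affine // muleA -EFinM; congr (_%:E * _)%E.
by rewrite exprVn invrK.
Qed.

Lemma sqrt_det_near p (K : R) : 1 < K -> exists2 d, 0 < d & forall v,
  `|v - center p| < d ->
  K^-1 * Num.sqrt (\det (metric g p (center p))) <= Num.sqrt (\det (metric g p v))
    <= K * Num.sqrt (\det (metric g p (center p))).
Proof.
move=> K1; have K0 : 0 < K by exact: lt_trans K1.
set s0 := Num.sqrt (\det (metric g p (center p))).
have s00 : 0 < s0 by rewrite sqrtr_gt0; apply: posdef_det_gt0; exact: center_pd.
have cs : {for center p, continuous (fun v => Num.sqrt (\det (metric g p v)))}.
  apply: (@continuous_compose _ _ _ (fun v => \det (metric g p v)) Num.sqrt);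
    last exact: sqrt_continuous.
  by apply: det_continuous => i j; exact: metric_continuous (center_cod p).
(* This tolerance is exact for the lower bound and sufficient for the upper one, as 1 - 1/K <= K -
   1. *)
have e0 : 0 < (1 - K^-1) * s0 by rewrite mulr_gt0 // subr_gt0 invf_lt1.
have /cvgrPdist_lt /(_ _ e0) /nbhs_ballP [d /= d0 Hd] := cs.
exists d => // v vd; have := Hd v; rewrite -ball_normE /= distrC => /(_ vd).
rewrite -/s0 ltr_norml => /andP[h1 h2].
have KK : 1 - K^-1 <= K - 1.
  rewrite -subr_ge0 (_ : K - 1 - (1 - K^-1) = (K - 1) ^+ 2 / K).
    by rewrite divr_ge0 ?sqr_ge0 // ltW.
  by field; exact: lt0r_neq0.
have := ler_wpM2r (ltW s00) KK => h3.
apply/andP; split; lra.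
Qed.

(** C is the Lebesgue volume of the unit ball of the metric at p times the density there. It is
    chosen before K, so that it cancels when radii are compared. Of the n + 1 factors K, one is lost
    on the density and n on replacing the metric ball by chart balls of radii r / K and K r. *)
Lemma rball_volume p : exists2 C : R, 0 < C & forall K, 1 < K ->
  exists2 r0, 0 < r0 & forall r, 0 < r -> r <= r0 ->
    ((K^-1 ^+ n.+1 * C * r ^+ n)%:E <= vol (rball p r) <=
       (K ^+ n.+1 * C * r ^+ n)%:E)%E.
Proof.
set s0 := Num.sqrt (\det (metric g p (center p))).
have s00 : 0 < s0 by rewrite sqrtr_gt0; apply: posdef_det_gt0; exact: center_pd.
have /andP[I0 Ioo] := unit_ball_integral_pos p.
have EI : unit_ball_integral p = (fine (unit_ball_integral p))%:E.
  by rewrite fineK // ge0_fin_numE // ltW.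
set I := fine _ in EI.
have I00 : 0 < I by rewrite -lte_fin -EI.
exists (s0 * I); first exact: mulr_gt0.
move=> K K1; have K0 : 0 < K by exact: lt_trans K1.
have [r0 r00 [H1 H2]] := rdist_comparison g M_connected p K1.
have [d d0 Hd] := sqrt_det_near p K1.
have [l l0 Hl] := qnorm_lb (center_pd g p).
pose m := Num.min r0 (l * d).
have m0 : 0 < m by rewrite lt_min r00 mulr_gt0.
have mr : m <= r0 by rewrite ge_min lexx.
have nd (v : 'rV[R]_n) : cnorm g p (v - center p) < m -> `|v - center p| < d.
  move=> vm; rewrite -(ltr_pM2l l0); apply: le_lt_trans (Hl _) _.
  by apply: lt_le_trans vm _; rewrite ge_min lexx orbT.
exists (m / K); first by rewrite divr_gt0.
move=> r r1; rewrite ler_pdivlMr // => rm.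
have Kr : K * r <= m by rewrite mulrC.
have rK : r / K < K * r.
  rewrite ltr_pdivrMr // mulrAC ltr_pMl //.
  by rewrite -expr2 exprn_egt1.
have in_chart x : rball p r x ->
    dom p x /\ cnorm g p (phi p x - center p) < K * r.
  move=> xr; have Kx : K * rdist g x p < K * r by rewrite ltr_pM2l.
  have [px nx] := H2 x (lt_le_trans Kx (le_trans Kr mr)).
  by split => //; exact: le_lt_trans nx Kx.
have -> : vol (rball p r) = integral_rV (fun v =>
      (\1_(phi p @` rball p r) v * Num.sqrt (\det (metric g p v)))%:E).
  apply: vol_riemannian; first exact: measurable_rball.
  by move=> x /in_chart[].
apply/andP; split.
  have -> : (K^-1 ^+ n.+1 * (s0 * I) * r ^+ n)%:E =
      ((K^-1 * s0 * (r / K) ^+ n)%:E * unit_ball_integral p)%E.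
    by rewrite EI -EFinM; congr EFin; rewrite exprMn exprS; ring.
  have K'0 : 0 < K^-1 by rewrite invr_gt0.
  rewrite -ball_integral ?divr_gt0 ?mulr_gt0 //.
  apply: integral_rV_le => v.
    by rewrite lee_fin mulr_ge0 ?indicE // mulr_ge0 // ltW.
  rewrite lee_fin !indicE.
  have [vr|_] := boolP (v \in [set v | cnorm g p (v - center p) < r / K]);
    last by rewrite mul0r mulr_ge0 // sqrtr_ge0.
  rewrite inE /= in vr.
  have vm : cnorm g p (v - center p) < m.
    by apply: lt_le_trans Kr; exact: lt_trans rK.
  have [cv dv] := H1 v (lt_le_trans vm mr).
  have [di Ei] := chart_invK cv.
  rewrite mem_set; last first.
    exists (chart_inv (ch p) v) => //; rewrite /rball /=.
    by apply: le_lt_trans dv _; rewrite mulrC -ltr_pdivlMr.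
  by rewrite !mul1r; have /andP[] := Hd v (nd v vm).
have -> : (K ^+ n.+1 * (s0 * I) * r ^+ n)%:E =
    ((K * s0 * (K * r) ^+ n)%:E * unit_ball_integral p)%E.
  by rewrite EI -EFinM; congr EFin; rewrite exprMn exprS; ring.
rewrite -ball_integral ?mulr_gt0 //.
apply: integral_rV_le => v; first by rewrite lee_fin mulr_ge0 ?indicE // sqrtr_ge0.
rewrite lee_fin !indicE.
have [|_] := boolP (v \in phi p @` rball p r); last first.
  by rewrite mul0r mulr_ge0 // mulr_ge0 // ltW.
rewrite inE => -[x xr <-]; have [px nx] := in_chart x xr.
rewrite mem_set // !mul1r.
by have /andP[] := Hd _ (nd _ (lt_le_trans nx Kr)).
Qed.

End ball_volume.

(** * A Laplace estimate from volume ratios *)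

Section measure_comparison.
Local Open Scope ereal_scope.
Context d (T : measurableType d) (R : realType).
Implicit Types (mu : {measure set T -> \bar R}) (f h : T -> R).
Import HBNNSimple.

(** Layer-cake formula: the mean of a nonnegative variable is the integral of its tail
    probabilities, so a comparison of tails passes to the means. *)
Lemma le_expectation_superlevel (P : probability T R) f h (K : R) : (0 <= K)%R ->
  measurable_fun setT f -> measurable_fun setT h ->
  (forall x, 0 <= f x)%R -> (forall x, 0 <= h x)%R ->
  (forall t, (0 <= t)%R -> P [set x | t < f x]%R <= K%:E * P [set x | t < h x]%R) ->
  \int[P]_x (f x)%:E <= K%:E * \int[P]_x (h x)%:E.
Proof.
move=> K0 mf mh f0 h0 H.
pose F : {RV P >-> R} := HB.pack f (isMeasurableFun.Build _ _ _ _ f mf).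
pose G : {RV P >-> R} := HB.pack h (isMeasurableFun.Build _ _ _ _ h mh).
have EF := ge0_expectation_ccdf (X := F) f0.
have EG := ge0_expectation_ccdf (X := G) h0.
rewrite !expectation_def in EF EG.
pose I : set (measurableTypeR R) := `[0%R, +oo[%classic.
have mc (Y : {RV P >-> R}) : measurable_fun I (ccdf Y).
  by apply: measurable_funTS; exact: ccdf_measurable.
have c0 (Y : {RV P >-> R}) t : I t -> 0 <= ccdf Y t.
  by move=> _; exact: measure_ge0.
have mI : measurable I by exact: measurable_itv.
have K0E : 0 <= K%:E by rewrite lee_fin.
suff main : \int[lebesgue_measure]_(r in I) ccdf F r <=
    K%:E * \int[lebesgue_measure]_(r in I) ccdf G r.
  by rewrite [leLHS]EF [X in _ * X]EG; exact: main.
rewrite -(ge0_integralZl _ mI (mc G) (c0 G) K0E).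
apply: ge0_le_integral; [exact: mI | exact: c0 | exact: mc | |].
  by apply: measurable_funeM; exact: mc.
move=> t; rewrite /I /= in_itv /= andbT => t0.
have E (Y : {RV P >-> R}) : ccdf Y t = P [set x | t < Y x]%R.
  rewrite /ccdf /distribution /pushforward; congr (P _).
  by apply/seteqP; split => x /=; rewrite in_itv /= andbT.
by rewrite !E; exact: H.
Qed.

(** Normalising mu to a probability divides all the terms by the same constant, which reduces the
    claim to the probabilistic one. *)
Lemma le_integral_superlevel mu f h (K : R) : (0 <= K)%R ->
  0 < mu setT -> mu setT < +oo ->
  measurable_fun setT f -> measurable_fun setT h ->
  (forall x, 0 <= f x)%R -> (forall x, 0 <= h x)%R ->
  (forall t, (0 <= t)%R -> mu [set x | t < f x]%R <= K%:E * mu [set x | t < h x]%R) ->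
  \int[mu]_x (f x)%:E <= K%:E * \int[mu]_x (h x)%:E.
Proof.
move=> K0 mu0 muoo mf mh f0 h0 H.
pose P := mnormalize mu (dirac point).
pose c := fine (mu setT).
have Ec : mu setT = c%:E by rewrite fineK // ge0_fin_numE.
have c0 : (0 < c)%R by rewrite -lte_fin -Ec.
have c'0 : (0 <= c^-1)%R by rewrite invr_ge0 ltW.
have PE A : P A = (c^-1)%:E * mu A.
  by rewrite /P /mnormalize -/c gt_eqF // lt_eqF //= muleC.
have PI (k : T -> R) : measurable_fun setT k -> (forall x, 0 <= k x)%R ->
    \int[P]_x (k x)%:E = (c^-1)%:E * \int[mu]_x (k x)%:E.
  move=> mk k0.
  rewrite -(@ge0_integral_mscale _ _ _ _ _ _ (NngNum c'0)) //.
  - by apply: eq_measure_integral => A mA _; exact: PE.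
  - exact/measurable_EFinP.
  - by move=> x _; rewrite lee_fin.
have := @le_expectation_superlevel P f h K K0 mf mh f0 h0 _.
rewrite !PI // muleCA lee_pmul2l ?lte_fin ?invr_gt0 //; apply => t t0.
suff : (c^-1)%:E * mu [set x | t < f x]%R <=
    K%:E * ((c^-1)%:E * mu [set x | t < h x]%R) by rewrite -!PE.
rewrite muleCA lee_pmul2l ?lte_fin ?invr_gt0 //; exact: H.
Qed.

(** A simple function below f is a finite combination of indicators of its level sets, whose
    P-measure is given by the density. The supremum over such functions yields the inequality. *)
Lemma integral_density_le mu (P : {measure set T -> \bar R}) (w : T -> R) (z : R)
    (f : T -> \bar R) :
  measurable_fun setT w -> (forall x, 0 <= w x)%R -> (0 <= z)%R ->
  (forall A, measurable A -> P A = z%:E * \int[mu]_(x in A) (w x)%:E) ->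
  (forall x, 0 <= f x) ->
  \int[P]_x f x <= z%:E * \int[mu]_x (f x * (w x)%:E).
Proof.
move=> mw w0 z0 HP f0; apply: nonneg_integral_ub => // s sf.
have mS (y : R) : measurable (s @^-1` [set y]) by exact: measurable_sfunP.
have mwE : measurable_fun setT (EFin \o w) by exact/measurable_EFinP.
have -> : \int[P]_x (s x)%:E = z%:E * \int[mu]_x ((s x)%:E * (w x)%:E).
  (* The absolute value makes [F y] nonnegative for every real y; it does nothing on the range of
     s. *)
  pose F (y : R) x := (`|y| * (\1_(s @^-1` [set y]) x * w x))%R.
  have F0 y x : (0 <= F y x)%R by rewrite mulr_ge0 // mulr_ge0 // indicE.
  have mF y : measurable_fun setT (fun x => (F y x)%:E : \bar R).
    apply/measurable_EFinP; apply: measurable_funM => //.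
    by apply: measurable_funM => //; exact: measurable_indic.
  rewrite integral_nnsfun // patch_setT sintegralE fsbig_finite //=.
  transitivity (\sum_(y <- finmap.enum_fset (fset_set (range s))) z%:E * \int[mu]_x (F y x)%:E).
    rewrite big_seq [RHS]big_seq; apply: eq_bigr => y.
    rewrite in_fset_set // inE => -[t _ yE].
    have y0 : (0 <= y)%R by rewrite -yE.
    rewrite [P _]HP // muleCA; congr (_ * _).
    rewrite /F ger0_norm //.
    under [RHS]eq_integral do rewrite EFinM.
    have mi : measurable_fun setT
        (fun x => (\1_(s @^-1` [set y]) x * w x)%R%:E : \bar R).
      apply/measurable_EFinP.
      by apply: measurable_funM => //; exact: measurable_indic.
    rewrite (ge0_integralZl _ measurableT mi) //; last first.
      by move=> x _; rewrite lee_fin mulr_ge0 // indicE.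
    congr (_ * _); rewrite integral_mkcond; apply: eq_integral => x _.
    rewrite patchE indicE; case: ifP => _; first by rewrite mul1r.
    by rewrite mul0r.
  rewrite -ge0_sume_distrr; last first.
    by move=> y _; apply: integral_ge0 => x _; rewrite lee_fin.
  congr (_ * _); rewrite -ge0_integral_sum //; last by move=> y x _; rewrite lee_fin.
  apply: eq_integral => x _; rewrite sumEFin -EFinM; congr EFin.
  rewrite [X in (X * _)%R]fimfunE fsbig_finite //= mulr_suml big_seq [RHS]big_seq.
  apply: eq_bigr => y; rewrite in_fset_set // inE => -[t _ yE].
  by rewrite /F ger0_norm ?mulrA // -yE.
apply: lee_wpmul2l; first by rewrite lee_fin.
apply: nonneg_le_integral => x; first by apply: mule_ge0; rewrite lee_fin.
by apply: lee_wpmul2r; rewrite ?lee_fin.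
Qed.

End measure_comparison.

(** On the left is the loss from contracting balls by 7/8, on the right the growth that (pi / 2)^2
    >= 9/4 offers. The value 162/1000 fits at n = 1, where the left side is about 0.154, and is
    small enough for the final budget 3/2. *)
Lemma growth_bound (R : realType) n : (0 < n)%N ->
  101 / 100 * (8 / 7) ^+ n - 1 <= 162 / 1000 * (9 / 4) ^+ n.-1 :> R.
Proof.
case: n => // n _; elim: n => [|n IH]; first by rewrite expr1 expr0; lra.
have t1 : 1 <= (9 / 4) ^+ n :> R by apply: exprn_ege1; lra.
rewrite [(8 / 7) ^+ _]exprS [n.+2.-1]/= [(9 / 4) ^+ n.+1]exprS; move: IH => /=; lra.
Qed.

Section laplace.
Context d (T : measurableType d) (R : realType) (mu : {measure set T -> \bar R}).
Hypothesis mu_gt0 : (0 < mu setT)%E.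
Hypothesis mu_fin : (mu setT < +oo)%E.
Variable dd : T -> R.
Hypothesis mdd : measurable_fun setT dd.
Hypothesis dd_ge0 : forall x, 0 <= dd x.

(** A class stable under sums and products, all of whose members are integrable for a finite
    measure. *)
Definition bounded_measurable (f : T -> R) : Prop :=
  measurable_fun setT f /\ exists C : R, forall x, `|f x| <= C.

Lemma bounded_measurable_integrable f : bounded_measurable f ->
  mu.-integrable setT (EFin \o f).
Proof.
move=> [mf [C fC]]; apply: measurable_bounded_integrable => //.
exists C; split; first exact: num_real.
by move=> B CB x _; exact: le_trans (fC x) (ltW CB).
Qed.

Lemma bounded_measurableM f h : bounded_measurable f -> bounded_measurable h ->
  bounded_measurable (fun x => f x * h x).
Proof.
move=> [mf [C fC]] [mh [D hD]]; split; first exact: measurable_funM.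
by exists (C * D) => x; rewrite normrM; apply: ler_pM.
Qed.

Lemma bounded_measurableD f h : bounded_measurable f -> bounded_measurable h ->
  bounded_measurable (fun x => f x + h x).
Proof.
move=> [mf [C fC]] [mh [D hD]]; split; first exact: measurable_funD.
by exists (C + D) => x; apply: le_trans (ler_normD _ _) _; apply: lerD.
Qed.

Lemma bounded_measurable_cst (c : R) : bounded_measurable (fun=> c).
Proof. by split; [exact: measurable_cst | exists `|c|]. Qed.

Lemma bounded_measurable_indic A : measurable A -> bounded_measurable (\1_A : T -> R).
Proof.
move=> mA; split; first exact: measurable_indic.
by exists 1 => x; rewrite indicE; case: (_ \in _); rewrite ?normr1 // normr0.
Qed.

Lemma measurable_level (r : R) : measurable [set x | dd x < r].
Proof.
rewrite -[X in measurable X]setTI -[X in _ `&` X]/(dd @^-1` [set s | s < r]).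
rewrite (_ : [set s | s < r] = `]-oo, r[%classic); last first.
  by apply/seteqP; split => s /=; rewrite in_itv.
exact: (mdd measurableT (measurable_itv _)).
Qed.

Lemma measurable_superlevel (f : T -> R) (t : R) : measurable_fun setT f ->
  measurable [set x | t < f x].
Proof.
move=> mf.
have -> : [set x | t < f x] = setT `&` f @^-1` `]t, +oo[%classic.
  apply/seteqP; split => x /=; rewrite in_itv /= andbT; first by split.
  by case.
by apply: mf => //; exact: measurable_itv.
Qed.

Lemma bounded_measurable_exp (h : T -> R) : measurable_fun setT h ->
  (forall x, 0 <= h x) -> bounded_measurable (fun x => expR (- h x)).
Proof.
move=> mh h0; split.
  by apply: measurableT_comp => //; exact: measurable_funN.
by exists 1 => x; rewrite ger0_norm ?expR_ge0 // expR_le1 oppr_le0.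
Qed.

Local Notation J f := (\int[mu]_(x in setT) (f x)%R).

Lemma le_J f h : bounded_measurable f -> bounded_measurable h ->
  (forall x, f x <= h x) -> J f <= J h.
Proof.
by move=> bf bh fh; apply: le_Rintegral => //; exact: bounded_measurable_integrable.
Qed.

Lemma J_add f h : bounded_measurable f -> bounded_measurable h ->
  J (fun x => f x + h x) = J f + J h.
Proof.
by move=> bf bh; apply: RintegralD => //; exact: bounded_measurable_integrable.
Qed.

Lemma J_scale c f : bounded_measurable f -> J (fun x => c * f x) = c * J f.
Proof.
by move=> bf; apply: RintegralZl => //; exact: bounded_measurable_integrable.
Qed.

Lemma J_cst (c : R) : J (fun=> c) = c * fine (mu setT).
Proof. by rewrite Rintegral_cst. Qed.

Variable r0 : R.
Hypothesis r0_gt0 : 0 < r0.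

Definition ball_gauss (a : R) (x : T) : R :=
  \1_[set x | dd x < r0] x * expR (- (a * dd x ^+ 2 / 2)).

Lemma measurable_quad a : measurable_fun setT (fun x => a * dd x ^+ 2 / 2).
Proof.
apply: measurable_funM => //; apply: measurable_funM => //.
exact: measurable_funX.
Qed.

Lemma ball_gauss_ge0 a x : 0 <= ball_gauss a x.
Proof. by rewrite mulr_ge0 ?expR_ge0 // indicE. Qed.

Lemma bounded_ball_gauss a : 0 <= a -> bounded_measurable (ball_gauss a).
Proof.
move=> a0; apply: bounded_measurableM.
  exact/bounded_measurable_indic/measurable_level.
apply: bounded_measurable_exp; first exact: measurable_quad.
by move=> x; rewrite divr_ge0 // mulr_ge0 // sqr_ge0.
Qed.

Definition Phi a := J (ball_gauss a).

(* A superlevel set of the truncated gaussian is a ball, so that layer-cake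
   integration only involves ball volumes. *)
Lemma gauss_level a t : 0 < a -> 0 <= t -> t < 1 ->
  exists2 r, 0 < r <= r0 & forall u, 0 <= u ->
    ((u < r0) && (t < expR (- (a * u ^+ 2 / 2)))) = (u < r).
Proof.
move=> a0; rewrite le_eqVlt => /predU1P[<- _|t0 t1].
  exists r0; first by rewrite r0_gt0 lexx.
  by move=> u u0; rewrite expR_gt0 andbT.
have lt0 : 0 < - (2 * ln t / a).
  by rewrite -mulNr divr_gt0 // -mulrN mulr_gt0 // oppr_gt0 ln_lt0 // t0.
exists (Num.min r0 (Num.sqrt (- (2 * ln t / a)))).
  by rewrite lt_min r0_gt0 sqrtr_gt0 lt0 ge_min lexx.
move=> u u0; rewrite lt_min; congr (_ && _).
rewrite -{1}(lnK t0) ltr_expR ltrNr.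
rewrite -{2}(ger0_norm u0) -sqrtr_sqr ltr_sqrt // -mulNr ltr_pdivlMr //.
rewrite ltr_pdivrMr // mulNr -mulrN; congr (_ < _); ring.
Qed.

(** At each level, the superlevel set for the parameter a is a ball of some radius r, and the one
    for a / q^2 contains the ball of radius q r. This is an inclusion only, since both gaussians are
    cut off at the same r0. *)
Lemma Phi_scale (K q a : R) : 0 <= K -> 0 < q -> q <= 1 -> 0 < a ->
  (forall r, 0 < r -> r <= r0 ->
    (mu [set x | dd x < r]%R <= K%:E * mu [set x | dd x < q * r]%R)%E) ->
  Phi a <= K * Phi (a / q ^+ 2).
Proof.
move=> K0 q0 q1 a0 H.
have aq0 : 0 < a / q ^+ 2 by rewrite divr_gt0 // exprn_gt0.
have b1 := bounded_ball_gauss (ltW a0).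
have b2 := bounded_ball_gauss (ltW aq0).
have int_fin b : 0 <= b -> (\int[mu]_x (ball_gauss b x)%:E = (Phi b)%:E)%E.
  move=> b0; rewrite fineK //; apply: integrable_fin_num => //.
  exact/bounded_measurable_integrable/bounded_ball_gauss.
have L := @le_integral_superlevel d T R mu (ball_gauss a) (ball_gauss (a / q ^+ 2))
  K K0 mu_gt0 mu_fin (proj1 b1) (proj1 b2) (ball_gauss_ge0 a) (ball_gauss_ge0 _).
rewrite -lee_fin EFinM -(int_fin _ (ltW a0)) -(int_fin _ (ltW aq0)); apply: L.
move=> t t0.
have E b x : (t < ball_gauss b x) = ((dd x < r0) && (t < expR (- (b * dd x ^+ 2 / 2)))).
  rewrite /ball_gauss indicE; case: (boolP (dd x < r0)) => xr.
    by rewrite mem_set ?mul1r.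
  by rewrite memNset /= ?mul0r; [rewrite ltNge t0 | exact/negP].
have [t1|t1] := ltP t 1; last first.
  rewrite (_ : [set x | _] = set0) ?measure0 ?mule_ge0 ?lee_fin //.
  apply/seteqP; split => x //=; rewrite E => /andP[_]; rewrite ltNge => /negP; apply.
  apply: le_trans t1; rewrite expR_le1 oppr_le0 divr_ge0 // mulr_ge0 ?sqr_ge0 //.
  exact: ltW.
have [r /andP[rp rr0] Hr] := gauss_level a0 t0 t1.
rewrite (_ : [set x | t < ball_gauss a x] = [set x | dd x < r]); last first.
  by apply/seteqP; split => x /=; rewrite E Hr.
apply: le_trans (H r rp rr0) _; apply: lee_wpmul2l; first by rewrite lee_fin.
apply: le_measure; rewrite ?inE; first exact: measurable_level.
  exact: measurable_superlevel (proj1 b2).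
move=> x /= xr; rewrite E.
have xq : dd x / q < r by rewrite ltr_pdivrMr // mulrC.
have xq0 : 0 <= dd x / q by rewrite divr_ge0 // ltW.
have := Hr _ xq0; rewrite xq => /andP[_ h2].
apply/andP; split; last first.
  by rewrite (_ : _ / 2 = a * (dd x / q) ^+ 2 / 2) //; field; exact: lt0r_neq0.
by apply: lt_le_trans xr _; apply: le_trans rr0; rewrite ler_piMl // ltW.
Qed.

Variable D : R.
Hypothesis dd_le : forall x, dd x <= D.

Lemma bounded_measurable_sqr : bounded_measurable (fun x => dd x ^+ 2).
Proof.
split; first exact: measurable_funX.
exists (D ^+ 2) => x; rewrite ger0_norm ?sqr_ge0 //.
by rewrite ler_pXn2r ?nnegrE // (le_trans (dd_ge0 x)).
Qed.

Lemma bounded_ball_moment a : 0 <= a ->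
  bounded_measurable (fun x => dd x ^+ 2 * ball_gauss a x).
Proof.
move=> a0; apply: bounded_measurableM; first exact: bounded_measurable_sqr.
exact: bounded_ball_gauss.
Qed.

(* Convexity of the exponential: [h y e^(-y) <= e^(-(1 - h) y) - e^(-y)]. *)
Lemma Phi_moment (h a : R) : 0 < h -> h < 1 -> 0 < a ->
  h * a / 2 * J (fun x => dd x ^+ 2 * ball_gauss a x) + Phi a <= Phi ((1 - h) * a).
Proof.
move=> h0 h1 a0.
have ha0 : 0 <= (1 - h) * a by rewrite mulr_ge0 ?subr_ge0 ?ltW.
have b1 := bounded_ball_moment (ltW a0); have b2 := bounded_ball_gauss (ltW a0).
rewrite -J_scale // -J_add //; last first.
  by apply: bounded_measurableM b1; exact: bounded_measurable_cst.
apply: le_J; last 1 first.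
- move=> x; rewrite /ball_gauss indicE; case: (_ \in _); last by rewrite !mul0r !mulr0 addr0.
  rewrite !mul1r; set y := dd x ^+ 2.
  have -> : - ((1 - h) * a * y / 2) = h * a / 2 * y + - (a * y / 2) by ring.
  rewrite expRD mulrA -{2}(mul1r (expR (- (a * y / 2)))) -mulrDl.
  by apply: ler_wpM2r; [exact: expR_ge0 | rewrite addrC; exact: expR_ge1Dx].
- apply: bounded_measurableD => //; apply: bounded_measurableM b1.
  exact: bounded_measurable_cst.
- exact: bounded_ball_gauss.
Qed.

End laplace.

Local Notation J mu f := (\int[mu]_(x in setT) (f x)%R).

(** Write a = mumin / t and b = mumax / t. The denominator is at least [Phi b], and the part of the
    numerator near the minimum is at most S, the second moment of the gaussian of parameter a.
    Convexity bounds a S by a multiple of [Phi a], and contraction bounds [Phi a] by a multiple of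
    [Phi b]. Far away the weight is at most e^2 with e = exp(- u0 / (2 t)): one factor e is paid by
    [Phi b >= e v1], the other is at most a multiple of t^2. *)
Lemma gibbs_second_moment d (T : measurableType d) (R : realType)
  (mu : {measure set T -> \bar R}) (dd : T -> R) (r0 D : R)
  (n : nat) (V : T -> R) (mumin mumax u0 : R) :
  (0 < mu setT)%E -> (mu setT < +oo)%E ->
  measurable_fun setT dd -> (forall x, 0 <= dd x) -> (forall x, dd x <= D) -> 0 < r0 ->
  (0 < n)%N -> measurable_fun setT V -> (forall x, 0 <= V x) ->
  0 < mumin -> mumin <= mumax -> 0 < u0 ->
  (forall x, dd x < r0 -> mumin * dd x ^+ 2 <= 2 * V x <= mumax * dd x ^+ 2) ->
  (forall x, r0 <= dd x -> u0 <= V x) ->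
  (forall q r, 0 < q -> q <= 1 -> 0 < r -> r <= r0 ->
    (mu [set x | dd x < r]%R <=
       (101 / 100 * q ^- n)%:E * mu [set x | dd x < q * r]%R)%E) ->
  (forall r, 0 < r -> (0 < mu [set x | dd x < r]%R)%E) ->
  exists2 TW, 0 < TW & forall t, 0 < t -> t <= TW ->
    J mu (fun x => dd x ^+ 2 * expR (- (V x / t))) <=
    3 / 2 * (9 / 4) ^+ n.-1 * (mumax / mumin) ^+ n * (t / mumin) *
      J mu (fun x => expR (- (V x / t))).
Proof.
move=> mu_gt0 mu_fin mdd dd_ge0 dd_le r0_gt0 n0 mV V0 min0 minmax u00 Vin Vout volq volpos.
have max0 : 0 < mumax by exact: lt_le_trans minmax.
pose k := mumax / mumin.
have k0 : 0 < k by rewrite divr_gt0.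
have k1 : 1 <= k by rewrite ler_pdivlMr // mul1r.
pose m := fine (mu setT).
have m0 : 0 <= m by exact: fine_ge0.
(* Within r1 the gaussian of parameter mumax / t is at least exp(- u0 / (2 t)), the square root of
   the bound on the weight far from the minimum. *)
pose r1 := Num.min r0 (Num.sqrt (u0 / mumax)).
have r10 : 0 < r1 by rewrite lt_min r0_gt0 sqrtr_gt0 divr_gt0.
have r1sq : mumax * r1 ^+ 2 <= u0.
  have : r1 ^+ 2 <= Num.sqrt (u0 / mumax) ^+ 2.
    by rewrite ler_pXn2r ?nnegrE ?sqrtr_ge0 ?(ltW r10) // ge_min lexx orbT.
  have um : 0 <= u0 / mumax by exact/ltW/divr_gt0.
  rewrite sqr_sqrtr // => h.
  by rewrite mulrC -ler_pdivlMr.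
pose v1 := fine (mu [set x | dd x < r1]).
have v1fin : mu [set x | dd x < r1] = v1%:E.
  rewrite fineK // ge0_fin_numE //; apply: le_lt_trans mu_fin.
  by apply: le_measure; rewrite ?inE //; exact: measurable_level.
have v10 : 0 < v1 by rewrite -lte_fin -v1fin; exact: volpos.
pose C1 := 16 * D ^+ 2 * m / (v1 * u0 ^+ 2).
have C10 : 0 <= C1.
  rewrite /C1 divr_ge0 //; first by rewrite mulr_ge0 // mulr_ge0 // sqr_ge0.
  by rewrite mulr_ge0 ?sqr_ge0 // ltW.
have C1p : 0 < 10 * (mumin * (C1 + 1)) by rewrite !mulr_gt0 // ltr_wpDl.
(* Below this temperature the far contribution C1 t^2 is at most t / (10 mumin); the added 1 covers
   C1 = 0. *)
exists (10 * (mumin * (C1 + 1)))^-1; first by rewrite invr_gt0.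
move=> t t0 tTW.
pose a := mumin / t; pose b := mumax / t.
have a0 : 0 < a by rewrite divr_gt0.
have b0 : 0 < b by rewrite divr_gt0.
pose w x := expR (- (V x / t)).
have bw : bounded_measurable w.
  apply: bounded_measurable_exp; first exact: measurable_funM.
  by move=> x; rewrite divr_ge0 // ltW.
have bdw : bounded_measurable (fun x => dd x ^+ 2 * w x).
  exact: bounded_measurableM (bounded_measurable_sqr mdd dd_ge0 dd_le) bw.
pose S := J mu (fun x => dd x ^+ 2 * ball_gauss dd r0 a x).
have bS := bounded_ball_moment mdd dd_ge0 r0 dd_le (ltW a0).
have bb := bounded_ball_gauss mdd r0 (ltW b0).
pose e := expR (- (u0 / (2 * t))).
have e0 : 0 <= e by exact: expR_ge0.
have W1 : Phi mu dd r0 b <= J mu w.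
  apply: (le_J mu_fin) => //.
  move=> x; rewrite /ball_gauss indicE; case: (boolP (x \in _)); last first.
    by rewrite mul0r expR_ge0.
  rewrite inE /= mul1r /w => /Vin /andP[_ h]; rewrite ler_expR lerN2.
  rewrite ler_pdivrMr //.
  have -> : b * dd x ^+ 2 / 2 * t = mumax * dd x ^+ 2 / 2.
    by rewrite /b; field; exact: lt0r_neq0.
  clear - h; lra.
have W2 : e * v1 <= Phi mu dd r0 b.
  have b1 : bounded_measurable (\1_[set x | dd x < r1] : T -> R).
    exact/bounded_measurable_indic/measurable_level.
  have -> : v1 = J mu (\1_[set x | dd x < r1] : T -> R).
    by rewrite /Rintegral integral_indic ?setIT //; exact: measurable_level.
  rewrite -J_scale //; apply: (le_J mu_fin).
  - by apply: bounded_measurableM b1; exact: bounded_measurable_cst.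
  - exact: bb.
  move=> x; rewrite indicE; case: (boolP (x \in _)); last first.
    by rewrite mulr0 ball_gauss_ge0.
  rewrite inE /= mulr1 => xr1.
  have xr0 : dd x < r0 by apply: lt_le_trans xr1 _; rewrite ge_min lexx.
  rewrite /ball_gauss indicE mem_set // mul1r /e ler_expR lerN2.
  rewrite ler_pdivlMr ?mulr_gt0 //.
  have -> : b * dd x ^+ 2 / 2 * (2 * t) = mumax * dd x ^+ 2.
    by rewrite /b; field; exact: lt0r_neq0.
  apply: le_trans r1sq; rewrite ler_pM2l // ler_pXn2r ?nnegrE ?(ltW r10) //.
  exact: ltW.
have Phib0 : 0 <= Phi mu dd r0 b by apply: le_trans W2; rewrite mulr_ge0 // ltW.
have N1 : J mu (fun x => dd x ^+ 2 * w x) <= S + D ^+ 2 * (e * e) * m.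
  rewrite -J_cst -J_add //; last exact: bounded_measurable_cst.
  apply: (le_J mu_fin) => //.
    by apply: bounded_measurableD bS _; exact: bounded_measurable_cst.
  move=> x; have ee : 0 <= D ^+ 2 * (e * e) by rewrite mulr_ge0 ?sqr_ge0 // mulr_ge0.
  rewrite /ball_gauss indicE; case: (boolP (x \in _)).
    rewrite inE /= mul1r => /Vin /andP[h _]; apply: ler_wpDr => //.
    apply: ler_wpM2l; first exact: sqr_ge0.
    rewrite /w ler_expR lerN2 ler_pdivlMr //.
    have -> : a * dd x ^+ 2 / 2 * t = mumin * dd x ^+ 2 / 2.
      by rewrite /a; field; exact: lt0r_neq0.
    clear - h; lra.
  rewrite notin_setE /= => /negP; rewrite -leNgt => /Vout h.
  rewrite mul0r mulr0 add0r; apply: ler_pM; rewrite ?sqr_ge0 ?expR_ge0 //.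
    by rewrite ler_pXn2r ?nnegrE // (le_trans (dd_ge0 x)).
  rewrite /e -expRD /w ler_expR -opprD lerN2.
  have -> : u0 / (2 * t) + u0 / (2 * t) = u0 / t by field; exact: lt0r_neq0.
  by rewrite ler_pM2r // invr_gt0.
have N2 : D ^+ 2 * (e * e) * m <= C1 * t ^+ 2 * Phi mu dd r0 b.
  (* The inequality exp y >= y is used twice at y = u0 / (4 t), as e = exp(- 2 y). *)
  have he : e <= 16 * t ^+ 2 / u0 ^+ 2.
    pose y := u0 / (4 * t).
    have y0 : 0 < y by rewrite divr_gt0 // mulr_gt0.
    have -> : e = (expR y * expR y)^-1.
      by rewrite -expRD -expRN /e; congr expR; rewrite /y; field; exact: lt0r_neq0.
    have -> : 16 * t ^+ 2 / u0 ^+ 2 = (y * y)^-1.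
      by rewrite /y; field; rewrite !lt0r_neq0.
    have yy0 : 0 < y * y by exact: mulr_gt0.
    have ey0 : 0 < expR y * expR y by rewrite mulr_gt0 // expR_gt0.
    rewrite lef_pV2 ?posrE //.
    have yl : y <= expR y by apply: le_trans (expR_ge1Dx y); rewrite lerDr.
    by apply: ler_pM => //; exact: ltW.
  rewrite [leRHS](_ : _ = D ^+ 2 * m * ((16 * t ^+ 2 / u0 ^+ 2) * (Phi mu dd r0 b / v1)));
    last by rewrite /C1; field; rewrite !lt0r_neq0.
  rewrite mulrAC; apply: ler_wpM2l; first by rewrite mulr_ge0 ?sqr_ge0.
  by apply: ler_pM => //; rewrite ler_pdivlMr.
(* With q = k^(-1/2) the parameter a / q^2 is b. The resulting factor k^(n/2) is weakened to the k^n
   that the target allows. *)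
have q2 : Phi mu dd r0 a <= 101 / 100 * k ^+ n * Phi mu dd r0 b.
  pose q := Num.sqrt k^-1.
  have q0 : 0 < q by rewrite sqrtr_gt0 invr_gt0.
  have qsq : q ^+ 2 = k^-1 by rewrite sqr_sqrtr // invr_ge0 ltW.
  have q1 : q <= 1.
    by rewrite -(@ler_pXn2r _ 2) ?nnegrE ?(ltW q0) // qsq expr1n invf_le1.
  have := Phi_scale mu_gt0 mu_fin mdd dd_ge0 r0_gt0 (K := 101 / 100 * q ^- n) _
    q0 q1 a0 (fun r => volq q r q0 q1).
  have qn0 : 0 < q ^- n by rewrite invr_gt0 exprn_gt0.
  have -> : a / q ^+ 2 = b by rewrite qsq invrK /a /b /k; field; rewrite !lt0r_neq0.
  move=> /(_ (mulr_ge0 _ (ltW qn0))) H; apply: le_trans (H _) _; first by clear; lra.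
  apply: ler_wpM2r => //; apply: ler_wpM2l; first by clear; lra.
  rewrite -exprVn ler_pXn2r ?nnegrE ?invr_ge0 ?(ltW q0) ?(ltW k0) //.
  rewrite -[leRHS]invrK lef_pV2 ?posrE ?invr_gt0 // -qsq expr2.
  by apply: ler_piMl => //; exact: ltW.
(* The convexity parameter h = 15/64 has 1 - h = (7/8)^2, so a contraction by 7/8 brings the
   parameter (1 - h) a back to a. *)
have q3 : 15 / 64 * a / 2 * S <= (162 / 1000 * (9 / 4) ^+ n.-1) * Phi mu dd r0 a.
  have [h0 h1] : (0 < 15 / 64 :> R) /\ (15 / 64 < 1 :> R) by clear; split; lra.
  have P1 := Phi_moment mu_fin mdd dd_ge0 r0 dd_le h0 h1 a0.
  have [q0 q1] : (0 < 7 / 8 :> R) /\ (7 / 8 <= 1 :> R) by clear; split; lra.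
  have a'0 : 0 < (1 - 15 / 64) * a by apply: mulr_gt0 a0; clear; lra.
  have := Phi_scale mu_gt0 mu_fin mdd dd_ge0 r0_gt0 (K := 101 / 100 * (7 / 8) ^- n) _ q0 q1 a'0
    (fun r => volq _ r q0 q1).
  have -> : (1 - 15 / 64) * a / (7 / 8) ^+ 2 = a by field.
  rewrite -exprVn (_ : (7 / 8)^-1 = 8 / 7); last by field.
  have z0 : 0 < 101 / 100 * (8 / 7) ^+ n :> R by apply: mulr_gt0; [|apply: exprn_gt0]; clear; lra.
  move=> /(_ (ltW z0)) P2.
  have Pa0 : 0 <= Phi mu dd r0 a by apply: Rintegral_ge0 => x _; exact: ball_gauss_ge0.
  have P3 := ler_wpM2r Pa0 (growth_bound R n0); rewrite -/S in P1.
  clear - P1 P2 P3; lra.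
have tk : 1 <= (9 / 4) ^+ n.-1 * k ^+ n.
  by apply: mulr_ege1; apply: exprn_ege1 => //; clear; lra.
set t9 := (9 / 4) ^+ n.-1 in q3 tk *; set kn := k ^+ n in q2 tk *.
have t90 : 0 < t9 by apply: exprn_gt0; clear; lra.
have tm0 : 0 < t / mumin by rewrite divr_gt0.
(* 128/15 is 2 / h, and 128/15 * 0.162 * 1.01 is just below 1.397, which leaves 1/10 for the far
   part within 3/2. *)
have S1 : S <= 1397 / 1000 * (t9 * kn) * (t / mumin) * Phi mu dd r0 b.
  have -> : S = (128 / 15) * (t / mumin) * (15 / 64 * a / 2 * S).
    by rewrite /a; field; rewrite !lt0r_neq0.
  have H : 15 / 64 * a / 2 * S <= 162 / 1000 * t9 * (101 / 100 * kn * Phi mu dd r0 b).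
    by apply: le_trans q3 _; apply: ler_wpM2l q2; apply: mulr_ge0 (ltW t90); clear; lra.
  have c0 : 0 <= 128 / 15 * (t / mumin) by apply: mulr_ge0 (ltW tm0); clear; lra.
  apply: le_trans (ler_wpM2l c0 H) _.
  have X0 : 0 <= t9 * kn * (t / mumin) * Phi mu dd r0 b.
    by rewrite mulr_ge0 // mulr_ge0 ?(ltW tm0) // (le_trans ler01).
  clear - X0; lra.
have S2 : C1 * t ^+ 2 * Phi mu dd r0 b <= 1 / 10 * (t9 * kn) * (t / mumin) * Phi mu dd r0 b.
  apply: ler_wpM2r => //.
  apply: (@le_trans _ _ (1 / 10 * (t / mumin))); last first.
    by apply: ler_wpM2r; [exact: ltW | clear - tk; lra].
  have -> : 1 / 10 * (t / mumin) = t * (10 * mumin)^-1 by field; exact: lt0r_neq0.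
  rewrite expr2 mulrCA; apply: ler_wpM2l; first exact: ltW.
  rewrite -[leRHS]mul1r ler_pdivlMr ?mulr_gt0 //.
  move: tTW; rewrite -(ler_pM2r C1p) mulVf ?gt_eqF // => h.
  have X : 0 <= mumin * t by rewrite mulr_ge0 // ltW.
  clear - h X; lra.
rewrite -/w -/k -/kn -/t9.
apply: le_trans N1 _; apply: (@le_trans _ _ (3 / 2 * (t9 * kn) * (t / mumin) * Phi mu dd r0 b)).
  have X0 : 0 <= t9 * kn * (t / mumin) * Phi mu dd r0 b.
    by rewrite mulr_ge0 // mulr_ge0 ?(ltW tm0) // (le_trans ler01).
  clear - X0 S1 S2 N2; lra.
rewrite (mulrA (3 / 2) t9 kn); apply: ler_wpM2l => //.
apply: mulr_ge0 (ltW tm0); rewrite -mulrA.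
by apply: mulr_ge0 (le_trans ler01 tk).
Qed.

(** * Numerical bounds *)

Section euler_beta_bounds.
Context {R : realType}.
Local Notation mu := (@lebesgue_measure R).

(** A majorant of the integrand of B(1/2, n/2) for all n >= 1, with the explicit primitive F below,
    which increases by 4 from 0 to 1. *)
Let phi (t : R) := t `^ (- (1 / 2)) + (1 - t) `^ (- (1 / 2)).
Let F (t : R) := 2 * t `^ (1 / 2) - 2 * (1 - t) `^ (1 / 2).

Lemma is_derive_sqrt_diff (t : R) : 0 < t -> t < 1 -> is_derive t 1 F (phi t).
Proof.
move=> t0 t1; have t1' : 0 < 1 - t by rewrite subr_gt0.
have d1 : is_derive t 1 (fun s : R => s `^ (1 / 2)) (1 / 2 * t `^ (1 / 2 - 1)).
  exact: is_derive1_powR.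
have d2 : is_derive t 1 (fun s : R => (1 - s) `^ (1 / 2)) (- (1 / 2 * (1 - t) `^ (1 / 2 - 1))).
  have d3 := is_derive1_powR (1 / 2) t1'.
  have d4 : is_derive t 1 (fun s : R => 1 - s) (-1).
    split; first by apply/derivable1_diffP; exact: differentiableB.
    by rewrite -derive1E derive1_onem.
  have := @is_derive1_comp _ (fun s : R => s `^ (1 / 2)) (fun s : R => 1 - s) t _ _ d3 d4.
  by rewrite mulrN1.
have -> : phi t = 2 * (1 / 2 * t `^ (1 / 2 - 1)) - 2 * - (1 / 2 * (1 - t) `^ (1 / 2 - 1)).
  by rewrite /phi (_ : - (1 / 2) = 1 / 2 - 1); [field | field].
have -> : F = (2 \*o (fun s : R => s `^ (1 / 2))) - (2 \*o (fun s : R => (1 - s) `^ (1 / 2))).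
  by [].
exact: is_deriveB.
Qed.

Let sqrt_le1 (t : R) : 0 <= t -> t <= 1 -> 0 <= t `^ (1 / 2) <= 1.
Proof.
move=> t0 t1; rewrite powR_ge0 /=; apply: (@le_trans _ _ (1 `^ (1 / 2))); last by rewrite powR1.
by apply: ge0_ler_powR => //; rewrite nnegrE.
Qed.

Let phi_continuous (a b : R) : 0 < a -> b < 1 -> continuous_on phi a b.
Proof.
move=> a0 b1 t /andP[at_ tb].
have t0 : 0 < t by exact: lt_le_trans at_.
have t1 : 0 < 1 - t by rewrite subr_gt0 (le_lt_trans tb).
have c1 (s : R) : 0 < s -> {for s, continuous (fun s : R => s `^ (- (1 / 2)))}.
  move=> s0; apply: differentiable_continuous; apply/derivable1_diffP.
  by have [] := is_derive1_powR (- (1 / 2)) s0.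
have c2 : {for t, continuous (fun s : R => (1 - s) `^ (- (1 / 2)))}.
  apply: (@continuous_compose _ _ _ (fun s : R => 1 - s) (fun s : R => s `^ (- (1 / 2)))).
    by apply: differentiable_continuous; exact: differentiableB.
  exact: c1.
exact: (continuousD (c1 t t0) c2).
Qed.

Lemma integral_phi_le (a b : R) : 0 < a -> a < b -> b < 1 ->
  (\int[mu]_(x in `[a, b]) (phi x)%:E <= 4%:E)%E.
Proof.
move=> a0 ab b1.
have dF t : a <= t <= b -> is_derive t 1 F (phi t).
  move=> /andP[at_ tb]; apply: is_derive_sqrt_diff; first exact: lt_le_trans at_.
  exact: le_lt_trans b1.
have cF t : a <= t <= b -> {for t, continuous F}.
  move=> /dF[dF' _]; apply: differentiable_continuous; exact/derivable1_diffP.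
have aab : a <= a <= b by rewrite lexx ltW.
have bab : a <= b <= b by rewrite lexx ltW.
rewrite (@continuous_FTC2 R phi F) //.
- have a1 := lt_trans ab b1; have b0 := lt_trans a0 ab.
  have /andP[h1 h2] : 0 <= b `^ (1 / 2) <= 1 by apply: sqrt_le1; exact: ltW.
  have /andP[h3 h4] : 0 <= (1 - a) `^ (1 / 2) <= 1.
    by apply: sqrt_le1; [rewrite subr_ge0 ltW | rewrite gerBl ltW].
  have h5 : 0 <= (1 - b) `^ (1 / 2) by exact: powR_ge0.
  have h6 : 0 <= a `^ (1 / 2) by exact: powR_ge0.
  by rewrite -EFinB lee_fin /F; lra.
- exact/continuous_on_within/phi_continuous.
- split.
  + move=> t; rewrite in_itv /= => /andP[h1 h2].
    by have [] := dF t; rewrite ?(ltW h1) ?(ltW h2).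
  + by apply: cvg_at_right_filter; exact: cF.
  + by apply: cvg_at_left_filter; exact: cF.
- move=> t; rewrite in_itv /= => /andP[h1 h2]; rewrite derive1E.
  by have [|_ ->] := dF t; rewrite ?(ltW h1) ?(ltW h2).
Qed.

(** The integrand blows up at both ends, so the interval is exhausted by compact subintervals, on
    which the fundamental theorem of calculus applies. *)
Lemma integral_phi01_le : (\int[mu]_(x in `]0%R, 1%R[) (phi x)%:E <= 4%:E)%E.
Proof.
(* Starting at 1/3 makes every interval [e k, 1 - e k] nondegenerate. *)
pose e (k : nat) : R := k.+3%:R^-1.
have e0 k : 0 < e k by rewrite invr_gt0.
have e3 k : e k <= 3^-1 by rewrite lef_pV2 ?posrE // ler_nat.
have eS k m : (k <= m)%N -> e m <= e k.
  by move=> km; rewrite lef_pV2 ?posrE // ler_nat !ltnS.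
pose I k : set R := `[e k, 1 - e k]%classic.
have -> : `]0%R, 1%R[%classic = \bigcup_k I k.
  apply/seteqP; split => t; rewrite /= in_itv /=.
    move=> /andP[t0 t1].
    pose m := Num.min t (1 - t).
    have m0 : 0 < m by rewrite lt_min t0 subr_gt0.
    exists (Num.truncn m^-1) => //; rewrite /I /= in_itv /=.
    have em : e (Num.truncn m^-1) <= m.
      rewrite -[leRHS]invrK lef_pV2 ?posrE ?invr_gt0 //.
      apply: (@le_trans _ _ (Num.truncn m^-1).+1%:R); last first.
        by rewrite ler_nat; exact: leq_trans (leqnSn _) (leqnSn _).
      by apply: ltW; exact: truncnS_gt.
    move: em; rewrite le_min => /andP[h1 h2].
    by rewrite h1 lerBrDr addrC -lerBrDr.
  move=> [k _]; rewrite /I /= in_itv /= => /andP[h1 h2].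
  by rewrite (lt_le_trans (e0 k) h1) (le_lt_trans h2) // gtrBl.
have ek k : e k < 1 - e k by have := e3 k; have := e0 k; lra.
have H : (\int[mu]_(x in I i) (phi x)%:E @[i --> \oo] -->
    \int[mu]_(x in \bigcup_i I i) (phi x)%:E)%E.
  apply: ge0_nondecreasing_set_cvg_integral.
  - move=> k m km; apply/subsetPset => t; rewrite /I /= !in_itv /= => /andP[h1 h2].
    by have := eS k m km; rewrite (le_trans (eS k m km) h1) /=; lra.
  - by move=> k; exact: measurable_itv.
  - move=> k; have := @continuous_on_integrable R phi (e k) (1 - e k).
    move=> /(_ _)/measurable_int; apply; apply: phi_continuous => //.
    by rewrite gtrBl.
  - by move=> k x _; rewrite lee_fin addr_ge0 // powR_ge0.
rewrite -(cvg_lim _ H) //; apply: lime_le; first by apply/cvg_ex; eexists; exact: H.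
by apply: nearW => k; apply: integral_phi_le => //; rewrite gtrBl.
Qed.

Lemma euler_beta_half n : (0 < n)%N ->
  0 < euler_beta (1 / 2) (n%:R / 2) :> R /\ euler_beta (1 / 2) (n%:R / 2) <= 4 :> R.
Proof.
move=> n0; pose f (t : R) := t `^ (1 / 2 - 1) * (1 - t) `^ (n%:R / 2 - 1).
have f0 t : 0 <= f t by rewrite mulr_ge0 // powR_ge0.
have n1 : 1 <= n%:R :> R by rewrite ler1n.
have fphi t : 0 < t -> t < 1 -> f t <= phi t.
  move=> t0 t1; have t'0 : 0 < 1 - t by rewrite subr_gt0.
  have h1 : (1 - t) `^ (n%:R / 2 - 1) <= (1 - t) `^ (- (1 / 2)).
    by apply: ger_powR; [rewrite t'0 gerBl ltW | lra].
  rewrite /f /phi (_ : 1 / 2 - 1 = - (1 / 2) :> R); last by field.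
  apply: le_trans (ler_wpM2l (powR_ge0 _ _) h1) _; rewrite !powRN.
  set u := t `^ (1 / 2); set v := (1 - t) `^ (1 / 2).
  have u0 : 0 < u by exact: powR_gt0.
  have v0 : 0 < v by exact: powR_gt0.
  have uE : u ^+ 2 = t by rewrite -powR_mulrn ?powR_ge0 // -powRrM mul1r mulVf // powRr1 // ltW.
  have vE : v ^+ 2 = 1 - t by rewrite -powR_mulrn ?powR_ge0 // -powRrM mul1r mulVf // powRr1 // ltW.
  rewrite -invfM -[leLHS]mul1r ler_pdivrMr ?mulr_gt0 //.
  have -> : (u^-1 + v^-1) * (u * v) = u + v by field; rewrite !lt0r_neq0.
  (* u^2 + v^2 = 1 with u, v > 0 forces u + v >= 1. *)
  by nra.
pose g (t : R) := (f \_ `]0%R, 1%R[) t.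
pose B := (\int[mu]_(t in `]0%R, 1%R[) (f t)%:E)%E.
have Bub : (B <= 4%:E)%E.
  apply: (@le_trans _ _ (\int[mu]_(x in `]0%R, 1%R[) (phi x)%:E)%E);
    last exact: integral_phi01_le.
  rewrite /B integral_mkcond [leRHS]integral_mkcond.
  apply: nonneg_le_integral => t; rewrite !patchE; case: ifPn; rewrite ?lee_fin //.
  by rewrite inE /= in_itv /= => /andP[t0 t1]; exact: fphi.
(* On [1/4, 1/2], an interval of length 1/4, the first factor of f is at least 1 and the second at
   least (1 - t)^(n/2) >= c. The bounds are proved for the extended integral, because [euler_beta]
   would be 0 if it were infinite. *)
pose c : R := (1 / 2) `^ (n%:R / 2).
have c0 : 0 < c by apply: powR_gt0; lra.
have Blb : ((c / 4)%:E <= B)%E.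
  have -> : ((c / 4)%:E = \int[mu]_(t in `[(1 / 4)%R, (1 / 2)%R]) (cst c%:E t) :> \bar R)%E.
    rewrite integral_cst //= lebesgue_measure_itv /= lte_fin.
    rewrite (_ : (1 / 4 < 1 / 2 :> R) = true); last by apply/idP; lra.
    by rewrite -EFinB -EFinM; congr EFin; field.
  rewrite /B integral_mkcond [leRHS]integral_mkcond; apply: nonneg_le_integral => t; rewrite !patchE.
    by case: ifPn => //; rewrite lee_fin ltW.
  case: ifPn; last by case: ifPn; rewrite ?lee_fin.
  rewrite inE /= in_itv /= => /andP[t1 t2].
  have t01 : 0 < t < 1 by apply/andP; split; lra.
  rewrite mem_set /= ?in_itv //= lee_fin -[leLHS]mul1r.
  have /andP[t0 t1'] := t01.
  apply: ler_pM; [by [] | exact: ltW | |].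
    apply: (@le_trans _ _ (t `^ 0)); first by rewrite powRr0.
    by apply: ger_powR; [rewrite t0 ltW | lra].
  apply: (@le_trans _ _ ((1 - t) `^ (n%:R / 2))).
    apply: ge0_ler_powR; [by rewrite divr_ge0 | rewrite nnegrE; lra |
      rewrite nnegrE; lra | lra].
  apply: ger_powR; last by rewrite gerBl.
  by apply/andP; split; lra.
have Bfin : B \is a fin_num.
  rewrite ge0_fin_numE; first by apply: le_lt_trans Bub _; exact: ltry.
  by apply: le_trans Blb; rewrite lee_fin divr_ge0 // ltW.
have BE : euler_beta (1 / 2) (n%:R / 2) = fine B by [].
rewrite BE; split.
  by apply: (@lt_le_trans _ _ (c / 4)); [rewrite divr_gt0 | rewrite -lee_fin fineK].
by rewrite -lee_fin fineK.
Qed.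

End euler_beta_bounds.

(* [pi / 6 >= sin (pi / 6) = 1 / 2] by the triple-angle formula *)
Lemma pi_ge3 (R : realType) : 3 <= pi :> R.
Proof.
pose x : R := pi / 6; pose s := sin x.
have pi0 := @pi_gt0 R.
have x0 : 0 < x by rewrite divr_gt0.
have s0 : 0 < s by apply: sin_gt0_pihalf; rewrite /x; apply/andP; split; lra.
(* This is the factored form of 3 s - 4 s^3 = 1, the triple-angle formula at pi / 6. *)
have E : (s + 1) * (2 * s - 1) ^+ 2 = 0.
  have : sin (x + (x + x)) = 1.
    rewrite (_ : x + (x + x) = pi / 2); last by rewrite /x; field.
    exact: sin_pihalf.
  rewrite sinD sinD cosD -/s => H; have c := cos2Dsin2 x; rewrite -/s in c.
  have c2 : cos x ^+ 2 = 1 - s ^+ 2 by lra.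
  have : 3 * s * cos x ^+ 2 - s ^+ 3 = 1 by apply: etrans H; ring.
  rewrite c2 => H2.
  have -> : (s + 1) * (2 * s - 1) ^+ 2 = 1 - (3 * s * (1 - s ^+ 2) - s ^+ 3) by ring.
  by rewrite H2 subrr.
have s2 : s = 1 / 2.
  move/eqP: E; rewrite mulf_eq0 sqrf_eq0 => /orP[] /eqP h; lra.
have : s <= x.
  have [|c _] := @MVT_segment R sin cos 0 x (ltW x0) (fun y _ => is_derive_sin y).
    by apply: continuous_subspaceT; exact: continuous_sin.
  rewrite sin0 !subr0 -/s => ->; apply: ler_piMl; [exact: ltW | exact: cos_le1].
rewrite s2 /x; lra.
Qed.

(** * Kantorovich distance to a Dirac distribution *)

Section kantorovich_dirac.
Context {R : realType} {n : nat} {M : ptopologicalType}.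
Context {X : smooth_manifold R n M} (g : riemannian_metric X).
Hypothesis M_connected : connected [set: M].
Hypothesis M_compact : compact [set: M].

Lemma continuous_borel (f : M -> R) : continuous f ->
  measurable_fun [set: borel M] (f : borel M -> R).
Proof.
move=> cf; apply: (measurability _ (RGenOInfty.measurableE R)) => //.
move=> _ [_ [a ->] <-]; rewrite setTI; apply: open_borel.
have -> : f @^-1` `]a, +oo[%classic = f @^-1` [set s | a < s].
  by apply/seteqP; split => x /=; rewrite in_itv /= andbT.
by apply: open_comp => [x _|]; [exact: cf | exact: open_gt].
Qed.

Lemma rdist_measurable y : measurable_fun [set: borel M]
  ((fun x => rdist g x y) : borel M -> R).
Proof. by apply: continuous_borel; exact: rdist_continuous. Qed.

Lemma measurable_borel_set1 (y : M) : measurable ([set y] : set (borel M)).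
Proof.
rewrite -[X in measurable X]setCK; apply: measurableC; apply: open_borel.
apply: closed_openC; apply: accessible_closed_set1.
exact: hausdorff_accessible (manifold_hausdorff X).
Qed.

Variables (mu : probability (borel M) R) (y : M).

Lemma integral_fst (q : probability (borel M * borel M)%type R) :
  coupling mu (dirac (y : borel M)) q ->
  (\int[q]_z (rdist g z.1 y)%:E = \int[mu]_x (rdist g x y)%:E)%E.
Proof.
move=> Hq.
pose P := measure_function_pushforward__canonical__measure_function_Measure q
  (@measurable_fst _ _ (borel M) (borel M)).
have E : (\int[P]_x (rdist g x y)%:E = \int[mu]_x (rdist g x y)%:E)%E.
  apply: eq_measure_integral => A mA _.
  apply: etrans (Hq A mA).1; congr (q _).
  by apply/seteqP; split => -[a b] //= [].
have mf : measurable_fun [set: borel M] (fun x => (rdist g x y)%:E : \bar R).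
  by apply/measurable_EFinP; exact: rdist_measurable.
have f0 : {in [set: borel M], forall x, (0 <= (rdist g x y)%:E)%E}.
  by move=> x _; rewrite lee_fin; exact: rdist_ge0.
rewrite -E; apply/esym.
exact: (ge0_integral_pushforward (@measurable_fst _ _ (borel M) (borel M)) q
  measurableT mf f0).
Qed.

(** A coupling with the Dirac distribution charges only the slice where the second coordinate is y,
    and points are Borel because [M] is Hausdorff. *)
Lemma coupling_snd (q : probability (borel M * borel M)%type R) :
  coupling mu (dirac (y : borel M)) q ->
  measurable [set z : borel M * borel M | z.2 != y] /\
  q [set z : borel M * borel M | z.2 != y] = 0%E.
Proof.
move=> Hq; have m1 : measurable (~` [set y] : set (borel M)).
  by apply: measurableC; exact: measurable_borel_set1.
have -> : [set z : borel M * borel M | z.2 != y] = [set: borel M] `*` ~` [set y].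
  apply/seteqP; split => -[a b] /=; first by move=> /eqP by_; split.
  by move=> [_ /eqP].
split; first exact: measurableX.
by apply: etrans (Hq _ m1).2 _; rewrite /= diracE memNset // => /(_ erefl).
Qed.

(** Outside the null set of [coupling_snd] the cost equals d(z.1, y), a measurable function of the
    first coordinate, whose integral depends only on the marginal mu. *)
Lemma kantorovich_dirac_ge :
  (\int[mu]_x (rdist g x y)%:E <= kantorovich g mu (dirac (y : borel M)))%E.
Proof.
apply: le_ereal_inf_tmp => _ [q Hq <-].
have [mA qA] := coupling_snd Hq.
set A := [set z | _] in mA qA.
rewrite -(integral_fst Hq).
have mf : measurable_fun [set: borel M * borel M]
    (fun z : borel M * borel M => (rdist g z.1 y)%:E : \bar R).
  apply/measurable_EFinP; apply: (measurableT_comp (rdist_measurable y)).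
  exact: measurable_fst.
have f0 (z : borel M * borel M) : (0 <= (rdist g z.1 y)%:E)%E.
  by rewrite lee_fin; exact: rdist_ge0.
have -> : (\int[q]_z (rdist g z.1 y)%:E =
    \int[q]_(z in ~` A) (rdist g z.1 y)%:E)%E.
  rewrite -(setUv A) ge0_integral_setU //=; first last.
  - by apply/disj_setPS => z [].
  - by rewrite setUv.
  - exact: measurableC.
  rewrite (_ : (\int[q]_(x in A) _)%E = 0%E) ?add0e //.
  by apply: null_set_integral => //; exact: measurable_funTS.
rewrite integral_mkcond; apply: nonneg_le_integral => z.
  by rewrite patchE; case: ifP.
rewrite patchE; case: ifPn => [|_]; last by rewrite lee_fin; exact: rdist_ge0.
by rewrite inE /A /= => /negP; rewrite negbK => /eqP ->.
Qed.

Let graph_map (x : borel M) : borel M * borel M := (x, y).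

Lemma measurable_graph_map : measurable_fun setT graph_map.
Proof. by apply: measurable_fun_pair => //; exact: measurable_cst. Qed.

(** The competitor is the image of mu under x |-> (x, y). *)
Lemma kantorovich_dirac_le :
  (kantorovich g mu (dirac (y : borel M)) <= \int[mu]_x (rdist g x y)%:E)%E.
Proof.
pose h : {mfun borel M >-> (borel M * borel M)%type} :=
  HB.pack graph_map (isMeasurableFun.Build _ _ _ _ graph_map measurable_graph_map).
pose q : probability (borel M * borel M)%type R := distribution mu h.
have Hq : coupling mu (dirac (y : borel M)) q.
  move=> A mA; split.
    rewrite [LHS]/(mu (graph_map @^-1` (A `*` setT))); congr (mu _).
    by apply/seteqP; split => x //= [].
  rewrite [LHS]/(mu (graph_map @^-1` (setT `*` A))) [RHS]diracE.
  have [yA|yA] := boolP (y \in A).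
    have -> : graph_map @^-1` (setT `*` A) = setT.
      by apply/seteqP; split => x //= _; split => //; rewrite inE in yA.
    exact: probability_setT.
  have -> : graph_map @^-1` (setT `*` A) = set0.
    by apply/seteqP; split => x //= [_ /= ?]; move/negP: yA; apply; rewrite inE.
  exact: (measure0 mu).
apply: le_trans (ereal_inf_lbound _) _; first by exists q; [exact: Hq | reflexivity].
have [mA qA] := coupling_snd Hq.
set A := [set z | _] in mA qA.
rewrite -(integral_fst Hq).
pose D := diameter g.
have D0 : 0 <= D.
  apply: le_trans (rdist_le_diameter g M_connected M_compact y y).
  exact: rdist_ge0.
have mf : measurable_fun [set: borel M * borel M]
    (fun z : borel M * borel M => (rdist g z.1 y)%:E : \bar R).
  apply/measurable_EFinP; apply: (measurableT_comp (rdist_measurable y)).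
  exact: measurable_fst.
have mi : measurable_fun [set: borel M * borel M]
    (fun z => (D * \1_A z)%:E : \bar R).
  apply/measurable_EFinP; apply: measurable_funM => //; exact: measurable_indic.
(* On the null set A the cost is at most the diameter D, so adding D times the indicator of A gives
   a measurable majorant with the integral of d(z.1, y). *)
apply: (@le_trans _ _ (\int[q]_z ((rdist g z.1 y)%:E + (D * \1_A z)%:E))%E).
  apply: nonneg_le_integral => z; first by rewrite lee_fin; exact: rdist_ge0.
  rewrite indicE; case: (boolP (z \in A)) => zA.
    rewrite mulr1 -EFinD lee_fin; apply: ler_wpDl; first exact: rdist_ge0.
    exact: rdist_le_diameter.
  rewrite mulr0 adde0; move: zA; rewrite notin_setE /A /= => /negP; rewrite negbK.
  by move=> /eqP ->.
rewrite ge0_integralD //; first last.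
- by move=> z _; rewrite lee_fin mulr_ge0 // indicE.
- by move=> z _; rewrite lee_fin; exact: rdist_ge0.
rewrite [X in (_ + X)%E](_ : _ = 0%E) ?adde0 //.
under eq_integral do rewrite EFinM.
have mI : measurable_fun [set: borel M * borel M] (fun z => (\1_A z)%:E : \bar R).
  by apply/measurable_EFinP; exact: measurable_indic.
have I0 (z : borel M * borel M) : setT z -> (0 <= (\1_A z)%:E :> \bar R)%E.
  by move=> _; rewrite lee_fin indicE.
have D0E : (0 <= D%:E)%E by rewrite lee_fin.
rewrite (ge0_integralZl _ measurableT mI I0 D0E).
by rewrite integral_indic // setIT [X in (_ * X)%E]qA mule0.
Qed.

End kantorovich_dirac.

(** * Barycentres of concentrated distributions *)

Section barycentre.
Context {R : realType} {n : nat} {M : ptopologicalType}.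
Context {X : smooth_manifold R n M} (g : riemannian_metric X).
Hypothesis M_connected : connected [set: M].
Hypothesis M_compact : compact [set: M].
Variables (mu : probability (borel M) R) (y : M).

Lemma barycentre_dist (eta : R) (xhat : M) : 0 < eta -> is_barycentre g mu xhat ->
  (kantorovich g mu (dirac (y : borel M)) < (eta ^+ 2 / (4 * diameter g))%:E)%E ->
  rdist g xhat y < eta.
Proof.
move=> eta0 bar W.
set D := diameter g in W.
have dD x z : rdist g x z <= D by exact: rdist_le_diameter.
have d0 x z : 0 <= rdist g x z by exact: rdist_ge0.
have mufin : (mu setT < +oo)%E by rewrite probability_setT ltry.
have bdist z : bounded_measurable (fun x : borel M => rdist g x z).
  split; first exact: rdist_measurable.
  by exists D => x; rewrite ger0_norm.
have bsq z : bounded_measurable (fun x : borel M => rdist g z x ^+ 2).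
  have -> : (fun x : borel M => rdist g z x ^+ 2) =
      (fun x : borel M => rdist g x z * rdist g x z).
    by apply/funext => x; rewrite expr2 rdist_sym.
  exact: bounded_measurableM.
have JE (f : borel M -> R) : bounded_measurable f ->
    (\int[mu]_x (f x)%:E = (\int[mu]_(x in setT) (f x)%R)%:E)%E.
  by move=> bf; rewrite fineK //; apply: integrable_fin_num => //;
    exact: bounded_measurable_integrable.
have := le_lt_trans (kantorovich_dirac_ge g M_connected mu y) W.
rewrite JE // lte_fin; set w := (X in X < _ -> _) => wD.
have w0 : 0 <= w by apply: Rintegral_ge0 => x _; exact: d0.
(* If D were 0, the quotient by 4 D would be 0 by convention, and no mean distance w >= 0 lies below
   it. *)
have D0 : 0 < D.
  rewrite lt_neqAle (le_trans (d0 y y) (dD y y)) andbT; apply/eqP => D0.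
  by move: wD; rewrite -D0 mulr0 invr0 mulr0 ltNge w0.
have := bar y; rewrite /variance_function !JE // -!EFinM lee_fin.
rewrite ler_pM2l ?invr_gt0 //; set A := (X in X <= _); set B := (X in _ <= X) => AB.
have B1 : B <= D * w.
  rewrite -(J_scale mufin) //; apply: (le_J mufin) => //.
    by apply: bounded_measurableM => //; exact: bounded_measurable_cst.
  move=> x; rewrite expr2 (rdist_sym g M_connected y x).
  by apply: ler_wpM2r.
have A1 : rdist g xhat y ^+ 2 <= A + 2 * D * w.
  have bz := bounded_measurableM (bounded_measurable_cst (borel M) (2 * D)) (bdist y).
  rewrite -(J_scale mufin) // -(J_add mufin) //.
  apply: (@le_trans _ _ (\int[mu]_(x in setT) (rdist g xhat y ^+ 2)%R)).
    by rewrite J_cst [X in fine X]probability_setT mulr1.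
  apply: (le_J mufin).
  - exact: bounded_measurable_cst.
  - exact: bounded_measurableD.
  move=> x.
  have h1 := rdist_triangle g M_connected xhat x y.
  have h2 := dD xhat x; have h3 := dD xhat y; have h4 := d0 xhat x.
  have h5 := d0 x y; have h6 := d0 xhat y.
  move: h1 h2 h3 h4 h5 h6; set p := rdist g xhat y; set r := rdist g xhat x.
  set s := rdist g x y; clear => h1 h2 h3 h4 h5 h6.
  (* If p > r, then p^2 - r^2 = (p - r)(p + r), where p - r <= s by the triangle inequality and p +
     r <= 2 D. *)
  have [pr|rp] := leP p r.
    by rewrite -[leLHS]addr0; apply: lerD; [rewrite ler_pXn2r | rewrite mulr_ge0 //; lra].
  have -> : p ^+ 2 = r ^+ 2 + (p - r) * (p + r) by ring.
  rewrite lerD2l mulrC; apply: ler_pM; lra.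
(* The hypothesis reads 4 D w < eta^2, which is more than the 3 D w obtained. *)
have F : rdist g xhat y ^+ 2 < eta ^+ 2.
  move: wD; rewrite ltr_pdivlMr ?mulr_gt0 // => wD.
  have Dw : 0 <= D * w by rewrite mulr_ge0 // ltW.
  move: A1 AB B1 wD Dw; clear; lra.
by rewrite -(@ltr_pXn2r _ 2) ?nnegrE // ltW.
Qed.

End barycentre.

(** * Gibbs distributions *)

Lemma root_above1 (R : realType) (m : nat) : (0 < m)%N ->
  exists2 K : R, 1 < K & K ^+ m = 101 / 100.
Proof.
move=> m0; have h : 1 < 101 / 100 :> R by lra.
have h0 : 0 < 101 / 100 :> R by lra.
exists (expR (ln (101 / 100) / m%:R)).
  by rewrite expR_gt1 divr_gt0 ?ltr0n // ln_gt0.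
by rewrite -expRM_natl mulrC divfK ?lnK // pnatr_eq0 -lt0n.
Qed.

(** The square of K contains 8 pi / B^2 >= 24 / 16 = 3/2 and (pi / 2)^2 >= 9/4 to the power n - 1;
    the other factors agree. *)
Lemma moment_constant (R : realType) (n : nat) (mumin mumax T : R) :
  (0 < n)%N -> 0 < mumin -> 0 < mumax -> 0 < T ->
  let K := (8 * pi) `^ (1 / 2) * (euler_beta (1 / 2) (n%:R / 2))^-1
    * (pi / 2) ^+ (n - 1) * (mumax / mumin) `^ (n%:R / 2) * (T / mumin) `^ (1 / 2) in
  0 < K /\
  3 / 2 * (9 / 4) ^+ n.-1 * (mumax / mumin) ^+ n * (T / mumin) <= K ^+ 2.
Proof.
move=> n_gt0 mumin_gt0 mumax_gt0 T0 K; have [B0 B4] := @euler_beta_half R n n_gt0.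
move: B0 B4; set B := euler_beta _ _ => B0 B4.
have p3 := pi_ge3 R; have p0 := @pi_gt0 R.
have k0 : 0 < mumax / mumin by rewrite divr_gt0.
have t0 : 0 < T / mumin by rewrite divr_gt0.
have p8 : 0 < 8 * pi :> R by rewrite mulr_gt0.
have p2 : 0 < pi / 2 :> R by rewrite divr_gt0.
have sq (x y : R) : 0 <= x -> (x `^ (y / 2)) ^+ 2 = x `^ y.
  by move=> x0; rewrite -powR_mulrn ?powR_ge0 // -powRrM divfK.
have K0 : 0 < K.
  by rewrite !mulr_gt0 ?powR_gt0 // ?invr_gt0 // exprn_gt0.
split => //.
have -> : K ^+ 2 = 8 * pi * B ^- 2 * ((pi / 2) ^+ 2) ^+ n.-1
    * (mumax / mumin) ^+ n * (T / mumin).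
  have e5 (a b c e f : R) :
    (a * b * c * e * f) ^+ 2 = a ^+ 2 * b ^+ 2 * c ^+ 2 * e ^+ 2 * f ^+ 2.
    by rewrite !exprMn.
  rewrite /K subn1 e5 !sq ?ltW // powR_mulrn ?ltW // !powRr1 ?ltW //.
  by rewrite exprVn exprAC.
apply: ler_wpM2r; first exact: ltW.
apply: ler_wpM2r; first by rewrite exprn_ge0 // ltW.
apply: ler_pM.
- by clear; lra.
- by apply: exprn_ge0; clear; lra.
- rewrite ler_pdivlMr ?exprn_gt0 //.
  have : B ^+ 2 <= 4 ^+ 2 by rewrite ler_pXn2r ?nnegrE // ltW.
  move: p3; clear; lra.
- by apply: lerXn2r; rewrite ?nnegrE ?sqr_ge0 //; move: p3; clear; nra.
Qed.

Section gibbs_measure.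
Context {R : realType} {n : nat} {M : ptopologicalType}.
Context {X : smooth_manifold R n M} (g : riemannian_metric X).
Hypothesis n_gt0 : (0 < n)%N.
Hypothesis M_connected : connected [set: M].
Hypothesis M_compact : compact [set: M].
Variable vol : {measure set (borel M) -> \bar R}.
Hypothesis vol_riemannian : is_riemannian_volume g vol.

Lemma rball_ratio p : exists2 r0, 0 < r0 & forall r, 0 < r -> r <= r0 ->
  (0 < vol (rball g p r))%E /\ forall q, 0 < q -> q <= 1 ->
    (vol (rball g p r) <= (101 / 100 * q ^- n)%:E * vol (rball g p (q * r)))%E.
Proof.
have [C C0 H] := rball_volume M_connected vol_riemannian p.
(* The factor K^(n+1) is lost twice, above at radius r and below at radius q r, hence a root of
   order 2 n + 2 of 101/100. *)
have [K K1 EK] := root_above1 R (ltn0Sn (n + n).+1).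
have K0 : 0 < K by exact: lt_trans K1.
have [r0 r00 Hr] := H K K1; exists r0 => // r rp rr0.
have /andP[h1 h2] := Hr r rp rr0.
have Kn : 0 < K ^+ n.+1 by rewrite exprn_gt0.
split.
  apply: lt_le_trans h1; rewrite lte_fin.
  by rewrite !mulr_gt0 ?exprn_gt0 // invr_gt0.
move=> q q0 q1; have qr : q * r <= r0 by apply: le_trans rr0; rewrite ler_piMl // ltW.
have /andP[h3 _] := Hr (q * r) (mulr_gt0 q0 rp) qr.
apply: le_trans h2 _.
have c0 : 0 <= 101 / 100 * q ^- n.
  by apply: mulr_ge0; [lra | rewrite invr_ge0 exprn_ge0 // ltW].
apply: le_trans (lee_wpmul2l _ h3); last by rewrite lee_fin.
rewrite -EFinM lee_fin -EK le_eqVlt; apply/orP; left; apply/eqP.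
have -> : ((n + n).+2 = n.+1 + n.+1)%N by rewrite addnS addSn.
rewrite exprD exprMn exprVn; field.
by rewrite !expf_neq0 //; exact: lt0r_neq0.
Qed.

(** Otherwise the balls of radii s and s / 2 would coincide for a small s, although their volumes
    differ by a factor of nearly 2^n >= 2. The contradiction is 2 <= 101/100. *)
Lemma rball_nontrivial p (r : R) : 0 < r -> exists x, 0 < rdist g x p < r.
Proof.
move=> rp; have [C C0 H] := rball_volume M_connected vol_riemannian p.
have [K K1 EK] := root_above1 R (ltn0Sn (n + n).+1).
have K0 : 0 < K by exact: lt_trans K1.
have [r0 r00 Hr] := H K K1.
pose s := Num.min r r0.
have s0 : 0 < s by rewrite lt_min rp.
have sr0 : s <= r0 by rewrite ge_min lexx orbT.
have s20 : 0 < s / 2 by rewrite divr_gt0.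
have s2 : s / 2 <= r0 by apply: le_trans sr0; rewrite ler_pdivrMr // ler_peMr ?ltW // ltr1n.
have /andP[h1 _] := Hr s s0 sr0.
have /andP[_ h2] := Hr (s / 2) s20 s2.
apply: contrapT => nx.
have sub : rball g p s `<=` rball g p (s / 2).
  move=> x xs; rewrite /rball /=; apply: (@le_lt_trans _ _ 0) => //.
  rewrite leNgt; apply/negP => x0; apply: nx; exists x; rewrite x0 /=.
  by apply: lt_le_trans xs _; rewrite ge_min lexx.
have lm : (vol (rball g p s) <= vol (rball g p (s / 2)))%E.
  by apply: le_measure sub; rewrite inE; exact: measurable_rball.
have := le_trans h1 (le_trans lm h2); rewrite lee_fin.
have Kn : 0 < K ^+ n.+1 by rewrite exprn_gt0.
have t0 : 0 < C * s ^+ n by rewrite mulr_gt0 // exprn_gt0.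
have e2 : 2 <= 2 ^+ n :> R by rewrite -[leLHS]expr1 ler_eXn2l // ltr1n.
rewrite exprVn -mulrA mulrC ler_pdivrMr //.
have -> : K ^+ n.+1 * C * (s / 2) ^+ n * K ^+ n.+1 = 101 / 100 * (C * s ^+ n) / 2 ^+ n.
  rewrite -EK (_ : (n + n).+2 = n.+1 + n.+1)%N; last by rewrite addnS addSn.
  by rewrite exprD exprMn exprVn; ring.
rewrite ler_pdivlMr ?exprn_gt0 // mulrC ler_pM2r //.
by move=> /(le_trans e2); lra.
Qed.

Variables (U : M -> R) (xs : M) (piT : R -> probability (borel M) R).
Hypothesis U_continuous : continuous U.
Hypothesis piT_gibbs : forall T, 0 < T ->
  forall A : set (borel M), measurable A -> piT T A = gibbs vol U T A.

(** Since [piT T] has total mass 1, the product of 1 / Z and the extended integral is 1. An infinite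
    or zero integral would give Z = 0, hence 1 / Z = 0 by convention, and the product 0. *)
Lemma partition_function_fin T : 0 < T ->
  (\int[vol]_(x in [set: borel M]) (expR (- (U x / T)))%:E =
    (partition_function vol U T)%:E)%E /\ 0 < partition_function vol U T.
Proof.
move=> T0; pose Z := partition_function vol U T.
pose I := (\int[vol]_(x in [set: borel M]) (expR (- (U x / T)))%:E)%E.
have ZI : Z = fine I by [].
have I0 : (0 <= I)%E by apply: integral_ge0 => x _; rewrite lee_fin expR_ge0.
have P1 : ((Z^-1)%:E * I = 1)%E.
  by rewrite -(probability_setT (piT T)) piT_gibbs.
have Ifin : I \is a fin_num.
  rewrite ge0_fin_numE // ltNge leye_eq; apply/negP => /eqP Ioo.
  by move: P1; rewrite ZI Ioo /= invr0 mul0e => /eqP; rewrite lt_eqF.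
have IZ : I = Z%:E by rewrite ZI fineK.
split; first exact: IZ.
rewrite -/Z lt_neqAle -lee_fin -IZ I0 andbT; apply/eqP => Z0.
by move: P1; rewrite -Z0 invr0 mul0e => /eqP; rewrite lt_eqF.
Qed.

Lemma potential_bound : exists B : R, forall x, U x <= B.
Proof.
have M0 : [set: M] !=set0 by exists xs.
have cU : {within [set: M], continuous U} by exact: continuous_subspaceT.
have [c _ H] := compact_EVT_max M0 M_compact cU.
by exists (U c) => x; apply: H; rewrite inE.
Qed.

(** The potential is bounded above by compactness, so the finite integral Z(1) dominates a positive
    multiple of the volume. *)
Lemma vol_finite : (vol setT < +oo)%E.
Proof.
have [B UB] := potential_bound.
have [I1 _] := partition_function_fin (ltr01 : 0 < 1 :> R).
have c0 : 0 < expR (- B) by exact: expR_gt0.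
have : ((expR (- B))%:E * vol setT <= (partition_function vol U 1)%:E)%E.
  rewrite -I1 -integral_cst //; apply: nonneg_le_integral => x.
    by rewrite lee_fin ltW.
  by rewrite lee_fin ler_expR lerN2 divr1.
by rewrite -lee_pdivlMl // => /le_lt_trans; apply; rewrite -EFinM ltry.
Qed.

Hypothesis U_min : forall x, x <> xs -> U xs < U x.

Lemma potential_gap (r : R) : 0 < r ->
  exists2 u, 0 < u & forall x, r <= rdist g x xs -> u <= U x - U xs.
Proof.
move=> r0; pose S : set M := [set x | r <= rdist g x xs].
have cS : closed S.
  have -> : S = (fun x => rdist g x xs) @^-1` [set s | r <= s] by [].
  by apply: closed_comp => [x _|]; [exact: rdist_continuous | exact: closed_ge].
have kS : compact S by apply: subclosed_compact cS M_compact _.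
have [S0|S0] := pselect (S !=set0); last first.
  by exists 1 => // x xr; exfalso; apply: S0; exists x.
have cU : {within S, continuous U} by exact: continuous_subspaceT.
have [c Sc H] := compact_EVT_min S0 kS cU.
exists (U c - U xs).
  rewrite subr_gt0; apply: U_min => cx; move: Sc.
  by rewrite inE /S /= cx rdist_xx // leNgt r0.
by move=> x xr; rewrite lerD2r; apply: H; rewrite inE.
Qed.

Variables mumin mumax rho : R.
Hypotheses (mumin_gt0 : 0 < mumin) (mumax_gt0 : 0 < mumax) (rho_gt0 : 0 < rho).
Hypothesis U_quadratic : forall x, rdist g x xs <= rho ->
  mumin * rdist g x xs ^+ 2 <= 2 * (U x - U xs) <= mumax * rdist g x xs ^+ 2.

(** The two quadratic bounds are compared at one point near the minimum and distinct from it. The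
    contraction factor (mumin / mumax)^(1/2) is thereby at most 1. *)
Lemma mumin_le_mumax : mumin <= mumax.
Proof.
have [x /andP[x0 xr]] := rball_nontrivial xs rho_gt0.
have /andP[h1 h2] := U_quadratic (ltW xr).
by have := le_trans h1 h2; rewrite ler_pM2r // exprn_gt0.
Qed.

Lemma gibbs_moment_bound : exists2 TW, 0 < TW & forall T, 0 < T -> T <= TW ->
  (\int[piT T]_x (rdist g x xs ^+ 2)%:E <=
    (3 / 2 * (9 / 4) ^+ n.-1 * (mumax / mumin) ^+ n * (T / mumin))%:E)%E.
Proof.
have [r1 r10 Hr] := rball_ratio xs.
(* Within r0 both the volume ratios and the quadratic bounds on U are available. *)
pose r0 := Num.min r1 rho.
have r00 : 0 < r0 by rewrite lt_min r10.
have r01 : r0 <= r1 by rewrite ge_min lexx.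
have r0rho : r0 <= rho by rewrite ge_min lexx orbT.
have [u u0 Hu] := potential_gap r00.
pose dd (x : borel M) := rdist g x xs.
pose V (x : borel M) := U x - U xs.
have mdd : measurable_fun setT dd by exact: rdist_measurable.
have mU : measurable_fun setT (U : borel M -> R) by exact: continuous_borel.
have mV : measurable_fun setT V by exact: measurable_funB.
have V0 x : 0 <= V x.
  rewrite subr_ge0; have [->//|nx] := pselect (x = xs); exact/ltW/U_min.
have volpos r : 0 < r -> (0 < vol [set x | dd x < r]%R)%E.
  move=> rp; have rm : 0 < Num.min r r0 by rewrite lt_min rp.
  have mr : Num.min r r0 <= r1 by apply: le_trans r01; rewrite ge_min lexx orbT.
  apply: lt_le_trans (Hr _ rm mr).1 _; apply: le_measure; rewrite ?inE.
  - exact: measurable_rball.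
  - exact: (measurable_rball g M_connected xs r).
  - by move=> x; rewrite /rball /= lt_min => /andP[].
have vol0 : (0 < vol setT)%E.
  apply: lt_le_trans (volpos 1 ltr01) _; apply: le_measure; rewrite ?inE //.
  exact: (measurable_rball g M_connected xs 1).
have dd0 x : 0 <= dd x by exact: rdist_ge0.
have ddD x : dd x <= diameter g by exact: rdist_le_diameter.
have Vin x : dd x < r0 -> mumin * dd x ^+ 2 <= 2 * V x <= mumax * dd x ^+ 2.
  by move=> xr; apply: U_quadratic; exact: le_trans (ltW xr) r0rho.
have volq q r : 0 < q -> q <= 1 -> 0 < r -> r <= r0 ->
    (vol [set x | dd x < r]%R <=
       (101 / 100 * q ^- n)%:E * vol [set x | dd x < q * r]%R)%E.
  by move=> q0 q1 rp rr; apply: (Hr r rp (le_trans rr r01)).2.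
have [TW TW0 H] := gibbs_second_moment vol0 vol_finite mdd dd0 ddD r00 n_gt0 mV V0
  mumin_gt0 mumin_le_mumax u0 Vin Hu volq volpos.
exists TW => // T T0 TTW.
have {}H := H T T0 TTW.
have [EZ Z0] := partition_function_fin T0.
set Z := partition_function vol U T in EZ Z0.
pose w (x : borel M) := expR (- (U x / T)).
have mw : measurable_fun setT w.
  by apply: measurableT_comp => //; apply: measurable_funN; exact: measurable_funM.
have w0 x : 0 <= w x by exact: expR_ge0.
have Z'0 : 0 <= Z^-1 by rewrite invr_ge0 ltW.
have d20 (x : borel M) : (0 <= (dd x ^+ 2)%:E)%E by rewrite lee_fin sqr_ge0.
apply: le_trans (integral_density_le (mu := vol) mw w0 Z'0 (piT_gibbs T0) d20) _.
(* Replacing U by V = U - U(xs) divides the moment integral and Z by the same factor e, which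
   cancels. *)
pose e := expR (- (U xs / T)).
have e0 : 0 < e by exact: expR_gt0.
pose v (x : borel M) := expR (- (V x / T)).
have wv x : w x = e * v x.
  by rewrite /e /v -expRD; congr expR; rewrite /V; field; exact: lt0r_neq0.
have bv : bounded_measurable v.
  apply: bounded_measurable_exp; first exact: measurable_funM.
  by move=> x; rewrite divr_ge0 // ltW.
have bdv : bounded_measurable (fun x => dd x ^+ 2 * v x).
  exact: bounded_measurableM (bounded_measurable_sqr mdd dd0 ddD) bv.
have JE (f : borel M -> R) : bounded_measurable f ->
    (\int[vol]_x (f x)%:E = (\int[vol]_(x in setT) (f x)%R)%:E)%E.
  by move=> bf; rewrite fineK //; apply: integrable_fin_num => //;
    exact: (bounded_measurable_integrable vol_finite).
have ZE : Z = e * \int[vol]_(x in setT) (v x)%R.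
  rewrite -(J_scale vol_finite) // /Z /partition_function.
  by apply: eq_Rintegral => x _; exact: wv.
under eq_integral => x _ do rewrite wv -EFinM mulrCA.
have bedv := bounded_measurableM (bounded_measurable_cst (borel M) e) bdv.
rewrite (JE _ bedv) -EFinM lee_fin (J_scale vol_finite) //.
rewrite ler_pdivrMl // ZE -[leRHS]mulrA ler_pM2l // [leRHS]mulrC.
exact: H.
Qed.

Lemma kantorovich_gibbs_le : exists2 TW : R, 0 < TW &
  forall T, 0 < T -> T <= TW ->
  (kantorovich g (piT T) (dirac (xs : borel M))
     <= ((8 * pi) `^ (1 / 2) * (euler_beta (1 / 2) (n%:R / 2))^-1
         * (pi / 2) ^+ (n - 1) * (mumax / mumin) `^ (n%:R / 2)
         * (T / mumin) `^ (1 / 2))%:E)%E.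
Proof.
have [TW TW0 H] := gibbs_moment_bound.
exists TW => // T T0 TTW.
have [] := moment_constant n_gt0 mumin_gt0 mumax_gt0 T0.
set K := (X in 0 < X) => K0 HK; rewrite -/K.
apply: le_trans (kantorovich_dirac_le g M_connected M_compact (piT T) xs) _.
have m2 : (\int[piT T]_x (rdist g x xs ^+ 2)%:E <= (K ^+ 2)%:E)%E.
  by apply: le_trans (H T T0 TTW) _; rewrite lee_fin.
have c0 : 0 <= (2 * K)^-1 by rewrite invr_ge0 mulr_ge0 // ltW.
(* AM-GM: [d <= d^2 / (2 K) + K / 2] *)
apply: (@le_trans _ _ (\int[piT T]_x (((2 * K)^-1)%:E * (rdist g x xs ^+ 2)%:E
   + (K / 2)%:E))%E).
  apply: nonneg_le_integral => x; first by rewrite lee_fin; exact: rdist_ge0.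
  rewrite -EFinM -EFinD lee_fin; set d := rdist g x xs.
  rewrite -subr_ge0 (_ : _ - d = (d - K) ^+ 2 / (2 * K)).
    by rewrite divr_ge0 ?sqr_ge0 // mulr_ge0 // ltW.
  by field; exact: lt0r_neq0.
have md : measurable_fun [set: borel M]
    (fun x : borel M => (rdist g x xs ^+ 2)%:E : \bar R).
  by apply/measurable_EFinP; apply: measurable_funX; exact: rdist_measurable.
have d0 (x : borel M) : setT x -> (0 <= (rdist g x xs ^+ 2)%:E)%E.
  by move=> _; rewrite lee_fin sqr_ge0.
have mcd : measurable_fun [set: borel M]
    (fun x : borel M => ((2 * K)^-1)%:E * (rdist g x xs ^+ 2)%:E : \bar R)%E.
  exact: emeasurable_funM.
have cd0 (x : borel M) : setT x -> (0 <= ((2 * K)^-1)%:E * (rdist g x xs ^+ 2)%:E)%E.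
  by move=> _; apply: mule_ge0; rewrite lee_fin ?sqr_ge0.
have mK : measurable_fun [set: borel M] (fun _ : borel M => (K / 2)%:E : \bar R).
  exact: measurable_cst.
have K20 (x : borel M) : setT x -> (0 <= (K / 2)%:E)%E.
  by move=> _; rewrite lee_fin divr_ge0 // ltW.
have c0E : (0 <= ((2 * K)^-1)%:E)%E by rewrite lee_fin.
rewrite (ge0_integralD _ measurableT cd0 mcd K20 mK).
rewrite (ge0_integralZl _ measurableT md d0 c0E) integral_cst //.
rewrite [X in (_ + _ * X)%E](_ : _ = 1%E) ?mule1; last exact: probability_setT.
apply: (@le_trans _ _ (((2 * K)^-1)%:E * (K ^+ 2)%:E + (K / 2)%:E)%E).
  by apply: leeD => //; apply: lee_wpmul2l.
rewrite -EFinM -EFinD lee_fin le_eqVlt; apply/orP; left; apply/eqP.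
by field; exact: lt0r_neq0.
Qed.

End gibbs_measure.

Unset Implicit Arguments.

Theorem proposition2p1 (R : realType) (n : nat) (M : ptopologicalType)
    (X : smooth_manifold R n M) (g : riemannian_metric X)
    (vol : {measure set (borel M) -> \bar R})
    (U : M -> R) (xs : M) (mumin mumax rho : R)
    (piT : R -> probability (borel M) R)
    (n_gt0 : (0 < n)%N)
    (M_compact : compact [set: M])
    (M_connected : connected [set: M])
    (M_orientable : orientable X)
    (M_positive : positive_sectional_curvature g)
    (vol_riemannian : is_riemannian_volume g vol)
    (U_continuous : continuous U)
    (U_min : forall x, x <> xs -> U xs < U x)
    (mumin_gt0 : 0 < mumin) (mumax_gt0 : 0 < mumax) (rho_gt0 : 0 < rho)
    (U_quadratic : forall x, rdist g x xs <= rho ->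
       mumin * rdist g x xs ^+ 2 <= 2 * (U x - U xs)
         <= mumax * rdist g x xs ^+ 2)
    (piT_gibbs : forall T, 0 < T ->
       forall A : set (borel M), measurable A -> piT T A = gibbs vol U T A) :
  (forall eta T : R, 0 < eta -> 0 < T ->
     forall xhat : M, is_barycentre g (piT T) xhat ->
     (kantorovich g (piT T) (dirac (xs : borel M))
        < (eta ^+ 2 / (4 * diameter g))%:E)%E ->
     rdist g xhat xs < eta)
  /\
  (exists2 TW : R, 0 < TW &
     forall T, 0 < T -> T <= TW ->
     (kantorovich g (piT T) (dirac (xs : borel M))
        <= ((8 * pi) `^ (1 / 2)
            * (euler_beta (1 / 2) (n%:R / 2))^-1
            * (pi / 2) ^+ (n - 1)
            * (mumax / mumin) `^ (n%:R / 2)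
            * (T / mumin) `^ (1 / 2))%:E)%E).
Proof.
split; first by move=> eta T eta0 _ xhat; exact: barycentre_dist.
exact: (kantorovich_gibbs_le n_gt0 M_connected M_compact vol_riemannian
  U_continuous piT_gibbs U_min mumin_gt0 mumax_gt0 rho_gt0 U_quadratic).
Qed.
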